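(* Let $g\in C^2(\Gamma)$ be a generating function satisfying conditions A1, A2 and A1*. Then condition A3w is invariant under duality, that is, $g$ satisfies A3w if and only if its dual generating function $g^*$ satisfies A3w$^*$. Moreover, condition A3w is equivalent to each of the following two conditions: A3w(1): for all $x_0,u_0,p_0,p_1$ with $\{x_0\}\times\{u_0\}\times[p_0,p_1]\subset\mathcal U$, the set $S_1$ is locally $g$-convex at $x_0$ with respect to $(y_0,z_0)$. A3w(2): for all $x_0,u_0,p_0,p_1$ with $\{x_0\}\times\{u_0\}\times[p_0,p_1]\subset\mathcal U$, there exists a neighbourhood $\mathcal N_0$ of $x_0$ such that $$g(x,y_\theta,z_\theta)\le\max\{g(x,y_0,z_0),\,g(x,y_1,z_1)\}$$ for all $x\in\mathcal N_0$ and all $\theta\in[0,1]$.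
   Context: Setting. $\Gamma\subset\mathbb R^n\times\mathbb R^n\times\mathbb R$ is a domain whose projections $I(x,y)=\{z\in\mathbb R: (x,y,z)\in\Gamma\}$ are open intervals. A generating function is $g=g(x,y,z)\in C^2(\Gamma)$ with $g_z<0$ in $\Gamma$. Subscripts denote partial derivatives; $[p_0,p_1]$ is the closed straight segment joining $p_0$ and $p_1$. Set $\mathcal U=\{(x,g(x,y,z),g_x(x,y,z)) : (x,y,z)\in\Gamma\}\subset\mathbb R^n\times\mathbb R\times\mathbb R^n$ and $\mathcal U(x,u)=\{p\in\mathbb R^n:(x,u,p)\in\mathcal U\}$. A1: for each $(x,u,p)\in\mathcal U$ there is a unique point $(x,y,z)\in\Gamma$ with $g(x,y,z)=u$, $g_x(x,y,z)=p$. One writes $Y(x,u,p)=y$, $Z(x,u,p)=z$. A2: $\det E\ne0$ in $\Gamma$, where $E=g_{x,y}-(g_z)^{-1}g_{x,z}\otimes g_y$. A1*: with $Q:=-g_y/g_z$, for all $(y,z)$ the map $x\mapsto Q(x,y,z)$ is one-to-one on $\{x:(x,y,z)\in\Gamma\}$. A3w: with $A(x,u,p)=g_{xx}(x,Y(x,u,p),Z(x,u,p))$ on $\mathcal U$, for every $\xi\in\mathbb R^n$ and every $(x,u)\in\mathbb R^n\times\mathbb R$ the function $p\mapsto (A(x,u,p)\xi,\xi)$ is convex along line segments in $\mathcal U(x,u)$ orthogonal to $\xi$. Duality. The dual generating function $g^*$ is defined on $\Gamma^*=\{(x,y,g(x,y,z)):(x,y,z)\in\Gamma\}$ by $g(x,y,g^*(x,y,u))=u$.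 Thus $g^*_y=-g_y/g_z$ and $g^*_u=1/g_z<0$. For $g^*$ the roles of $x$ and $y$ (and of $u$ and $z$) are interchanged: set $\mathcal V=\{(y,z,Q(x,y,z)):(x,y,z)\in\Gamma\}$ and $\mathcal V(y,z)=\{q:(y,z,q)\in\mathcal V\}$. By A1*, for $(y,z,q)\in\mathcal V$ there is a unique $x=X(y,z,q)$ with $(x,y,z)\in\Gamma$, $Q(x,y,z)=q$. Set $A^*(y,z,q)=g^*_{yy}(x,y,g(x,y,z))$ with $x=X(y,z,q)$. A3w$^*$ is the condition that for every $\xi\in\mathbb R^n$ and every $(y,z)$ the function $q\mapsto(A^*(y,z,q)\xi,\xi)$ is convex along line segments in $\mathcal V(y,z)$ orthogonal to $\xi$. Notation for A3w(1) and A3w(2). Given $\{x_0\}\times\{u_0\}\times[p_0,p_1]\subset\mathcal U$, for $\theta\in[0,1]$ put $p_\theta=(1-\theta)p_0+\theta p_1$, $y_\theta=Y(x_0,u_0,p_\theta)$, $z_\theta=Z(x_0,u_0,p_\theta)=g^*(x_0,y_\theta,u_0)$, $h_\theta(x)=g(x,y_\theta,z_\theta)-g(x,y_0,z_0)$, $\Omega_0=\{x:\{x\}\times\{u_0\}\times[p_0,p_1]\subset\mathcal U\}$, and $S_\theta=\{x\in\Omega_0: h_\theta(x)<0\}$. Here only $x$ at which the expressions are defined are considered (this includes a full neighbourhood of $x_0$), and neighbourhoods of $x_0$ are taken small enough that all expressions are defined. A set $\Omega\subset\mathbb R^n$ is $g$-convex with respect to $(y_0,z_0)$ if $\Omega\times\{y_0\}\times\{z_0\}\subset\Gamma$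 and $Q(\cdot,y_0,z_0)(\Omega)$ is convex in $\mathbb R^n$. $S_1$ is locally $g$-convex at $x_0$ with respect to $(y_0,z_0)$ if there is a neighbourhood $\mathcal N_0$ of $x_0$ such that $S_1\cap\mathcal N_0$ is $g$-convex with respect to $(y_0,z_0)$. *)

(* Defs.v *)
From HB Require Import structures.
From mathcomp Require Import all_boot all_order all_algebra.
From mathcomp Require Import all_classical all_reals all_analysis.

Set Implicit Arguments.
Unset Strict Implicit.
Unset Printing Implicit Defensive.

Import Order.TTheory GRing.Theory Num.Theory.
Import numFieldNormedType.Exports.

Local Open Scope classical_set_scope.
Local Open Scope ring_scope.

Section LinearAlgebra.
Context {R : realType} {n : nat}.
Implicit Types (u v p : 'rV[R]_n) (M : 'M[R]_n).

Definition dot u v : R := (u *m v^T) 0 0.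

Definition quad M v : R := dot (v *m M^T) v.

Definition segpt p0 p1 (t : R) : 'rV[R]_n := (1 - t) *: p0 + t *: p1.

Definition seg p0 p1 : set 'rV[R]_n := [set segpt p0 p1 t | t in `[0, 1]].

End LinearAlgebra.

Section C2.
Context {R : realType} {V : normedModType R}.

(* In finite dimension, continuity of all the directional derivatives is
   continuity of [x |-> 'd f x]. *)
Definition C1_on (D : set V) (f : V -> R) :=
  forall x, D x ->
    differentiable f x /\ forall v, {for x, continuous ('D_v f)}.

Definition C2_on (D : set V) (f : V -> R) :=
  C1_on D f /\ forall v, C1_on D ('D_v f).

End C2.

Section Partial.
Context {R : realType} {n : nat}.
Notation T := ('rV[R]_n * 'rV[R]_n * R)%type.
Implicit Types (f : T -> R) (w : T).

Definition dirx (i : 'I_n) : T := (delta_mx 0 i, 0, 0).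
Definition diry (i : 'I_n) : T := (0, delta_mx 0 i, 0).
Definition dirz : T := (0, 0, 1).

Definition px f w : 'rV[R]_n := \row_i 'D_(dirx i) f w.
Definition py f w : 'rV[R]_n := \row_i 'D_(diry i) f w.
Definition pz f w : R := 'D_dirz f w.

Definition pxx f w : 'M[R]_n :=
  \matrix_(i, j) 'D_(dirx j) ('D_(dirx i) f) w.
Definition pyy f w : 'M[R]_n :=
  \matrix_(i, j) 'D_(diry j) ('D_(diry i) f) w.
Definition pxy f w : 'M[R]_n :=
  \matrix_(i, j) 'D_(diry j) ('D_(dirx i) f) w.
Definition pxz f w : 'rV[R]_n := \row_i 'D_dirz ('D_(dirx i) f) w.

End Partial.

(* A function on [G] is represented by a total function whose values outside
   [G] are irrelevant, since [G] is open.  Partially defined maps are totalized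
   with [xget 0]: they are 0 where the defining equations have no solution. *)
Section Generating.
Context {R : realType} {n : nat}.
Notation T := ('rV[R]_n * 'rV[R]_n * R)%type.
Variables (G : set T) (g : T -> R).
Implicit Types (x y p q xi : 'rV[R]_n) (u z : R).

Definition generating_domain :=
  [/\ open G, connected G
    & forall x y, open [set z | G (x, y, z)] /\
                  is_interval [set z | G (x, y, z)]].

Definition generating_function :=
  C2_on G g /\ forall w, G w -> pz g w < 0.

Definition U : set ('rV[R]_n * R * 'rV[R]_n) :=
  [set (w.1.1, g w, px g w) | w in G].

Definition Ufiber x u : set 'rV[R]_n := [set p | U (x, u, p)].

Definition YZset x u p : set ('rV[R]_n * R) :=
  [set yz | [/\ G (x, yz.1, yz.2), g (x, yz.1, yz.2) = u
              & px g (x, yz.1, yz.2) = p]].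

Definition Y x u p : 'rV[R]_n := (xget 0 (YZset x u p)).1.
Definition Z x u p : R := (xget 0 (YZset x u p)).2.

Definition E (w : T) : 'M[R]_n :=
  pxy g w - (pz g w)^-1 *: ((pxz g w)^T *m py g w).

Definition Q (w : T) : 'rV[R]_n := - (pz g w)^-1 *: py g w.

Definition A1 := forall x u p, U (x, u, p) -> exists! yz, YZset x u p yz.

Definition A2 := forall w, G w -> \det (E w) != 0.

Definition A1star := forall y z x x',
  G (x, y, z) -> G (x', y, z) -> Q (x, y, z) = Q (x', y, z) -> x = x'.

Definition A x u p : 'M[R]_n := pxx g (x, Y x u p, Z x u p).

Definition A3w := forall xi x u p0 p1,
  seg p0 p1 `<=` Ufiber x u -> dot (p1 - p0) xi = 0 ->
  @convex_function R 'rV[R]_n (seg p0 p1) (fun p => quad (A x u p) xi).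

(* The dual generating function, as a function of (x, y, u). *)
Definition gstar (w : T) : R :=
  xget 0 [set z | G (w.1.1, w.1.2, z) /\ g (w.1.1, w.1.2, z) = w.2].

Definition V : set ('rV[R]_n * R * 'rV[R]_n) :=
  [set (w.1.2, w.2, Q w) | w in G].

Definition Vfiber y z : set 'rV[R]_n := [set q | V (y, z, q)].

Definition X y z q : 'rV[R]_n :=
  xget 0 [set x | G (x, y, z) /\ Q (x, y, z) = q].

Definition Astar y z q : 'M[R]_n :=
  pyy gstar (X y z q, y, g (X y z q, y, z)).

Definition A3wstar := forall xi y z q0 q1,
  seg q0 q1 `<=` Vfiber y z -> dot (q1 - q0) xi = 0 ->
  @convex_function R 'rV[R]_n (seg q0 q1) (fun q => quad (Astar y z q) xi).

Definition gconvex y0 z0 (O : set 'rV[R]_n) :=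
  (forall x, O x -> G (x, y0, z0)) /\
  @convex_set R 'rV[R]_n [set Q (x, y0, z0) | x in O].

Definition locally_gconvex x0 y0 z0 (S : set 'rV[R]_n) :=
  exists2 N, nbhs x0 N & gconvex y0 z0 (S `&` N).

Section Segment.
Variables (x0 : 'rV[R]_n) (u0 : R) (p0 p1 : 'rV[R]_n).

Definition yth (t : R) := Y x0 u0 (segpt p0 p1 t).
Definition zth (t : R) := Z x0 u0 (segpt p0 p1 t).

Definition hth (t : R) x := g (x, yth t, zth t) - g (x, yth 0, zth 0).

Definition Omega0 : set 'rV[R]_n := [set x | seg p0 p1 `<=` Ufiber x u0].

(* The second and third conditions say that [hth t x] is defined. *)
Definition Sth (t : R) : set 'rV[R]_n :=
  [set x | [/\ Omega0 x, G (x, yth t, zth t), G (x, yth 0, zth 0)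
             & hth t x < 0]].

End Segment.

Definition A3w1 := forall x0 u0 p0 p1, seg p0 p1 `<=` Ufiber x0 u0 ->
  locally_gconvex x0 (yth x0 u0 p0 p1 0) (zth x0 u0 p0 p1 0)
    (Sth x0 u0 p0 p1 1).

(* Membership in [G] makes explicit that the neighbourhood is small enough for
   all the expressions to be defined. *)
Definition A3w2 := forall x0 u0 p0 p1, seg p0 p1 `<=` Ufiber x0 u0 ->
  exists2 N, nbhs x0 N & forall x t, N x -> t \in `[0, 1] ->
    let y_ := yth x0 u0 p0 p1 in
    let z_ := zth x0 u0 p0 p1 in
    G (x, y_ t, z_ t) /\
    g (x, y_ t, z_ t) <= Num.max (g (x, y_ 0, z_ 0)) (g (x, y_ 1, z_ 1)).

End Generating.

(* Main.v *)
(** Let two sections [g_i = g(., y_i, z_i)] agree at [x], with gradients [p_i]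
    there, and let [x'] be a nearby point where [g_1 <= g_0].  The key fact is
    that under A3w the section with 1-jet [(g_0(x), (1 - t) p_0 + t p_1)] at [x]
    is at most [g_0] at [x'].  Otherwise maximize its value at [x'], minus a small
    multiple of [|x - x'|^2], over [t] and over [x] on [{g_1 = g_0}].  At an
    interior maximum the [t]-derivative vanishes, which says that the direction
    [v] with [v E = - g_z (Q(x') - Q(x))] is tangent to [{g_1 = g_0}].  Along [v]
    the first-order terms cancel and what remains is a positive multiple of the
    convexity defect of [(A v, v)], which is nonnegative, while [x] strictly
    approaches [x']: a contradiction.

    With [x = x_0] this is A3w(2).  Letting [t] tend to [0], it gives a supporting
    half-space of [{g_1 < g_0}] at every boundary point in the coordinates [Q], so
    A3w(1).  The latter, applied to [(y, z)] close to [(y_0, z_0)] and read as a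
    property of [y], says that a dual section cannot exceed near [y_0] both of its
    neighbours on the same segment.

    Conversely, each condition prevents the sections with gradients [p + et] and
    [p - et] at [x_0] from being both below the one with gradient [p] arbitrarily
    close to [x_0]; a second-order expansion along [x_0 + s xi + s^2 b et] with a
    suitable [b] then gives midpoint convexity of [(A xi, xi)]. *)

From HB Require Import structures.
Require Import Defs.
From mathcomp Require Import all_boot all_order all_algebra.
From mathcomp Require Import all_classical all_reals all_analysis.
From mathcomp Require Import ring lra.

Set Implicit Arguments.
Unset Strict Implicit.
Unset Printing Implicit Defensive.

Import Order.TTheory GRing.Theory Num.Theory.
Import numFieldNormedType.Exports.

Local Open Scope classical_set_scope.
Local Open Scope ring_scope.

(** * Differential calculus *)

(** With g only C^2, [gxx] is merely continuous, so A cannot be differentiated in p and A3w cannot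
    be traded for a differential inequality. Only first derivatives of the map from a 1-jet (x, p,
    u) to the point (x, y, z) are taken; it is differentiable because A2 makes the differential of
    the jet map invertible. Tangency of v to {g_1 = g_0} does double work: it makes v orthogonal to
    p_1 - p_0, as A3w demands, and it makes u change at the rate p_t . v for every t, which cancels
    the first-order terms. A3w then yields only a nonnegative derivative along v; the quadratic
    penalty makes it positive.

    The radius in the maximum principle has to be uniform in the second section: duality compares
    (y_0, z_0) with all nearby (y, z), where the segment [p_0, p_1] shrinks to a point.

    Every road back to A3w passes through one weak property, [no_common_descent]. The step from A3w
    to this property of the dual is proved for abstract derivative data and used twice, with g and
    its dual exchanged. *)

Section Differentials.
Context {R : realType} {V W : normedModType R}.

Lemma differentiable_near (f : V -> W) a : differentiable f a ->
  forall e : R, 0 < e ->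
  \forall b \near a, `|f b - f a - 'd f a (b - a)| <= e * `|b - a|.
Proof.
move=> /diff_locally /eqaddoP df e e0.
rewrite (near_shift 0 a) subr0; apply: filterS (df _ e0) => h /=.
by rewrite addrK -[(_ - _) h]/(f (h + a) - (f a + 'd f a h)) opprD addrA.
Qed.

Lemma near_is_diff (f : V -> W) a (D : {linear V -> W}) : continuous D ->
  (forall e : R, 0 < e ->
     \forall b \near a, `|f b - f a - D (b - a)| <= e * `|b - a|) ->
  is_diff a f D.
Proof.
move=> cD fD.
have H : f \o shift a = cst (f a) + D +o_ 0 id.
  apply/eqaddoP => e e0; have := fD _ e0.
  rewrite (near_shift 0 a) subr0; apply: filterS => h /=.
  by rewrite addrK -[(_ - _) h]/(f (h + a) - (f a + D h)) opprD addrA.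
have dfD := diff_unique cD H.
by apply: DiffDef => //; apply/diff_locallyP; rewrite dfD.
Qed.

End Differentials.

Section Curves.
Context {R : realType} {V W : normedModType R}.

Lemma is_derive_comp_curve (f : V -> W) (c : R -> V) (s : R) (dc : V) :
  differentiable f (c s) -> is_derive s 1 c dc ->
  is_derive s 1 (f \o c) ('d f (c s) dc).
Proof.
move=> df [/derivable1_diffP dc1 dc2].
have dfc : differentiable (f \o c) s by exact: differentiable_comp.
apply: DeriveDef; first exact/derivable1_diffP.
by rewrite deriveE// diff_comp//= -dc2 deriveE.
Qed.

Lemma is_derive_line (a v : V) (s : R) :
  is_derive s 1 (fun t : R => a + t *: v) v.
Proof.
have := @is_deriveD R R V (cst a) ( *:%R^~ v) s 1 0 v (is_derive_cst _ _ _).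
rewrite add0r; apply.
have d : differentiable (fun z : R => id z *: v) s by exact: (@differentiableZl _ _ _ id).
apply: DeriveDef; first exact/diff_derivable.
by rewrite deriveE// (@diffZl _ _ _ id)//= diff_val scale1r.
Qed.

Lemma continuous_line (a v : V) : continuous (fun t : R => a + t *: v).
Proof.
move=> t; apply: differentiable_continuous; apply/derivable1_diffP.
by case: (is_derive_line a v t).
Qed.

End Curves.

Section RealValued.
Context {R : realType} {V : normedModType R}.
Implicit Types (f : V -> R) (a v : V).

Lemma mvt_line f a v (h : R) : 0 < h ->
  (forall t, t \in `[0, h] -> differentiable f (a + t *: v)) ->
  exists2 t, t \in `]0, h[ & f (a + h *: v) - f a = h * 'D_v f (a + t *: v).
Proof.
move=> h0 df; pose F t := f (a + t *: v).
have dF t : t \in `[0, h] -> is_derive t 1 F ('D_v f (a + t *: v)).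
  move=> th; rewrite deriveE; last exact: df.
  by apply: is_derive_comp_curve (is_derive_line a v t); exact: df.
have [|c ch Fc] := MVT (f := F) (df := fun t => 'D_v f (a + t *: v)) h0
    (fun t th => dF t (subset_itv_oo_cc th)).
  apply: derivable_within_continuous => t th.
  by have [] := dF t th.
by exists c => //; move: Fc; rewrite /F scale0r addr0 subr0 mulrC.
Qed.

(** The tolerance [e] on the direction is the point: on a curved constraint only directions close to
    [v] are available. *)
Lemma diff_direction_gt0 f a v : differentiable f a -> 0 < 'd f a v ->
  exists2 e : R, 0 < e & \forall s \near 0^'+, forall w,
    `|w - v| <= e -> f a < f (a + s *: w).
Proof.
move=> df dv.
have [k k0 dk] := linear_lipschitz (diff_continuous df).
(* Directions this close to [v] keep at least half of the derivative, and the remainder, with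
   coefficient ['d f a v / (4 * M)], costs at most a quarter of it. *)
have e0 : 0 < 'd f a v / (2 * k) by rewrite divr_gt0// mulr_gt0.
exists ('d f a v / (2 * k)) => //.
set e := _ / _ in e0 *.
pose M := `|v| + e.
have M0 : 0 < M by rewrite ltr_wpDl.
have c0 : 0 < 'd f a v / (4 * M) by rewrite divr_gt0// mulr_gt0.
have /nbhs_ballP[r /= r0 fr] := differentiable_near df c0.
near=> s => w wv.
have s0 : 0 < s by [].
have wM : `|w| <= M.
  by rewrite -(subrK v w) (le_trans (ler_normD _ _))// addrC lerD2l.
have : ball a r (a + s *: w).
  rewrite -ball_normE /= opprD addrA subrr sub0r normrN normrZ gtr0_norm//.
  rewrite (le_lt_trans (ler_wpM2l (ltW s0) wM))// -ltr_pdivlMr//.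
  near: s; apply: nbhs_right_lt; exact: divr_gt0.
move=> /fr /=; rewrite (addrC a) addrK linearZ normrZ (gtr0_norm s0) /=.
rewrite ler_norml => /andP[+ _].
have -> : 'd f a w = 'd f a v + 'd f a (w - v) by rewrite -linearD addrC subrK.
have : `|'d f a (w - v)| <= 'd f a v / 2.
  rewrite (le_trans (dk _))// (le_trans (ler_wpM2l (ltW k0) wv))// /e.
  by rewrite le_eqVlt; apply/orP; left; apply/eqP; field; rewrite gt_eqF.
rewrite ler_norml => /andP[+ _].
have : 'd f a v / (4 * M) * (s * `|w|) <= s * ('d f a v / 4).
  have -> : s * ('d f a v / 4) = 'd f a v / (4 * M) * (s * M).
    by field; rewrite gt_eqF.
  by rewrite ler_pM2l// ler_pM2l.
set D := 'd f a v; set D' := 'd f a (w - v); set X := _ * (s * _).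
change (s *: (D + D')) with (s * (D + D')).
move=> h1 h2 h3.
have : 0 < s * D by rewrite mulr_gt0.
have : s * (- (D / 2)) <= s * D' by rewrite ler_pM2l.
move: h1 h3; lra.
Unshelve. all: by end_near. Qed.

(** A substitute for the implicit function theorem: at [t = e] and [t = - e] the correction by [w]
    gives [f] opposite signs, and the intermediate value theorem in [t] finds a zero between
    them. *)
Lemma constrained_direction f a v w : {near a, continuous f} ->
  differentiable f a -> f a = 0 -> 'd f a v = 0 -> 0 < 'd f a w ->
  forall e : R, 0 < e -> \forall s \near 0^'+,
    exists2 t : R, `|t| <= e & f (a + s *: (v + t *: w)) = 0.
Proof.
move=> /nbhs_ballP[r /= r0 cf] df fa dv dw e e0.
have dp : 0 < 'd f a (v + e *: w).
  by rewrite linearD linearZ dv add0r mulr_gt0.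
have dn : 0 < 'd (- f) a (v - e *: w).
  rewrite diffN//=; change (0 < - 'd f a (v - e *: w)).
  by rewrite linearB /= linearZ /= dv sub0r opprK mulr_gt0.
have [ep ep0 fp] := diff_direction_gt0 df dp.
have [en en0 fn] := diff_direction_gt0 (differentiableN df) dn.
have M0 : 0 < `|v| + e * `|w| + 1 by rewrite ltr_wpDl// addr_ge0// mulr_ge0// ltW.
near=> s.
have s0 : 0 < s by [].
have sr : s < r / (`|v| + e * `|w| + 1).
  by near: s; apply: nbhs_right_lt; exact: divr_gt0.
have bs t : t \in `[- e, e] -> ball a r (a + s *: (v + t *: w)).
  rewrite in_itv /= -ler_norml => te.
  rewrite -ball_normE /= opprD addrA subrr sub0r normrN normrZ gtr0_norm//.
  apply: (@le_lt_trans _ _ (s * (`|v| + e * `|w| + 1))).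
    rewrite ler_pM2l// (le_trans (ler_normD _ _))// -addrA lerD2l normrZ.
    by rewrite (le_trans (ler_wpM2r _ te))// lerDl.
  by rewrite -ltr_pdivlMr.
have F : continuous (fun t : R => a + s *: (v + t *: w)).
  move=> t; apply: cvgD; first exact: cvg_cst.
  by apply: cvgZ; [exact: cvg_cst|exact: continuous_line].
have [t tE ft] : exists2 t, t \in `[- e, e] & f (a + s *: (v + t *: w)) = 0.
  apply: (@IVT _ (fun t : R => f (a + s *: (v + t *: w)))).
  - by rewrite ge0_cp// ltW.
  - apply: continuous_in_subspaceT => t; rewrite inE => /bs/cf ct.
    by apply: (continuous_comp (F t)); exact: ct.
  - have : 0 < f (a + s *: (v + e *: w)).
      by rewrite -fa; apply: (near fp s) => //; rewrite subrr normr0 ltW.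
    have : f (a + s *: (v - e *: w)) < 0.
      rewrite -oppr_gt0 -[0]oppr0 -fa; apply: (near fn s) => //.
      by rewrite subrr normr0 ltW.
    rewrite scaleNr => h1 h2.
    by rewrite ge_min le_max (ltW h1) (ltW h2) orbT.
by exists t => //; move: tE; rewrite in_itv /= -ler_norml.
Unshelve. all: by end_near. Qed.

End RealValued.

Section OneVariable.
Context {R : realType}.
Implicit Types f : R -> R.

(** [df] is differentiable only at 0; this already makes it negative just to the right of 0, and the
    mean value theorem concludes. *)
Lemma second_derivative_lt0 f df (d : R) :
  (\forall s \near (0 : R), is_derive s (1 : R) f (df s)) -> df 0 = 0 ->
  is_derive (0 : R) (1 : R) df d -> d < 0 -> \forall s \near 0^'+, f s < f 0.
Proof.
move=> fdf df0 [/derivable1_diffP ddf dd] d0.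
have dn : 0 < 'd (- df) 0 1.
  by rewrite diffN//= [X in 0 < X]/(- 'd df 0 1) -deriveE// dd oppr_gt0.
have [e e0 dfn] := diff_direction_gt0 (differentiableN ddf) dn.
move: fdf dfn => /nbhs_ballP[r /= r0 fdf] /nbhs_right0P[r' /= r'0 dfn].
near=> s.
have s0 : 0 < s by [].
have sr : s < r by near: s; exact: nbhs_right_lt.
have sr' : s < r' by near: s; exact: nbhs_right_lt.
have bs t : t \in `[0, s] -> is_derive t 1 f (df t).
  rewrite in_itv /= => /andP[t0 ts]; apply: fdf.
  by rewrite -ball_normE /= sub0r normrN ger0_norm// (le_lt_trans ts).
have [|c] := MVT s0 (fun t th => bs t (subset_itv_oo_cc th)).
  apply: derivable_within_continuous => t th.
  by have [] := bs t th.
rewrite in_itv /= => /andP[c0 cs] fc.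
rewrite -subr_lt0 fc subr0 pmulr_llt0// -oppr_gt0 -[0]oppr0 -df0.
have : (- df) 0 < (- df) (0 + (0 + c) *: 1).
  apply: dfn => //=; last by rewrite subrr normr0 ltW.
  by rewrite sub0r normrN gtr0_norm// (lt_trans cs).
by rewrite !add0r [c *: _]mulr1.
Unshelve. all: by end_near. Qed.

(** The admissible steps [d] depend on [t], so dyadic bisection is not possible; an interior maximum
    of the excess over the chord is excluded instead. *)
Lemma midpoint_convex f : {within `[0, 1], continuous f} ->
  (forall t, t \in `]0, 1[ ->
     \forall d \near 0^'+, f t <= (f (t - d) + f (t + d)) / 2) ->
  forall t, t \in `[0, 1] -> f t <= (1 - t) * f 0 + t * f 1.
Proof.
move=> cf mf t tI; apply/ler_addgt0Pl => e e0.
(* The term [e * u ^+ 2] makes the midpoint inequality strict, so [F] has no interior maximum; at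
   the ends [F] is 0 and [e]. *)
pose F u := f u - ((1 - u) * f 0 + u * f 1) + e * u ^+ 2.
have cC : continuous (fun u : R => e * u ^+ 2 - ((1 - u) * f 0 + u * f 1)).
  move=> u; apply: cvgB; first by apply: cvgMl_tmp; exact: exprn_continuous.
  apply: cvgD; apply: cvgMr_tmp; last exact: cvg_id.
  by apply: cvgB; [exact: cvg_cst|exact: cvg_id].
have cF : {within `[0, 1], continuous F}.
  have -> : F = f \+ (fun u => e * u ^+ 2 - ((1 - u) * f 0 + u * f 1)).
    by apply/funext => u; rewrite /F /=; ring.
  move=> u; apply: cvgD; first exact: cf.
  by have := continuous_subspaceT cC; apply.
have [c cI Fc] := EVT_max ler01 cF.
have : F t <= e.
  apply: le_trans (Fc t tI) _.
  have [->|c0] := eqVneq c 0; first by rewrite /F; lra.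
  have [->|c1] := eqVneq c 1; first by rewrite /F; lra.
  have /andP[c0' c1'] : 0 < c < 1.
    by move: cI; rewrite in_itv /= !le_eqVlt eq_sym (negbTE c0) (negbTE c1).
  have cI' : c \in `]0, 1[ by rewrite in_itv /= c0'.
  have : \forall d \near (0 : R)^'+, False.
    near=> d.
    have d0 : 0 < d by [].
    have dc : d < c by near: d; exact: nbhs_right_lt.
    have d1 : d < 1 - c by near: d; apply: nbhs_right_lt; rewrite subr_gt0.
    have dm : c - d \in `[0, 1] by rewrite in_itv /=; apply/andP; split; lra.
    have dp : c + d \in `[0, 1] by rewrite in_itv /=; apply/andP; split; lra.
    have : f c <= (f (c - d) + f (c + d)) / 2 by near: d; exact: mf.
    have := Fc _ dm; have := Fc _ dp.
    have : 0 < e * d ^+ 2 by rewrite mulr_gt0// exprn_gt0.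
    rewrite /F; lra.
  by move=> /filter_ex[].
rewrite /F; have : 0 <= e * t ^+ 2 by rewrite mulr_ge0 ?sqr_ge0// ltW.
lra.
Unshelve. all: by end_near. Qed.

End OneVariable.

(** * Inverse function theorem from strict differentiability at a point *)

Section StrictDifferentiability.
Context {R : realType} {V W : normedModType R}.

(** Both points vary, unlike in differentiability at [a]: this is the part of C^1 regularity from
    which the inverse function theorem is drawn. *)
Definition strict_diff (f : V -> W) a (D : V -> W) :=
  forall e : R, 0 < e -> exists2 d : R, 0 < d &
    forall b c, `|b - a| < d -> `|c - a| < d ->
      `|f b - f c - D (b - c)| <= e * `|b - c|.

Variables (f : V -> W) (a : V) (D : {linear V -> W}) (L : {linear W -> V}).
Hypotheses (fD : strict_diff f a D) (cL : continuous L) (DK : cancel D L).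

Let invB e b c : 0 <= e -> `|f b - f c - D (b - c)| <= e * `|b - c| ->
  forall k, 0 < k -> (forall x, `|L x| <= k * `|x|) ->
  `|L (f b) - L (f c) - (b - c)| <= k * e * `|b - c|.
Proof.
move=> e0 fbc k k0 Lk; rewrite -[X in _ - X]DK -!linearB (le_trans (Lk _))//.
by rewrite -mulrA ler_pM2l.
Qed.

(** Near [a] the map [L \o f] differs from the identity by a map with Lipschitz constant 1/2. *)
Lemma strict_diff_expansive : exists2 C : R, 0 < C & exists2 d : R, 0 < d &
  forall b c, `|b - a| < d -> `|c - a| < d -> `|b - c| <= C * `|f b - f c|.
Proof.
have [k k0 Lk] := linear_lipschitz cL.
exists (2 * k); first by rewrite mulr_gt0.
have e0 : 0 < (2 * k)^-1 by rewrite invr_gt0 mulr_gt0.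
have [d d0 fd] := fD e0.
exists d => // b c bd cd.
have := invB (ltW e0) (fd b c bd cd) k0 Lk.
have -> : k * (2 * k)^-1 = 2^-1 by field; rewrite gt_eqF.
have := Lk (f b - f c).
rewrite linearB /=; set u := L _ - L _; set v := b - c => h1 h2.
have : `|v| <= `|u| + `|u - v|.
  by rewrite -{1}(subKr u v) (le_trans (ler_normB _ _)).
move: h1 h2; lra.
Qed.

(** The inverse [F] is given and continuous, as injectivity comes from elsewhere; only its
    differentiability is at stake. Expansiveness converts an error in [|b - a|] into one in
    [|f b - f a|]. *)
Lemma strict_diff_inverse (G : set V) (F : W -> V) :
  nbhs (f a) (f @` G) -> {for f a, continuous F} ->
  (forall b, G b -> F (f b) = b) -> F (f a) = a ->
  is_diff (f a) F L.
Proof.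
move=> fG cF FK Fa; apply: near_is_diff => // e e0.
have [k k0 Lk] := linear_lipschitz cL.
have [C C0 [d d0 Cd]] := strict_diff_expansive.
have e0' : 0 < e / (k * C) by rewrite divr_gt0// mulr_gt0.
have [d' d'0 fd'] := fD e0'.
near=> w; have [b Gb fb] : (f @` G) w by near: w.
have : `|F (f a) - F w| < Num.min d d'.
  near: w; move/cvgrPdist_lt: cF; apply.
  by rewrite lt_min d0.
rewrite Fa -fb FK// lt_min distrC => /andP[bd bd'].
have a0 t : 0 < t -> `|a - a| < t by rewrite subrr normr0.
have := invB (ltW e0') (fd' b a bd' (a0 _ d'0)) k0 Lk.
rewrite -linearB -normrN opprB /= => /le_trans; apply.
have := Cd b a bd (a0 _ d0).
have -> : k * (e / (k * C)) = e / C by field; rewrite !gt_eqF.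
move=> ba; rewrite -mulrA ler_pM2l// ler_pdivrMl//.
Unshelve. all: by end_near. Qed.

Hypothesis LK : cancel L D.
Hypothesis cV : forall (v : V) (r : R), compact [set u : V | `|u - v| <= r].

(** A preimage of [w] is found by minimizing [|L w - L (f u)|] over a compact ball around [a]. *)
Lemma strict_diff_open (N : set V) : nbhs a N -> nbhs (f a) (f @` N).
Proof.
move=> /nbhs_ballP[r0 /= r00 rN].
have [k k0 Lk] := linear_lipschitz cL.
have e0 : 0 < (2 * k)^-1 by rewrite invr_gt0 mulr_gt0.
have [d d0 fd] := fD e0.
pose r := Num.min (r0 / 2) (d / 2).
have [rr0 rd] : r < r0 /\ r < d.
  by rewrite /r; split; rewrite gt_min ?ltr_pdivrMr// ?ltr_pMr// ?ltr1n// orbT.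
have rgt0 : 0 < r by rewrite lt_min !divr_gt0.
have half b c : `|b - a| < d -> `|c - a| < d ->
    `|L (f b) - L (f c) - (b - c)| <= `|b - c| / 2.
  move=> bd cd; have := invB (ltW e0) (fd b c bd cd) k0 Lk.
  have -> : k * (2 * k)^-1 = 2^-1 by field; rewrite gt_eqF.
  by rewrite mulrC.
(* The 5 makes [F a < r / 5]. The minimizer is within [4 * F a] of [a] and the corrective step has
   length at most [F a], so the corrected point is still in the ball. *)
have rho0 : 0 < r / (5 * k) by rewrite divr_gt0// mulr_gt0.
apply/nbhs_ballP; exists (r / (5 * k)) => //= w.
rewrite -ball_normE /= distrC => wfa.
pose K := [set u : V | `|u - a| <= r].
pose F u := `|L w - L (f u)|.
have cF : {within K, continuous F}.
  apply: continuous_in_subspaceT => u; rewrite inE => /= ua.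
  apply/cvgrPdist_lt => t t0.
  have ud : `|u - a| < d by exact: le_lt_trans ua rd.
  near=> v.
  have uv : `|u - v| < Num.min (d - `|u - a|) (t / 2).
    by near: v; apply: cvgr_dist_lt => //; rewrite lt_min subr_gt0 ud divr_gt0.
  move: uv; rewrite lt_min => /andP[uv ut].
  have vd : `|v - a| < d.
    rewrite -(subrKA u) (le_lt_trans (ler_normD _ _))// distrC.
    by move: uv; lra.
  have h1 := half _ _ ud vd.
  apply: (@le_lt_trans _ _ `|L (f u) - L (f v)|).
    rewrite (le_trans (ler_dist_dist _ _))// distrC opprB addrC.
    by rewrite addrA subrK distrC.
  have := ler_normB (L (f u) - L (f v)) (L (f u) - L (f v) - (u - v)).
  have := ler_normD (L (f u) - L (f v) - (u - v)) (u - v).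
  by rewrite subrK; move: h1 ut; lra.
have [|v vK vmin] := @compact_EVT_min _ _ F K _ (@cV a r) cF.
  by exists a; rewrite /K /= subrr normr0 ltW.
have va : `|v - a| <= r by move: vK; rewrite inE.
have aa : `|a - a| < d by rewrite subrr normr0.
have Fa : F a < r / 5.
  rewrite /F -linearB (le_lt_trans (Lk _))//.
  rewrite -ltr_pdivlMl//; apply: (lt_le_trans wfa).
  by rewrite le_eqVlt; apply/orP; left; apply/eqP; field; rewrite gt_eqF.
have FvFa : F v <= F a by apply: vmin; rewrite inE /K /= subrr normr0 ltW.
(* Moving [v] by its residual [e] at least halves the residual, so at the minimum it is zero. *)
pose e := L w - L (f v).
have va' : `|v - a| <= 4 * F a.
  have h1 := half _ _ (le_lt_trans va rd) aa.
  have : `|L (f v) - L (f a)| <= F a + F v.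
    rewrite -(subrKA (L w)) addrC (le_trans (ler_normD _ _))//.
    by rewrite lerD2l distrC.
  have := ler_normB (L (f v) - L (f a)) (L (f v) - L (f a) - (v - a)).
  rewrite subKr; move: h1 FvFa; lra.
have ve : `|v + e - a| <= r.
  rewrite addrAC (le_trans (ler_normD _ _))//.
  move: FvFa va' Fa; rewrite -/(F v); lra.
have : F v <= F (v + e) by apply: vmin; rewrite inE.
have := half _ _ (le_lt_trans ve rd) (le_lt_trans va rd).
rewrite [v + e - v]addrC addKr -normrN -/(F v).
have -> : - (L (f (v + e)) - L (f v) - e) = L w - L (f (v + e)).
  by rewrite opprB {1}/e opprB subrKA.
rewrite -/(F (v + e)) => h1 h2.
have : F v <= 0 by move: h1 h2; lra.
rewrite normr_le0 subr_eq0 => /eqP /(can_inj LK) wv.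
exists v => //; apply: rN; rewrite -ball_normE /= distrC.
exact: le_lt_trans va rr0.
Unshelve. all: by end_near. Qed.

End StrictDifferentiability.

(** * Functions of class C^1 and C^2, symmetry of second derivatives *)

Section C1C2.
Context {R : realType} {V : normedModType R}.
Implicit Types (f g : V -> R) (D : set V) (a v w : V).

Lemma continuous_at_near_eq {T U : topologicalType} (f g : T -> U) x :
  (\near x, f x = g x) -> {for x, continuous f} -> {for x, continuous g}.
Proof.
move=> fg cf; rewrite /prop_for /continuous_at -(nbhs_singleton fg).
by apply: cvg_trans cf; apply: near_eq_cvg.
Qed.

Lemma C1_on_eq D f g : open D -> {in D, f =1 g} -> C1_on D f -> C1_on D g.
Proof.
move=> oD fg fC x Dx.
have nfg : \near x, f x = g x.
  by near=> y; apply: fg; rewrite inE; near: y; exact: open_nbhs_nbhs.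
have [df cf] := fC x Dx.
split=> [|v].
  have H : is_diff x g ('d f x).
    apply: near_is_diff; first exact: diff_continuous.
    move=> e e0; have := differentiable_near df e0.
    rewrite (nbhs_singleton nfg); apply: filterS2 nfg => y ->; exact.
  by case: H.
apply: continuous_at_near_eq (cf v).
near=> y; apply: near_eq_derive.
near=> z; apply: fg; rewrite inE; near: z.
by apply: open_nbhs_nbhs; split => //; near: y; exact: open_nbhs_nbhs.
Unshelve. all: by end_near. Qed.

Lemma C1_on_continuous D f x : C1_on D f -> D x -> {for x, continuous f}.
Proof. by move=> fC /fC[/differentiable_continuous]. Qed.

Lemma C1_on_derive D f (F : V -> V -> R) : open D ->
  (forall x, D x -> differentiable f x) ->
  (forall x v, D x -> 'D_v f x = F v x) ->
  (forall x v, D x -> {for x, continuous (F v)}) -> C1_on D f.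
Proof.
move=> oD df fF cF x Dx; split=> [|v]; first exact: df.
apply: continuous_at_near_eq (cF x v Dx).
by near=> y; rewrite fF//; near: y; exact: open_nbhs_nbhs.
Unshelve. all: by end_near. Qed.

Lemma C1_on_cst D (c : R) : C1_on D (cst c).
Proof.
move=> x Dx; split=> // v.
rewrite (_ : 'D_v _ = cst 0); first exact: cvg_cst.
by apply/funext => y; rewrite derive_cst.
Qed.

Lemma C1_onD D f g : open D -> C1_on D f -> C1_on D g ->
  C1_on D (fun x => f x + g x).
Proof.
move=> oD fC gC; apply: (@C1_on_derive _ _ (fun v x => 'D_v f x + 'D_v g x)) => //.
- by move=> x Dx; apply: differentiableD; [case: (fC x)|case: (gC x)].
- move=> x v Dx; rewrite (@deriveD _ _ _ f g)//.
    by apply: diff_derivable; case: (fC x).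
  by apply: diff_derivable; case: (gC x).
- by move=> x v Dx; apply: cvgD; [exact: (fC x Dx).2|exact: (gC x Dx).2].
Qed.

Lemma C1_onM D f g : open D -> C1_on D f -> C1_on D g ->
  C1_on D (fun x => f x * g x).
Proof.
move=> oD fC gC.
apply: (@C1_on_derive _ _ (fun v x => f x * 'D_v g x + g x * 'D_v f x)) => //.
- by move=> x Dx; apply: differentiableM; [case: (fC x)|case: (gC x)].
- move=> x v Dx; rewrite (@deriveM _ _ f g)//.
    by apply: diff_derivable; case: (fC x).
  by apply: diff_derivable; case: (gC x).
- move=> x v Dx; apply: cvgD; apply: cvgM.
  + exact: C1_on_continuous fC Dx.
  + exact: (gC x Dx).2.
  + exact: C1_on_continuous gC Dx.
  + exact: (fC x Dx).2.
Qed.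

Lemma C1_onN D f : open D -> C1_on D f -> C1_on D (fun x => - f x).
Proof.
move=> oD fC; apply: C1_on_eq (C1_onM oD (C1_on_cst (-1)) fC) => // x _.
by rewrite /= mulN1r.
Qed.

Lemma C1_onV D f : open D -> (forall x, D x -> f x != 0) -> C1_on D f ->
  C1_on D (fun x => (f x)^-1).
Proof.
move=> oD f0 fC.
apply: (@C1_on_derive _ _ (fun v x => - (f x) ^- 2 * 'D_v f x)) => //.
- by move=> x Dx; apply: differentiableV; [case: (fC x)|exact: f0].
- move=> x v Dx; rewrite (@deriveV _ _ f)//; first exact: f0.
  by apply: diff_derivable; case: (fC x).
- move=> x v Dx; apply: cvgM; last exact: (fC x Dx).2.
  apply: cvgN; apply: cvgV; first by rewrite expf_neq0// f0.
  by rewrite expr2; apply: cvgM; exact: C1_on_continuous fC Dx.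
Qed.

Lemma derive_shift_arg f v w x :
  'D_v (fun y => f (y + w)) x = 'D_v f (x + w).
Proof. by rewrite /derive; under eq_fun do rewrite /= -addrA. Qed.

(** Mean value theorem along [v] for the increment by [w], then along [w] for ['D_v f]. The
    left-hand side is symmetric in [v] and [w], which is what [schwarz] exploits. *)
Lemma second_difference D f a v w : open D -> C2_on D f -> D a ->
  \forall h \near 0^'+, exists s t, [/\ 0 < s < h, 0 < t < h &
    f (a + h *: v + h *: w) - f (a + h *: v) - (f (a + h *: w) - f a) =
    h * (h * 'D_w ('D_v f) (a + s *: v + t *: w))].
Proof.
move=> oD [fC fC2] Da.
have /nbhs_ballP[r /= r0 rD] : nbhs a D by exact: open_nbhs_nbhs.
pose M := `|v| + `|w| + 1.
have M0 : 0 < M by rewrite ltr_wpDl// addr_ge0.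
near=> h.
have h0 : 0 < h by [].
have hr : h < r / M by near: h; apply: nbhs_right_lt; exact: divr_gt0.
have DD s t : s \in `[0, h] -> t \in `[0, h] -> D (a + s *: v + t *: w).
  rewrite !in_itv /= => /andP[s0 sh] /andP[t0 th]; apply: rD.
  rewrite -ball_normE /= -addrA opprD addrA subrr sub0r normrN.
  rewrite (le_lt_trans (ler_normD _ _))// !normrZ !ger0_norm//.
  apply: (@le_lt_trans _ _ (h * M)); last by rewrite -ltr_pdivlMr.
  by rewrite /M !mulrDr mulr1 ler_wpDr ?(ltW h0)// lerD// ler_wpM2r.
have z0 : 0 \in `[0, h] by rewrite in_itv /= lexx ltW.
have hh : h \in `[0, h] by rewrite in_itv /= lexx ltW.
pose F x := f (x + h *: w) - f x.
have dsh x : D (x + h *: w) -> differentiable (fun y => f (y + h *: w)) x.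
  by move=> Dx; apply: differentiable_comp => //; case: (fC _ Dx).
have dF t : t \in `[0, h] -> differentiable F (a + t *: v).
  move=> th; apply: differentiableB; first by apply: dsh; exact: DD.
  by have := DD _ _ th z0; rewrite scale0r addr0 => /fC[].
have [s sh Fs] := mvt_line h0 dF.
have [|t th ft] := @mvt_line _ _ ('D_v f) (a + s *: v) w h h0.
  by move=> t th; have /(fC2 v)[] := DD _ _ (subset_itv_oo_cc sh) th.
exists s, t; split; [by move: sh; rewrite in_itv|by move: th; rewrite in_itv|].
rewrite -ft -[LHS]/(F (a + h *: v) - F a) Fs /F; congr (_ * _).
have sc := subset_itv_oo_cc sh.
rewrite (@deriveB _ _ _ (fun y => f (y + h *: w)) f) ?derive_shift_arg//.
- by apply: diff_derivable; apply: dsh; exact: DD.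
- by apply: diff_derivable; have := DD _ _ sc z0; rewrite scale0r addr0 => /fC[].
Unshelve. all: by end_near. Qed.

Lemma schwarz D f a v w : open D -> C2_on D f -> D a ->
  'D_w ('D_v f) a = 'D_v ('D_w f) a.
Proof.
move=> oD fC2 Da; apply/eqP; rewrite -subr_eq0 -normr_eq0; apply/eqP.
apply/le_anti/andP; split => //; apply/ler_addgt0Pl => e e0; rewrite addr0.
have cvw : {for a, continuous ('D_w ('D_v f))} by exact: (fC2.2 v a Da).2.
have cwv : {for a, continuous ('D_v ('D_w f))} by exact: (fC2.2 w a Da).2.
have e2 : 0 < e / 2 by rewrite divr_gt0.
move/cvgrPdist_lt : cvw => /(_ _ e2) /nbhs_ballP[r /= r0 rvw].
move/cvgrPdist_lt : cwv => /(_ _ e2) /nbhs_ballP[r' /= r'0 rwv].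
pose M := `|v| + `|w| + 1.
have M0 : 0 < M by rewrite ltr_wpDl// addr_ge0.
have svw := second_difference v w oD fC2 Da.
have swv := second_difference w v oD fC2 Da.
have := filter_ex (filterI svw (filterI swv (filterI (nbhs_right_gt 0)
  (filterI (nbhs_right_lt (divr_gt0 r0 M0)) (nbhs_right_lt (divr_gt0 r'0 M0)))))).
move=> [h [[s [t [sh th st]]] [[s' [t' [sh' th' st']]] [h0 [hr hr']]]]].
have BB q b c (x y : V) : h < q / M -> `|x| + `|y| + 1 = M ->
    0 < b < h -> 0 < c < h -> ball a q (a + b *: x + c *: y).
  move=> hq xy /andP[b0 bh] /andP[c0 ch].
  rewrite -ball_normE /= -addrA opprD addrA subrr sub0r normrN.
  rewrite (le_lt_trans (ler_normD _ _))// !normrZ !gtr0_norm//.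
  apply: (@le_lt_trans _ _ (h * M)); last by rewrite -ltr_pdivlMr.
  by rewrite -xy !mulrDr mulr1 ler_wpDr ?(ltW h0)// lerD// ler_wpM2r// ltW.
have h1 := rvw _ (BB _ _ _ _ _ hr erefl sh th).
have h2 := rwv _ (BB _ _ _ _ _ hr' (congr1 (+%R^~ 1) (addrC _ _)) sh' th').
move: st st' h1 h2 => /=; rewrite (addrAC a (h *: w)).
set A := 'D_w _ (a + _ + _); set B := 'D_v _ (a + _ + _).
set u := f _; set v1 := f _; set v2 := f _; set v3 := f _ => st st' h1 h2.
clearbody A B u v1 v2 v3.
have AB : A = B.
  have : h * (h * A) = h * (h * B) by rewrite -st -st'; ring.
  by do 2!move/(mulfI (lt0r_neq0 h0)).
rewrite -AB in h2.
rewrite -(subrKA A) (le_trans (ler_normD _ _))// (splitr e) lerD ?(ltW h1)//.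
by rewrite distrC ltW.
Qed.

End C1C2.

Section Swap.
Context {R : realType} {n : nat}.
Notation T := ('rV[R]_n * 'rV[R]_n * R)%type.

Definition swap_xy (v : T) : T := (v.1.2, v.1.1, v.2).

Lemma derive_swap_xy (f : T -> R) (v w : T) :
  'D_v (f \o swap_xy) w = 'D_(swap_xy v) f (swap_xy w).
Proof. by rewrite /derive; congr (lim (_ @ _)). Qed.

End Swap.

(* Otherwise unification tries to decide equations between derivatives by
   unfolding them. *)
Local Opaque diff derive.

(** * Linear algebra *)

Section Dot.
Context {R : realType} {n : nat}.
Implicit Types (u v w : 'rV[R]_n).

Lemma dotE u v : dot u v = \sum_i u 0 i * v 0 i.
Proof. by rewrite /dot mxE; apply: eq_bigr => i _; rewrite mxE. Qed.

Lemma dotC u v : dot u v = dot v u.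
Proof. by rewrite !dotE; apply: eq_bigr => i _; rewrite mulrC. Qed.

Lemma dotDl u v w : dot (u + v) w = dot u w + dot v w.
Proof. by rewrite /dot mulmxDl mxE. Qed.

Lemma dotDr u v w : dot u (v + w) = dot u v + dot u w.
Proof. by rewrite dotC dotDl !(dotC u). Qed.

Lemma dotZl (a : R) u v : dot (a *: u) v = a * dot u v.
Proof. by rewrite /dot -scalemxAl mxE. Qed.

Lemma dotZr (a : R) u v : dot u (a *: v) = a * dot u v.
Proof. by rewrite dotC dotZl dotC. Qed.

Lemma dotNl u v : dot (- u) v = - dot u v.
Proof. by rewrite -scaleN1r dotZl mulN1r. Qed.

Lemma dotNr u v : dot u (- v) = - dot u v.
Proof. by rewrite dotC dotNl dotC. Qed.

Lemma dotBl u v w : dot (u - v) w = dot u w - dot v w.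
Proof. by rewrite dotDl dotNl. Qed.

Lemma dotBr u v w : dot u (v - w) = dot u v - dot u w.
Proof. by rewrite dotDr dotNr. Qed.

Lemma dot0l v : dot 0 v = 0.
Proof. by rewrite /dot mul0mx mxE. Qed.

Lemma dot_mulmx u v (M : 'M[R]_n) : dot (u *m M) v = dot u (v *m M^T).
Proof. by rewrite /dot trmx_mul trmxK mulmxA. Qed.

Lemma normr_coord v i : `|v 0 i| <= `|v|.
Proof.
rewrite [leRHS](mx_normrE v); apply: (le_trans _ (le_bigmax _ _ (0, i))).
exact: lexx.
Qed.

Lemma normr_rV_le v (e : R) : 0 <= e -> (forall i, `|v 0 i| <= e) -> `|v| <= e.
Proof.
move=> e0 ve; rewrite [leLHS](mx_normrE v); apply/bigmax_leP.
by split=> // -[i j] _ /=; rewrite ord1.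
Qed.

(** The norm of a row vector is the maximum norm whereas [dot] is Euclidean; with [normr_dot] this
    is the comparison behind the factors [n] in later constants. *)
Lemma sqr_norm_le_dot v : `|v| ^+ 2 <= dot v v.
Proof.
have sq i : v 0 i ^+ 2 <= dot v v.
  rewrite dotE (bigD1 i)//= -expr2 lerDl sumr_ge0// => j _.
  by rewrite -expr2 sqr_ge0.
have d0 : 0 <= dot v v by rewrite dotE sumr_ge0// => i _; rewrite -expr2 sqr_ge0.
rewrite -[leRHS]sqr_sqrtr// lerXn2r// ?nnegrE ?sqrtr_ge0//.
by apply: normr_rV_le => [|i]; rewrite ?sqrtr_ge0// -sqrtr_sqr ler_wsqrtr.
Qed.

Lemma dot_ge0 v : 0 <= dot v v.
Proof. by rewrite dotE sumr_ge0// => i _; rewrite -expr2 sqr_ge0. Qed.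

Lemma dot_gt0 v : v != 0 -> 0 < dot v v.
Proof.
move=> v0; apply: lt_le_trans (sqr_norm_le_dot v).
by rewrite exprn_gt0// normr_gt0.
Qed.

Lemma normr_dot u v : `|dot u v| <= n%:R * (`|u| * `|v|).
Proof.
rewrite dotE (le_trans (ler_norm_sum _ _ _))//.
rewrite (le_trans (ler_sum _ (G := fun=> `|u| * `|v|) _))//.
  by move=> i _; rewrite normrM ler_pM// normr_coord.
by rewrite sumr_const card_ord mulr_natl.
Qed.

End Dot.

Section Triple.
Context {R : realType} {n : nat}.
Notation T := ('rV[R]_n * 'rV[R]_n * R)%type.
Implicit Types (f : T -> R) (w : T) (x y : 'rV[R]_n) (z : R).

Lemma normr_triple x y z : `|(x, y, z) : T| = Num.max (Num.max `|x| `|y|) `|z|.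
Proof. by rewrite !prod_normE. Qed.

Lemma compact_closed_ball_rV (c : 'rV[R]_n) (r : R) :
  compact [set x : 'rV[R]_n | `|x - c| <= r].
Proof.
apply: bounded_closed_compact.
  exists (`|c| + r); split; first exact: num_real.
  move=> M crM x /= xc; rewrite (le_trans _ (ltW crM))//.
  by rewrite -[x](subrK c) (le_trans (ler_normD _ _))// addrC lerD2l.
rewrite (_ : mkset _ = closed_ball_ Num.norm c r); first exact: closed_closed_ball_.
by apply/seteqP; split=> x /=; rewrite distrC.
Qed.

Lemma compact_closed_ball_triple w (r : R) :
  compact [set v : T | `|v - w| <= r].
Proof.
have -> : [set v : T | `|v - w| <= r] =
  ([set x : 'rV[R]_n | `|x - w.1.1| <= r] `*` [set y | `|y - w.1.2| <= r])
  `*` [set z | `|z - w.2| <= r].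
  apply/seteqP; split=> -[[x y] z] /=; rewrite normr_triple !ge_max.
    by move=> /andP[/andP[-> ->] ->].
  by move=> [[-> ->] ->].
apply: compact_setX; first by apply: compact_setX; exact: compact_closed_ball_rV.
rewrite (_ : mkset _ = `[w.2 - r, w.2 + r]%classic); first exact: segment_compact.
by apply/seteqP; split=> z /=; rewrite in_itv /= ler_distl.
Qed.

Lemma triple_basis x y z : (x, y, z) =
  \sum_i x 0 i *: dirx i + \sum_i y 0 i *: diry i + z *: dirz :> T.
Proof.
have incx u : (u, 0, 0) = \sum_i u 0 i *: dirx i :> T.
  rewrite {1}[u]row_sum_delta.
  rewrite (big_morph (fun u => (u, 0, 0) : T) (id1 := 0) (op1 := +%R))//.
    by apply: eq_bigr => i _; congr (_, _, _); rewrite /= scaler0.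
  by move=> u1 u2; congr (_, _, _); rewrite /= addr0.
have incy u : (0, u, 0) = \sum_i u 0 i *: diry i :> T.
  rewrite {1}[u]row_sum_delta.
  rewrite (big_morph (fun u => (0, u, 0) : T) (id1 := 0) (op1 := +%R))//.
    by apply: eq_bigr => i _; congr (_, _, _); rewrite /= scaler0.
  by move=> u1 u2; congr (_, _, _); rewrite /= addr0.
rewrite -incx -incy; congr (_, _, _); rewrite /= ?scaler0 ?addr0 ?add0r//.
by rewrite [_ *: _]mulr1.
Qed.

Lemma diff_triple f w x y z : differentiable f w ->
  'd f w (x, y, z) = dot x (px f w) + dot y (py f w) + z * pz f w.
Proof.
move=> df.
rewrite triple_basis !linearD linearZ !linear_sum /= /pz deriveE// !dotE.
by congr (_ + _ + _); apply: eq_bigr => i _; rewrite linearZ /= mxE deriveE.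
Qed.

Lemma linear_form_dist x y z p p' q q' (r r' e : R) : 0 <= e ->
  `|p - p'| <= e -> `|q - q'| <= e -> `|r - r'| <= e ->
  `|dot x p + dot y q + z * r - (dot x p' + dot y q' + z * r')| <=
    (2 * n%:R + 1) * e * `|(x, y, z) : T|.
Proof.
move=> e0 pe qe re.
rewrite normr_triple; set M := Num.max _ _.
have [xM yM zM] : [/\ `|x| <= M, `|y| <= M & `|z| <= M].
  by rewrite /M !le_max !lexx !orbT.
have -> : dot x p + dot y q + z * r - (dot x p' + dot y q' + z * r') =
    dot x (p - p') + dot y (q - q') + z * (r - r') by rewrite !dotBr; ring.
rewrite (le_trans (ler_normD _ _))//.
have := ler_normD (dot x (p - p')) (dot y (q - q')).
have : `|dot x (p - p')| <= n%:R * (M * e).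
  by rewrite (le_trans (normr_dot _ _))// ler_wpM2l// ler_pM.
have : `|dot y (q - q')| <= n%:R * (M * e).
  by rewrite (le_trans (normr_dot _ _))// ler_wpM2l// ler_pM.
have : `|z * (r - r')| <= M * e by rewrite normrM ler_pM.
lra.
Qed.

Variable D : set T.
Hypothesis oD : open D.

Lemma C1_on_near_partials f a (e : R) : C1_on D f -> D a -> 0 < e ->
  \forall w \near a, [/\ D w, `|px f w - px f a| <= e,
    `|py f w - py f a| <= e & `|pz f w - pz f a| <= e].
Proof.
move=> fC Da e0.
have nC v : \forall w \near a, `|'D_v f a - 'D_v f w| <= e.
  by have /cvgrPdist_le := (fC a Da).2 v; apply.
have nx : \forall w \near a, forall i, `|'D_(dirx i) f a - 'D_(dirx i) f w| <= e.
  exact: (@filter_forall _ _ (fun i w => `|'D_(dirx i) f a - 'D_(dirx i) f w| <= e)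
    _ _ (fun i => nC (dirx i))).
have ny : \forall w \near a, forall i, `|'D_(diry i) f a - 'D_(diry i) f w| <= e.
  exact: (@filter_forall _ _ (fun i w => `|'D_(diry i) f a - 'D_(diry i) f w| <= e)
    _ _ (fun i => nC (diry i))).
have nD : \forall w \near a, D w by exact: open_nbhs_nbhs.
apply: filterS (filterI nD (filterI nx (filterI ny (nC dirz)))).
move=> w [Dw [xe [ye ze]]]; split.
- exact: Dw.
- by apply: (normr_rV_le (ltW e0)) => i; rewrite !mxE distrC; exact: xe.
- by apply: (normr_rV_le (ltW e0)) => i; rewrite !mxE distrC; exact: ye.
- by rewrite distrC; exact: ze.
Qed.

(** Continuity of each directional derivative becomes continuity in operator norm because finitely
    many basis directions suffice. *)
Lemma C1_on_near_diff f a (e : R) : C1_on D f -> D a -> 0 < e ->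
  \forall w \near a, D w /\ forall v : T, `|'d f w v - 'd f a v| <= e * `|v|.
Proof.
move=> fC Da e0.
have N0 : 0 < 2 * n%:R + 1 :> R by rewrite ltr_wpDl// mulr_ge0.
have e0' : 0 < e / (2 * n%:R + 1) by rewrite divr_gt0.
apply: filterS (C1_on_near_partials fC Da e0') => w [Dw xe ye ze].
split=> [|[[x y] z]]; first exact: Dw.
rewrite (congr2 (fun b c : R => b - c) (diff_triple x y z (fC w Dw).1)
  (diff_triple x y z (fC a Da).1)).
have -> : e = (2 * n%:R + 1) * (e / (2 * n%:R + 1)).
  by rewrite mulrC divfK// gt_eqF.
exact: (linear_form_dist x y z (ltW e0') xe ye ze).
Qed.

(** Mean value theorem on the segment from [c] to [b], which stays in a ball where the differential
    is within [e] of the one at [a]. *)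
Lemma C1_strict_diff f a : C1_on D f -> D a -> strict_diff f a ('d f a).
Proof.
move=> fC Da e e0.
have /nbhs_ballP[d /= d0 dD] := C1_on_near_diff fC Da e0.
exists d => // b c ba ca.
have bc t : t \in `[0, 1] -> ball a d (c + t *: (b - c)).
  rewrite in_itv /= -ball_normE /= distrC => /andP[t0 t1].
  have -> : c + t *: (b - c) - a = (1 - t) *: (c - a) + t *: (b - a).
    rewrite scalerBl scale1r -[RHS]addrA [- _ + _]addrC -scalerBr addrAC.
    by congr (_ + _ *: _); rewrite opprB subrKA.
  rewrite (le_lt_trans (ler_normD _ _))// !normrZ (ger0_norm t0) ger0_norm ?subr_ge0//.
  have [->|t0'] := eqVneq t 0; first by rewrite subr0 mul1r mul0r addr0.
  rewrite (_ : d = (1 - t) * d + t * d); last by ring.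
  apply: ler_ltD; first by rewrite ler_wpM2l ?subr_ge0// ltW.
  by rewrite ltr_pM2l// lt_neqAle eq_sym t0'.
have [|t tI] := @mvt_line _ _ f c (b - c) 1 ltr01.
  by move=> t /bc/dD[] /fC[].
have [Dt dt] := dD _ (bc t (subset_itv_oo_cc tI)).
rewrite scale1r (addrC c) subrK mul1r => ->.
rewrite deriveE; last exact: (fC _ Dt).1.
exact: dt.
Qed.

Lemma strict_diff_row m (f : 'I_m -> T -> R) (df : 'I_m -> T -> R) a :
  (forall i, strict_diff (f i) a (df i)) ->
  strict_diff (fun w => \row_i f i w) a (fun v => \row_i df i v).
Proof.
move=> fD e e0.
have : \forall d \near (0 : R)^'+, forall i b c, `|b - a| < d -> `|c - a| < d ->
    `|f i b - f i c - df i (b - c)| <= e * `|b - c|.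
  apply: (@filter_forall _ _ (fun i d => forall b c, `|b - a| < d ->
    `|c - a| < d -> `|f i b - f i c - df i (b - c)| <= e * `|b - c|)) => i.
  have [d d0 fd] := fD i e e0.
  near=> d' => b c bd cd; have d'd : d' < d by near: d'; exact: nbhs_right_lt.
  by apply: fd; [exact: lt_trans bd _|exact: lt_trans cd _].
move=> /(filterI (nbhs_right_gt 0))/filter_ex[d [d0 fd]].
exists d => // b c bd cd; apply: normr_rV_le => [|i].
  by rewrite mulr_ge0// ltW.
by rewrite !mxE; exact: fd.
Unshelve. all: by end_near. Qed.

End Triple.

Section LinearMaps.
Context {R : realType} {n : nat}.
Notation T := ('rV[R]_n * 'rV[R]_n * R)%type.

Lemma normr_mulmx_le (M : 'M[R]_n) : exists2 C : R, 0 < C &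
  forall u : 'rV[R]_n, `|u *m M| <= C * `|u|.
Proof.
pose C : R := \sum_j \sum_i `|M i j| + 1.
have C0 : 0 < C.
  by rewrite ltr_wpDl// sumr_ge0// => j _; rewrite sumr_ge0.
exists C => // u; apply: normr_rV_le => [|j]; first by rewrite mulr_ge0// ltW.
rewrite mxE (le_trans (ler_norm_sum _ _ _))//.
rewrite (le_trans (ler_sum _ (G := fun i => `|M i j| * `|u|) _))//.
  by move=> i _; rewrite normrM mulrC ler_wpM2l// normr_coord.
rewrite -mulr_suml; apply: ler_wpM2r => //.
rewrite /C [X in _ <= X + 1](bigD1 j)//= -addrA lerDl addr_ge0// sumr_ge0// => i _.
by rewrite sumr_ge0.
Qed.

Lemma mulmx_continuous (M : 'M[R]_n) : continuous (mulmxr M : 'rV[R]_n -> _).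
Proof.
have [C C0 MC] := normr_mulmx_le M.
apply: bounded_linear_continuous; apply/linear_boundedP.
apply: filterS (nbhs_pinfty_ge (num_real C)) => r Cr u.
by rewrite (le_trans (MC u))// ler_wpM2r.
Qed.

Lemma linear_triple_continuous (W : normedModType R) (f : {linear T -> W}) :
  continuous f.
Proof.
pose C : R := \sum_i `|f (dirx i)| + \sum_i `|f (diry i)| + `|f dirz|.
apply: bounded_linear_continuous; apply/linear_boundedP.
apply: filterS (nbhs_pinfty_ge (num_real C)) => r Cr [[x y] z].
apply: (@le_trans _ _ (C * `|(x, y, z) : T|)); last first.
  by rewrite ler_wpM2r.
rewrite {1}triple_basis !linearD linearZ !linear_sum /= normr_triple.
set M := Num.max _ _.
have [xM yM zM] : [/\ `|x| <= M, `|y| <= M & `|z| <= M].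
  by rewrite /M !le_max !lexx !orbT.
have sum_le (u : 'rV[R]_n) (h : 'I_n -> W) : `|u| <= M ->
    `|\sum_i u 0 i *: h i| <= (\sum_i `|h i|) * M.
  move=> uM; rewrite (le_trans (ler_norm_sum _ _ _))// mulr_suml ler_sum// => i _.
  by rewrite normrZ mulrC ler_wpM2l// (le_trans (normr_coord _ _)).
rewrite (le_trans (ler_normD _ _))// /C !mulrDl lerD//.
  rewrite (le_trans (ler_normD _ _))// lerD//.
    by under eq_bigr do rewrite linearZ; exact: sum_le.
  by under eq_bigr do rewrite linearZ; exact: sum_le.
by rewrite normrZ mulrC ler_wpM2l.
Qed.

End LinearMaps.

Section StrictDiff.
Context {R : realType} {n : nat}.
Notation T := ('rV[R]_n * 'rV[R]_n * R)%type.

Lemma strict_diff_is_diff {V W : normedModType R} (f : V -> W) a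
    (D : {linear V -> W}) : continuous D -> strict_diff f a D -> is_diff a f D.
Proof.
move=> cD fD; apply: near_is_diff => // e /fD[d d0 fd].
apply/nbhs_ballP; exists d => //= b; rewrite -ball_normE /= distrC => bd.
by apply: fd => //; rewrite subrr normr0.
Qed.

Lemma strict_diff_linear {V W : normedModType R} (f : {linear V -> W}) a :
  strict_diff f a f.
Proof.
move=> e e0; exists 1 => // b c _ _.
by rewrite linearB subrr normr0 mulr_ge0// ltW.
Qed.

Lemma strict_diff_triple {V : normedModType R} (f1 f2 : V -> 'rV[R]_n)
    (f3 : V -> R) (D1 D2 : V -> 'rV[R]_n) (D3 : V -> R) a :
  strict_diff f1 a D1 -> strict_diff f2 a D2 -> strict_diff f3 a D3 ->
  strict_diff (fun w => (f1 w, f2 w, f3 w) : T) a (fun v => (D1 v, D2 v, D3 v) : T).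
Proof.
move=> h1 h2 h3 e e0.
have [d1 d10 fd1] := h1 e e0.
have [d2 d20 fd2] := h2 e e0.
have [d3 d30 fd3] := h3 e e0.
exists (Num.min (Num.min d1 d2) d3); first by rewrite !lt_min d10 d20.
move=> b c; rewrite !lt_min => /andP[/andP[b1 b2] b3] /andP[/andP[c1 c2] c3].
by rewrite normr_triple /= !ge_max fd1// fd2// fd3.
Qed.

End StrictDiff.

(** * The linearized jet map and its inverse *)

Section JetMaps.
Context {R : realType} {n : nat}.
Notation T := ('rV[R]_n * 'rV[R]_n * R)%type.
Variables (A B E : 'M[R]_n) (a b k : 'rV[R]_n) (c : R).

(* The differentials at a point of [(x, y, z) |-> (x, g_x, g)] and of
   [(x, y, z) |-> (y, x, g)], and their inverses; here [A], [B], [k], [a], [b],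
   [c] stand for [g_xx], [g_xy], [g_xz], [g_x], [g_y], [g_z]. *)
Definition grad_form (v : T) : R := dot v.1.1 a + dot v.1.2 b + v.2 * c.

Definition jet_p (v : T) : 'rV[R]_n :=
  v.1.1 *m A^T + v.1.2 *m B^T + v.2 *: k.

Definition jet (v : T) : T := (v.1.1, jet_p v, grad_form v).

Definition jet_inv_y (v : T) : 'rV[R]_n :=
  (v.1.2 - v.1.1 *m A^T - ((v.2 - dot v.1.1 a) / c) *: k) *m invmx E^T.

Definition jet_inv (v : T) : T :=
  (v.1.1, jet_inv_y v, (v.2 - dot v.1.1 a - dot (jet_inv_y v) b) / c).

Definition jet_swap (v : T) : T := (v.1.2, v.1.1, grad_form v).

Definition jet_swap_inv (v : T) : T :=
  (v.1.2, v.1.1, (v.2 - dot v.1.2 a - dot v.1.1 b) / c).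

Lemma grad_form_linear : linear grad_form.
Proof.
move=> t [[x y] z] [[x' y'] z']; rewrite /grad_form /= !dotDl !dotZl.
rewrite -[t *: z]/(t * z) -[t *: (_ + _)]/(t * (_ + _)); ring.
Qed.
HB.instance Definition _ := GRing.isLinear.Build R T R _ grad_form grad_form_linear.

Lemma jet_p_linear : linear jet_p.
Proof.
move=> t v v'; rewrite /jet_p /= !mulmxDl -!scalemxAl.
move: (_ *m A^T) (_ *m A^T) (_ *m B^T) (_ *m B^T) => a1 a2 b1 b2.
by apply/rowP => i; rewrite !mxE -[t *: v.2]/(t * v.2); ring.
Qed.
HB.instance Definition _ := GRing.isLinear.Build R T 'rV[R]_n _ jet_p jet_p_linear.

Lemma jet_linear : linear jet.
Proof. by move=> t v v'; rewrite /jet jet_p_linear grad_form_linear. Qed.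
HB.instance Definition _ := GRing.isLinear.Build R T T _ jet jet_linear.

Lemma jet_inv_y_linear : linear jet_inv_y.
Proof.
move=> t v v'; rewrite /jet_inv_y scalemxAl -mulmxDl; congr (_ *m _) => /=.
rewrite !mulmxDl -!scalemxAl !dotDl !dotZl.
move: (_ *m A^T) (_ *m A^T) (dot _ a) (dot _ a) => a1 a2 d1 d2.
by apply/rowP => i; rewrite !mxE -[t *: v.2]/(t * v.2); ring.
Qed.

Lemma jet_inv_linear : linear jet_inv.
Proof.
move=> t v v'; rewrite /jet_inv jet_inv_y_linear; congr (_, _, _) => /=.
rewrite !dotDl !dotZl -[t *: v.2]/(t * v.2) -[t *: (_ / _)]/(t * (_ / _)); ring.
Qed.
HB.instance Definition _ := GRing.isLinear.Build R T T _ jet_inv jet_inv_linear.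

Lemma jet_swap_linear : linear jet_swap.
Proof. by move=> t v v'; rewrite /jet_swap grad_form_linear. Qed.
HB.instance Definition _ := GRing.isLinear.Build R T T _ jet_swap jet_swap_linear.

Lemma jet_swap_inv_linear : linear jet_swap_inv.
Proof.
move=> t v v'; congr (_, _, _) => /=.
rewrite !dotDl !dotZl -[t *: v.2]/(t * v.2) -[t *: (_ / _)]/(t * (_ / _)); ring.
Qed.
HB.instance Definition _ := GRing.isLinear.Build R T T _ jet_swap_inv jet_swap_inv_linear.

Hypothesis c0 : c != 0.

Lemma jet_swapK : cancel jet_swap jet_swap_inv.
Proof.
move=> [[x y] z]; rewrite /jet_swap_inv /jet_swap /grad_form /=; congr (_, _, _); field.
exact: c0.
Qed.

Lemma jet_swap_invK : cancel jet_swap_inv jet_swap.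
Proof.
move=> [[x y] z]; rewrite /jet_swap_inv /jet_swap /grad_form /=; congr (_, _, _); field.
exact: c0.
Qed.

Hypothesis defE : E = B - c^-1 *: (k^T *m b).
Hypothesis uE : E \in unitmx.

(** Eliminating z with the equation for the value turns g_xy into E in the equation for the
    gradient: this is why A2 is the condition that makes the jet map invertible. *)
Lemma mulmx_jetE (y : 'rV[R]_n) : y *m E^T = y *m B^T - (dot y b / c) *: k.
Proof.
rewrite defE linearB linearZ /= trmx_mul trmxK mulmxBr -scalemxAr mulmxA.
by rewrite [y *m b^T]mx11_scalar mul_scalar_mx scalerA mulrC.
Qed.

Lemma jetK : cancel jet jet_inv.
Proof.
move=> [[x y] z].
have yE : jet_inv_y (jet (x, y, z)) = y.
  rewrite /jet_inv_y /jet /jet_p /grad_form /=.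
  rewrite (_ : _ - _ - _ = y *m E^T) ?mulmxK ?unitmx_tr//.
  rewrite mulmx_jetE.
  rewrite (_ : (dot x a + dot y b + z * c - dot x a) / c = dot y b / c + z).
    move: (_ *m A^T) (_ *m B^T) (_ / _) => a1 b1 d.
    by apply/rowP => i; rewrite !mxE; ring.
  by field; exact: c0.
rewrite /jet_inv yE /jet /grad_form /=; congr (_, _, _); field; exact: c0.
Qed.

Lemma jet_invK : cancel jet_inv jet.
Proof.
move=> [[x p] u].
set y := jet_inv_y (x, p, u).
have yE : y *m E^T = p - x *m A^T - ((u - dot x a) / c) *: k.
  by rewrite /y /jet_inv_y mulmxKV ?unitmx_tr.
rewrite /jet_inv -/y /jet /jet_p /grad_form /=; congr (_, _, _); last by field; exact: c0.
rewrite mulrBl scalerBl.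
move: yE; rewrite mulmx_jetE => /eqP; rewrite subr_eq => /eqP ->.
move: (_ *m A^T) (_ *: k) (_ *: k) => a1 k1 k2.
by apply/rowP => i; rewrite !mxE; ring.
Qed.

End JetMaps.

(** * Generating functions *)

Section GenFunDef.
Context {R : realType} {n : nat}.
Notation T := ('rV[R]_n * 'rV[R]_n * R)%type.

Definition matE (gy : T -> 'rV[R]_n) (gz : T -> R) (gxy : T -> 'M[R]_n)
    (gxz : T -> 'rV[R]_n) (w : T) : 'M[R]_n :=
  gxy w - (gz w)^-1 *: ((gxz w)^T *m gy w).

Definition vecQ (gy : T -> 'rV[R]_n) (gz : T -> R) (w : T) : 'rV[R]_n :=
  - (gz w)^-1 *: gy w.

(* The derivatives are separate variables: the convexity argument below only
   uses the differentiability relations between them. *)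
Record genfun (G : set T) (g : T -> R) (gx gy : T -> 'rV[R]_n) (gz : T -> R)
    (gxx gxy : T -> 'M[R]_n) (gxz : T -> 'rV[R]_n) : Prop := GenFun {
  gf_open : open G;
  gf_diff : forall w, G w -> strict_diff g w (grad_form (gx w) (gy w) (gz w));
  gf_diffx : forall w, G w -> strict_diff gx w
    (jet_p (gxx w) (gxy w) (gxz w));
  gf_z : forall w, G w -> gz w < 0;
  gf_cz : forall w, G w -> {for w, continuous gz};
  gf_cxx : forall w, G w -> {for w, continuous gxx};
  gf_cE : forall w, G w -> {for w, continuous (matE gy gz gxy gxz)};
  gf_Q : forall w, G w -> exists2 DQ : T -> 'rV[R]_n,
    strict_diff (vecQ gy gz) w DQ &
    forall x, DQ (x, 0, 0) = - (gz w)^-1 *: (x *m matE gy gz gxy gxz w);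
  gf_unit : forall w, G w -> matE gy gz gxy gxz w \in unitmx;
  gf_inj : forall w w', G w -> G w' ->
    (w.1.1, gx w, g w) = (w'.1.1, gx w', g w') -> w = w';
  gf_injQ : forall x x' y z, G (x, y, z) -> G (x', y, z) ->
    vecQ gy gz (x, y, z) = vecQ gy gz (x', y, z) -> x = x'
}.

End GenFunDef.

Section Inverses.
Context {R : realType} {n : nat}.
Notation T := ('rV[R]_n * 'rV[R]_n * R)%type.
Variables (G : set T) (g : T -> R) (gx gy : T -> 'rV[R]_n) (gz : T -> R)
  (gxx gxy : T -> 'M[R]_n) (gxz : T -> 'rV[R]_n).
Hypothesis H : genfun G g gx gy gz gxx gxy gxz.
Notation E := (matE gy gz gxy gxz).
Notation Q := (vecQ gy gz).

(** The 1-jet in the order (x, p, u), while [U] uses (x, u, p): source and target then have the same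
    type. *)
Definition phi (w : T) : T := (w.1.1, gx w, g w).

Lemma gz_neq0 w : G w -> gz w != 0.
Proof. by move=> Gw; rewrite lt_eqF// (gf_z H). Qed.

Lemma strict_diff_phi w : G w ->
  strict_diff phi w (jet (gxx w) (gxy w) (gx w) (gy w) (gxz w) (gz w)).
Proof.
move=> Gw; apply: strict_diff_triple.
- by move=> e e0; exists 1 => // b c _ _; rewrite /= subrr normr0 mulr_ge0// ltW.
- exact: gf_diffx H _ Gw.
- exact: gf_diff H _ Gw.
Qed.

Variable S : T -> T.
Hypothesis SK : forall w, G w -> S (phi w) = w.

Lemma phi_open w (N : set T) : G w -> nbhs w N -> nbhs (phi w) (phi @` N).
Proof.
move=> Gw Nw.
have h1 := jetK (gxx w) (gx w) (gz_neq0 Gw) erefl (gf_unit H Gw).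
have h2 := jet_invK (gxx w) (gx w) (gz_neq0 Gw) erefl (gf_unit H Gw).
have h3 := @strict_diff_open _ _ _ _ _ _ _ (strict_diff_phi Gw)
  (@linear_triple_continuous _ _ _ _) h1 h2.
apply: h3 Nw.
exact: compact_closed_ball_triple.
Qed.

Lemma open_phi : open (phi @` G).
Proof.
rewrite openE => _ [w Gw <-]; apply: phi_open => //.
by apply: open_nbhs_nbhs; split=> //; exact: gf_open H.
Qed.

(** [S] is any left inverse of [phi]; its continuity is the openness of [phi]. *)
Lemma S_continuous w : G w -> {for phi w, continuous S}.
Proof.
move=> Gw N; rewrite SK// => Nw.
have NG : nbhs w (N `&` G).
  by apply: filterI => //; apply: open_nbhs_nbhs; split=> //; exact: gf_open H.
apply: filterS (phi_open Gw NG) => _ [w' [Nw' Gw'] <-] /=.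
by rewrite SK.
Qed.

Lemma S_diff w : G w -> is_diff (phi w) S
  (jet_inv (gxx w) (E w) (gx w) (gy w) (gxz w) (gz w)).
Proof.
move=> Gw.
have h1 := jetK (gxx w) (gx w) (gz_neq0 Gw) erefl (gf_unit H Gw).
have h2 := @strict_diff_inverse _ _ _ _ _ _ _ (strict_diff_phi Gw)
  (@linear_triple_continuous _ _ _ _) h1 G S.
apply: h2.
- by apply: phi_open => //; apply: open_nbhs_nbhs; split=> //; exact: gf_open H.
- exact: S_continuous.
- by move=> b; exact: SK.
- exact: SK.
Qed.

Lemma phi_S v : (phi @` G) v -> G (S v) /\ phi (S v) = v.
Proof. by move=> [w Gw <-]; rewrite SK. Qed.

Lemma near_slice (P : set T) (x y : 'rV[R]_n) (z : R) :
  nbhs (x, y, z) P -> \forall x' \near x, P (x', y, z).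
Proof.
move=> nP.
move: nP => /nbhs_ballP[d /= d0 dP]; apply/nbhs_ballP; exists d => //= x'.
rewrite -!ball_normE /= => xx'; apply: dP; rewrite -ball_normE /=.
rewrite (_ : _ - _ = (x - x', 0, 0)); last by congr (_, _, _); rewrite /= subrr.
by rewrite normr_triple !normr0 !max_l.
Qed.

Section FixedYZ.
Variables (y0 : 'rV[R]_n) (z0 : R) (X : 'rV[R]_n -> 'rV[R]_n).
Hypothesis XK : forall x, G (x, y0, z0) -> X (Q (x, y0, z0)) = x.

(** The differential of Q in x is - E / g_z, invertible by A2, so Q is a local chart in x: the
    coordinates in which g-convexity is convexity. *)
Lemma strict_diff_Qx x : G (x, y0, z0) ->
  strict_diff (fun x => Q (x, y0, z0)) x
    (mulmxr (- (gz (x, y0, z0))^-1 *: E (x, y0, z0))).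
Proof.
move=> Gw e e0.
have [DQ dQ DQE] := gf_Q H Gw.
have [d d0 fd] := dQ e e0.
exists d => // b c bd cd.
have nt (u v : 'rV[R]_n) : (u, y0, z0) - (v, y0, z0) = (u - v, 0, 0) :> T.
  by congr (_, _, _); rewrite /= subrr.
have nn (u v : 'rV[R]_n) : `|((u, y0, z0) : T) - (v, y0, z0)| = `|u - v|.
  by rewrite nt normr_triple !normr0 !max_l.
have := fd (b, y0, z0) (c, y0, z0); rewrite !nn nt DQE /= -scalemxAr; exact.
Qed.

Let Qx_DK x : G (x, y0, z0) ->
  cancel (mulmxr (- (gz (x, y0, z0))^-1 *: E (x, y0, z0)) : 'rV[R]_n -> 'rV[R]_n)
         (mulmxr (- gz (x, y0, z0) *: invmx (E (x, y0, z0)))).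
Proof.
move=> Gw u /=; rewrite -!scalemxAr -scalemxAl scalerA mulrNN.
by rewrite mulfV ?gz_neq0// scale1r mulmxK// (gf_unit H).
Qed.

Lemma Qx_open x (N : set 'rV[R]_n) : G (x, y0, z0) -> nbhs x N ->
  nbhs (Q (x, y0, z0)) [set Q (x', y0, z0) | x' in N].
Proof.
move=> Gw Nx.
have LK : cancel (mulmxr (- gz (x, y0, z0) *: invmx (E (x, y0, z0))) : 'rV[R]_n -> 'rV[R]_n)
                 (mulmxr (- (gz (x, y0, z0))^-1 *: E (x, y0, z0))).
  move=> u /=; rewrite -!scalemxAr -scalemxAl scalerA mulrNN.
  by rewrite mulVf ?gz_neq0// scale1r mulmxKV// (gf_unit H).
have := strict_diff_open (strict_diff_Qx Gw) (@mulmx_continuous _ _ _) (Qx_DK Gw) LK.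
by apply=> //; exact: compact_closed_ball_rV.
Qed.

Lemma near_section x : G (x, y0, z0) -> nbhs x [set x' | G (x', y0, z0)].
Proof.
by move=> Gw; apply: near_slice; apply: open_nbhs_nbhs; split=> //; exact: gf_open H.
Qed.

Lemma is_diff_X x : G (x, y0, z0) -> is_diff (Q (x, y0, z0)) X
  (mulmxr (- gz (x, y0, z0) *: invmx (E (x, y0, z0)))).
Proof.
move=> Gw.
have := strict_diff_inverse (strict_diff_Qx Gw) (@mulmx_continuous _ _ _) (Qx_DK Gw)
  (Qx_open Gw (near_section Gw)).
apply => //; last exact: XK.
move=> N; rewrite XK// => Nx.
have NG : nbhs x (N `&` [set x' | G (x', y0, z0)]).
  by apply: filterI => //; exact: near_section.
apply: filterS (Qx_open Gw NG) => _ [x' [Nx' Gx'] <-] /=.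
by rewrite XK.
Qed.

End FixedYZ.

End Inverses.

Section MatrixNorm.
Context {R : realType} {n : nat}.
Implicit Types (u : 'rV[R]_n) (M N : 'M[R]_n).

Lemma normr_entry M i j : `|M i j| <= `|M|.
Proof.
rewrite [leRHS](mx_normrE M); apply: (le_trans _ (le_bigmax _ _ (i, j))).
exact: lexx.
Qed.

Lemma normr_mulmx u M : `|u *m M| <= n%:R * `|M| * `|u|.
Proof.
apply: normr_rV_le => [|j]; first by rewrite !mulr_ge0.
rewrite mxE (le_trans (ler_norm_sum _ _ _))//.
rewrite (le_trans (ler_sum _ (G := fun=> `|M| * `|u|) _))//.
  by move=> i _; rewrite normrM mulrC ler_pM ?normr_coord ?normr_entry.
by rewrite sumr_const card_ord -mulrA mulr_natl.
Qed.

(** The term coming from [M - N] is at most half of [|u|] and is absorbed in the left-hand side, so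
    that only the inverse of the fixed matrix [N] enters. *)
Lemma solve_perturbed u M N (s e : R) : 0 <= s -> N \in unitmx ->
  `|M - N| <= s -> n%:R * `|invmx N| * (n%:R * s) <= 2^-1 ->
  `|u *m M| <= e -> `|u| <= 2 * (n%:R * `|invmx N|) * e.
Proof.
move=> s0 uN MN sN uM.
have C0 : 0 <= n%:R * `|invmx N| by rewrite mulr_ge0.
set C := _ * `|invmx N| in C0 sN *.
have : `|u| <= C * (e + n%:R * s * `|u|).
  rewrite -{1}[u](mulmxK uN) (le_trans (normr_mulmx _ _))// ler_wpM2l//.
  rewrite (_ : u *m N = u *m M - u *m (M - N)); last first.
    by rewrite mulmxBr subKr.
  rewrite (le_trans (ler_normB _ _))// lerD//.
  by rewrite (le_trans (normr_mulmx _ _))// ler_wpM2r// ler_wpM2l.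
have : C * (n%:R * s) * `|u| <= 2^-1 * `|u| by rewrite ler_wpM2r.
lra.
Qed.

End MatrixNorm.

(** * The direction [vecV] and the first variation of a section *)

Section Direction.
Context {R : realType} {n : nat}.
Notation T := ('rV[R]_n * 'rV[R]_n * R)%type.
Variables (G : set T) (g : T -> R) (gx gy : T -> 'rV[R]_n) (gz : T -> R)
  (gxx gxy : T -> 'M[R]_n) (gxz : T -> 'rV[R]_n).
Hypothesis H : genfun G g gx gy gz gxx gxy gxz.
Notation E := (matE gy gz gxy gxz).
Notation Q := (vecQ gy gz).

(* To first order this is [x' - x], and it is chosen so that moving [y] by
   [y'] changes [Q (x', y, z) - Q (x, y, z)] paired with [y'] exactly through
   [dot (vecV w w') (y' *m (E w)^T)]. *)
Definition vecV (w w' : T) : 'rV[R]_n :=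
  - gz w *: ((Q w' - Q w) *m invmx (E w)).

Lemma vecV_mulmx w w' : G w -> vecV w w' *m E w = - gz w *: (Q w' - Q w).
Proof. by move=> Gw; rewrite -scalemxAl mulmxKV// (gf_unit H). Qed.

(** [vecV] equals x' - x up to an error at most a small multiple of |x' - x|, uniformly near [w0];
    hence moving along it brings x closer to x'. *)
Lemma near_direction w0 : G w0 -> exists2 d : R, 0 < d &
  forall x x' y z, `|((x, y, z) : T) - w0| < d -> `|((x', y, z) : T) - w0| < d ->
  [/\ G (x, y, z), G (x', y, z) &
      x != x' -> 0 < dot (x' - x) (vecV (x, y, z) (x', y, z))].
Proof.
move=> G0; set E0 := E w0; set c0 := gz w0.
pose C : R := n%:R * `|invmx E0|.
pose K : R := 2 * `|c0| + n%:R * `|E0| + n%:R.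
have C0 : 0 <= C by rewrite mulr_ge0.
have K0 : 0 <= K by rewrite !addr_ge0 ?mulr_ge0.
(* With [t = M^-1] each summand times [t] is at most 1. They give respectively [t <= 1], the
   smallness demanded by [solve_perturbed], and the final bound of the error by half of [|D| ^+ 2];
   [K] collects the three terms of [zeE]. *)
pose M : R := 1 + 2 * (C * n%:R) + 4 * (n%:R * (C * K)).
have M0 : 0 < M by rewrite !ltr_wpDr// !mulr_ge0.
pose t : R := M^-1.
have t0 : 0 < t by rewrite invr_gt0.
have Mt : M * t = 1 by rewrite mulfV// gt_eqF.
clearbody t.
have a0 : 0 <= C * n%:R * t by rewrite !mulr_ge0// ltW.
have b0 : 0 <= n%:R * (C * K) * t by rewrite !mulr_ge0// ltW.
have tM : t + 2 * (C * n%:R * t) + 4 * (n%:R * (C * K) * t) = 1.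
  by rewrite -[RHS]Mt /M; ring.
have c0n : c0 != 0 by exact: gz_neq0 H _ G0.
have [DQ dQ DQE] := gf_Q H G0.
have [d1 d10 fQ] := dQ _ t0.
have tc0 : 0 < t * `|c0| by rewrite mulr_gt0// normr_gt0.
have /cvgrPdist_le/(_ _ tc0) nz := gf_cz H G0.
have /cvgrPdist_le/(_ _ t0) nE := gf_cE H G0.
have nG : \forall w \near w0, G w.
  by apply: open_nbhs_nbhs; split=> //; exact: gf_open H.
have nA : nbhs w0 [set w | G w /\ (`|gz w0 - gz w| <= t * `|c0| /\ `|E w0 - E w| <= t)].
  by apply: filterI => //; exact: filterI.
have /nbhs_ballP[d2 /= d20 near2] := nA.
exists (Num.min d1 d2); first by rewrite lt_min d10.
move=> x x' y z; rewrite !lt_min => /andP[w1 w2] /andP[w1' w2'].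
set w := (x, y, z) in w1 w2 *; set w' := (x', y, z) in w1' w2' *.
have [Gw [cw Ew]] := near2 w ltac:(by rewrite -ball_normE /= distrC).
have [Gw' _] := near2 w' ltac:(by rewrite -ball_normE /= distrC).
split=> // xx'; set D := x' - x.
have D0 : 0 < `|D| by rewrite normr_gt0 subr_eq0 eq_sym.
set V := vecV w w'.
have VE : V *m E w = - gz w *: (Q w' - Q w) by exact: vecV_mulmx.
have ww' : w' - w = (D, 0, 0) by congr (_, _, _); rewrite /= subrr.
pose r1 := Q w' - Q w + c0^-1 *: (D *m E0).
have r1D : `|r1| <= t * `|D|.
  have := fQ w' w w1' w1; rewrite ww' DQE scaleNr opprK.
  by rewrite normr_triple !normr0 !max_l.
pose ze := V - D.
have zeE : ze *m E w = - gz w *: r1 + (gz w / c0 - 1) *: (D *m E0) - D *m (E w - E0).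
  rewrite mulmxBl VE (mulmxBr D (E w) E0) /r1.
  move: (Q w' - Q w) (D *m E0) (D *m E w) => q1 q2 q3.
  by apply/rowP => i; rewrite !mxE; ring.
have cE : gz w / c0 - 1 = (gz w - c0) / c0 by field; exact: c0n.
have cc : `|gz w / c0 - 1| <= t.
  rewrite cE normrM normfV ler_pdivrMr ?normr_gt0// distrC; exact: cw.
have cw2 : `|gz w| <= 2 * `|c0|.
  have -> : gz w = (gz w / c0 - 1) * c0 + c0 by field; exact: c0n.
  rewrite (le_trans (ler_normD _ _))// normrM.
  have : `|gz w / c0 - 1| * `|c0| <= 1 * `|c0|.
    rewrite ler_wpM2r// (le_trans cc)//; move: tM a0 b0; lra.
  lra.
have zeEb : `|ze *m E w| <= t * K * `|D|.
  rewrite zeE (le_trans (ler_normB _ _))//.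
  have h1 : `|- gz w *: r1| <= 2 * `|c0| * (t * `|D|).
    by rewrite normrZ normrN ler_pM.
  have h2 : `|(gz w / c0 - 1) *: (D *m E0)| <= t * (n%:R * `|E0| * `|D|).
    by rewrite normrZ ler_pM// normr_mulmx.
  have h3 : `|D *m (E w - E0)| <= n%:R * t * `|D|.
    rewrite (le_trans (normr_mulmx _ _))// ler_wpM2r// ler_wpM2l//.
    by rewrite distrC; exact: Ew.
  have := ler_normD (- gz w *: r1) ((gz w / c0 - 1) *: (D *m E0)).
  rewrite /K; move: h1 h2 h3; lra.
have : `|ze| <= 2 * C * (t * K * `|D|).
  apply: (@solve_perturbed _ _ ze (E w) E0 t) => //; first exact: ltW.
  - exact: gf_unit H _ G0.
  - by rewrite distrC; exact: Ew.
  - by rewrite -/C; move: tM t0 a0 b0; lra.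
move=> zeb.
have h4 : `|dot D ze| <= n%:R * (`|D| * (2 * C * (t * K * `|D|))).
  by rewrite (le_trans (normr_dot _ _))// ler_wpM2l// ler_wpM2l.
have -> : V = D + ze by rewrite /ze addrC subrK.
rewrite dotDr.
have h5 := sqr_norm_le_dot D.
have h6 : 0 < `|D| ^+ 2 by rewrite exprn_gt0.
have h7 : n%:R * (`|D| * (2 * C * (t * K * `|D|))) <= 2^-1 * `|D| ^+ 2.
  rewrite (_ : _ * (_ * (_ * _)) = 2 * (n%:R * (C * K) * t) * `|D| ^+ 2); last by ring.
  by rewrite ler_wpM2r ?(ltW h6)//; move: tM t0 a0; lra.
move: h4; rewrite ler_norml => /andP[h4 _]; move: h4 h5 h6 h7; lra.
Qed.

End Direction.

Section ReplaceX.
Context {R : realType} {n : nat}.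
Notation T := ('rV[R]_n * 'rV[R]_n * R)%type.

Definition freeze (v : T) : T := (0, v.1.2, v.2).

Lemma freeze_linear : linear freeze.
Proof. by move=> t v v'; congr (_, _, _); rewrite /= scaler0 addr0. Qed.
HB.instance Definition _ := GRing.isLinear.Build R T T _ freeze freeze_linear.

Definition replace_x (x : 'rV[R]_n) (w : T) : T := (x, w.1.2, w.2).

Lemma is_diff_replace_x x w : is_diff w (replace_x x) freeze.
Proof.
apply: strict_diff_is_diff; first exact: linear_triple_continuous.
move=> e e0; exists 1 => // b c _ _.
have -> : replace_x x b - replace_x x c = freeze (b - c).
  by congr (_, _, _); rewrite /= subrr.
by rewrite subrr normr0 mulr_ge0// ltW.
Qed.

End ReplaceX.

Section Variation.
Context {R : realType} {n : nat}.
Notation T := ('rV[R]_n * 'rV[R]_n * R)%type.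
Variables (G : set T) (g : T -> R) (gx gy : T -> 'rV[R]_n) (gz : T -> R)
  (gxx gxy : T -> 'M[R]_n) (gxz : T -> 'rV[R]_n).
Hypothesis H : genfun G g gx gy gz gxx gxy gxz.
Notation E := (matE gy gz gxy gxz).
Notation Q := (vecQ gy gz).
Notation V := (vecV gy gz gxy gxz).
Notation phi := (phi g gx).
Notation jinv w := (jet_inv (gxx w) (E w) (gx w) (gy w) (gxz w) (gz w)).
Variable S : T -> T.
Hypothesis SK : forall w, G w -> S (phi w) = w.

(** The value at [x'] of the section whose 1-jet is [c]. *)
Definition moved_value x' (c : T) : R := g (replace_x x' (S c)).

Definition moved_diff x' w v : R :=
  let w' := replace_x x' w in
  grad_form (gx w') (gy w') (gz w') (freeze (jinv w v)).

Lemma is_diff_g w : G w -> is_diff w g (grad_form (gx w) (gy w) (gz w)).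
Proof.
move=> Gw; apply: strict_diff_is_diff; first exact: linear_triple_continuous.
exact: gf_diff H _ Gw.
Qed.

Lemma is_diff_gx w : G w -> is_diff w gx (jet_p (gxx w) (gxy w) (gxz w)).
Proof.
move=> Gw; apply: strict_diff_is_diff; first exact: linear_triple_continuous.
exact: gf_diffx H _ Gw.
Qed.

Lemma is_diff_moved_value x' w : G w -> G (replace_x x' w) ->
  is_diff (phi w) (moved_value x') (moved_diff x' w).
Proof.
move=> Gw Gw'.
have dS := S_diff H SK Gw.
have h1 : is_diff (S (phi w)) (replace_x x') freeze by exact: is_diff_replace_x.
have h2 : is_diff ((replace_x x' \o S) (phi w)) g
  (grad_form (gx (replace_x x' w)) (gy (replace_x x' w)) (gz (replace_x x' w))).
  by rewrite /= SK//; exact: is_diff_g.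
exact: (is_diff_comp (is_diff_comp dS h1) h2).
Qed.

(** If du = p . dx, then dy E^T = dp - dx A^T and g_y . dy + g_z dz = 0 at x. The variation at x' is
    therefore - g_z(x') (Q(x') - Q(x)) . dy, which [vecV] rewrites as a pairing with dy E^T. *)
Lemma moved_diffE x' w v : G w -> G (replace_x x' w) ->
  v.2 = dot v.1.1 (gx w) ->
  moved_diff x' w v = gz (replace_x x' w) / gz w *
    dot (V w (replace_x x' w)) (v.1.2 - v.1.1 *m (gxx w)^T).
Proof.
move=> Gw Gw' vx.
have z0 := gz_neq0 H Gw.
have z0' := gz_neq0 H Gw'.
rewrite /moved_diff /freeze /grad_form dot0l add0r /jet_inv /= vx subrr sub0r.
set y := jet_inv_y _ _ _ _ _ _.
have yE : v.1.2 - v.1.1 *m (gxx w)^T = y *m (E w)^T.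
  rewrite /y /jet_inv_y vx subrr mul0r scale0r subr0 mulmxKV// unitmx_tr.
  exact: gf_unit H _ Gw.
rewrite yE -dot_mulmx (vecV_mulmx H)// dotZl dotBl /vecQ !dotZl !(dotC _ y).
by field; rewrite z0 z0'.
Qed.

(** The value is always that of the first section, so the path makes sense off {g_1 = g_0}; its end
    at [t = 1] is the jet of the second section only on that set. *)
Definition jet_path (y0 y1 : 'rV[R]_n) (z0 z1 t : R) (x : 'rV[R]_n) : T :=
  (x, segpt (gx (x, y0, z0)) (gx (x, y1, z1)) t, g (x, y0, z0)).

Lemma is_diff_jet_path y0 y1 z0 z1 t x : G (x, y0, z0) -> G (x, y1, z1) ->
  is_diff x (jet_path y0 y1 z0 z1 t) (fun v => (v,
    (1 - t) *: (v *m (gxx (x, y0, z0))^T) + t *: (v *m (gxx (x, y1, z1))^T),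
    dot v (gx (x, y0, z0))) : T).
Proof.
move=> G0 G1.
have di (y : 'rV[R]_n) (z : R) : is_diff x (fun x => (x, y, z) : T) (fun v => (v, 0, 0) : T).
  exact: (is_diff_pair (is_diff_pair (is_diff_id x) (is_diff_cst y x)) (is_diff_cst z x)).
have d0 := is_diff_comp (di y0 z0) (is_diff_gx G0).
have d1 := is_diff_comp (di y1 z1) (is_diff_gx G1).
have dg := is_diff_comp (di y0 z0) (is_diff_g G0).
have dp := is_diffD (is_diffZ (1 - t) d0) (is_diffZ t d1).
apply: is_diff_eq (is_diff_pair (is_diff_pair (is_diff_id x) dp) dg) _.
apply/funext => v; congr (_, _, _).
  by rewrite /= -[LHS]/(_ *: _ + _ *: _) /= /jet_p /= !mul0mx !scale0r !addr0.
by rewrite /= /grad_form /= dot0l mul0r !addr0.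
Qed.

Lemma is_derive_jet_path y0 y1 z0 z1 t x :
  is_derive t (1 : R) (fun t => jet_path y0 y1 z0 z1 t x)
    ((0, gx (x, y1, z1) - gx (x, y0, z0), 0) : T).
Proof.
rewrite (_ : (fun t => _) = fun t : R => jet_path y0 y1 z0 z1 0 x +
    t *: ((0, gx (x, y1, z1) - gx (x, y0, z0), 0) : T)).
  exact: is_derive_line.
apply/funext => s; rewrite /jet_path /segpt; congr (_, _, _) => /=.
- by rewrite scaler0 addr0.
- move: (gx _) (gx _) => p q; by apply/rowP => i; rewrite !mxE; ring.
- by rewrite [s *: _]mulr0 addr0.
Qed.

End Variation.

Section Continuity.

Lemma continuous_at_pair {A B C : topologicalType} (f : A -> B) (h : A -> C) x :
  {for x, continuous f} -> {for x, continuous h} ->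
  {for x, continuous (fun a => (f a, h a))}.
Proof. by move=> cf ch; apply: cvg_pair. Qed.

Lemma continuous_at_comp {A B C : topologicalType} (f : A -> B) (h : B -> C) x :
  {for x, continuous f} -> {for f x, continuous h} ->
  {for x, continuous (fun a => h (f a))}.
Proof. exact: continuous_comp. Qed.

Lemma continuous_at_fst {A B C : topologicalType} (f : A -> B * C) x :
  {for x, continuous f} -> {for x, continuous (fun a => (f a).1)}.
Proof. by move=> cf; apply: (continuous_at_comp cf); exact: cvg_fst. Qed.

Lemma continuous_at_snd {A B C : topologicalType} (f : A -> B * C) x :
  {for x, continuous f} -> {for x, continuous (fun a => (f a).2)}.
Proof. by move=> cf; apply: (continuous_at_comp cf); exact: cvg_snd. Qed.

Lemma continuous_at_segpt {R : realType} {A : topologicalType} {n : nat}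
    (p q : A -> 'rV[R]_n) (t : A -> R) x :
  {for x, continuous p} -> {for x, continuous q} -> {for x, continuous t} ->
  {for x, continuous (fun a => segpt (p a) (q a) (t a))}.
Proof.
move=> cp cq ct.
have c1 : {for x, continuous (fun a => 1 - t a)}.
  by apply: cvgB => //; exact: cvg_cst.
by apply: cvgD; apply: cvgZ.
Qed.

End Continuity.

(** * Uniform neighbourhoods *)

Section Admissible.
Context {R : realType} {n : nat}.
Notation T := ('rV[R]_n * 'rV[R]_n * R)%type.
Variables (G : set T) (g : T -> R) (gx gy : T -> 'rV[R]_n) (gz : T -> R)
  (gxx gxy : T -> 'M[R]_n) (gxz : T -> 'rV[R]_n).
Hypothesis H : genfun G g gx gy gz gxx gxy gxz.
Notation E := (matE gy gz gxy gxz).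
Notation Q := (vecQ gy gz).
Notation V := (vecV gy gz gxy gxz).
Notation phi := (phi g gx).
Notation jet_path := (jet_path g gx).
Variable S : T -> T.
Hypothesis SK : forall w, G w -> S (phi w) = w.

Lemma g_continuous w : G w -> {for w, continuous g}.
Proof.
by move=> Gw; apply: differentiable_continuous; case: (is_diff_g H Gw).
Qed.

Lemma gx_continuous w : G w -> {for w, continuous gx}.
Proof.
by move=> Gw; apply: differentiable_continuous; case: (is_diff_gx H Gw).
Qed.

(* A neighbourhood on which everything the maximum principle needs holds. *)
Definition admissible (d : R) (x0 y0 y1 : 'rV[R]_n) (z0 z1 : R) :=
  forall x x', `|x - x0| < d -> `|x' - x0| < d ->
  [/\ G (x, y0, z0), G (x, y1, z1) & forall t, t \in `[0, 1] ->
    let c := jet_path y0 y1 z0 z1 t x in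
    [/\ (phi @` G) c, G (replace_x x' (S c)) &
        x != x' -> 0 < dot (x' - x) (V (S c) (replace_x x' (S c)))]].

Lemma admissible_near x0 y0 y1 z0 z1 : G (x0, y0, z0) -> G (x0, y1, z1) ->
  (forall t, t \in `[0, 1] -> (phi @` G) (jet_path y0 y1 z0 z1 t x0)) ->
  exists2 d : R, 0 < d & forall y z, `|y - y1| < d -> `|z - z1| < d ->
    admissible d x0 y0 y z0 z.
Proof.
move=> G0 G1 U0.
pose W := (('rV[R]_n * 'rV[R]_n) * ('rV[R]_n * R))%type.
pose i0 : W := ((x0, x0), (y1, z1)).
pose P (i : W) (t : R) :=
  let c := jet_path y0 i.2.1 z0 i.2.2 t i.1.1 in
  [/\ (phi @` G) c, G (replace_x i.1.2 (S c)) & i.1.1 != i.1.2 ->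
    0 < dot (i.1.2 - i.1.1) (V (S c) (replace_x i.1.2 (S c)))].
have cov : \forall i \near i0, `[0, 1]%classic `<=` P i.
  have /compact_near_coveringP nc : compact `[(0 : R), 1]%classic.
    exact: segment_compact.
  apply: (nc W (nbhs i0) P) => t tI.
  have [w Gw wc] := U0 t tI.
  have Sw : S (jet_path y0 y1 z0 z1 t x0) = w by rewrite -wc SK.
  have cid : {for (t, i0), continuous (id : R * W -> R * W)} by exact: cvg_id.
  have ct := continuous_at_fst cid.
  have ci := continuous_at_snd cid.
  have cx := continuous_at_fst (continuous_at_fst ci).
  have cx' := continuous_at_snd (continuous_at_fst ci).
  have cy := continuous_at_fst (continuous_at_snd ci).
  have cz := continuous_at_snd (continuous_at_snd ci).
  have ccst (A : topologicalType) (a : A) :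
    {for (t, i0), continuous ((fun=> a) : R * W -> A)}.
    exact: cvg_cst.
  have ca0 := continuous_at_pair (continuous_at_pair cx (ccst _ y0)) (ccst _ z0).
  have ca1 := continuous_at_pair (continuous_at_pair cx cy) cz.
  have cg := continuous_at_comp ca0 (g_continuous G0).
  have cp0 := continuous_at_comp ca0 (gx_continuous G0).
  have cp1 := continuous_at_comp ca1 (gx_continuous G1).
  have cc := continuous_at_pair (continuous_at_pair cx (continuous_at_segpt cp0 cp1 ct)) cg.
  have cS' : {for jet_path y0 y1 z0 z1 t x0, continuous S}.
    by rewrite -wc; exact: (S_continuous H SK Gw).
  have cS := continuous_at_comp cc cS'.
  have cR := continuous_at_pair (continuous_at_pair cx'
    (continuous_at_snd (continuous_at_fst cS))) (continuous_at_snd cS).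
  (* The positivity degenerates as x tends to x', so it is not obtained by continuity;
     [near_direction] gives it on a full neighbourhood. *)
  have [d d0 near_d] := near_direction H Gw.
  have n1 : nbhs (t, i0) [set a : R * W |
      (phi @` G) (jet_path y0 a.2.2.1 z0 a.2.2.2 a.1 a.2.1.1)].
    apply: cc; rewrite -[X in nbhs X]wc.
    by apply: open_nbhs_nbhs; split; [exact: open_phi H|exact: imageP].
  have wx : w.1.1 = x0 by have := congr1 (fst \o fst) wc.
  have bw : nbhs w (ball w d) by exact: nbhsx_ballx.
  have n2 : nbhs (t, i0) [set a : R * W |
      ball w d (S (jet_path y0 a.2.2.1 z0 a.2.2.2 a.1 a.2.1.1))].
    by apply: cS; rewrite -[X in nbhs X]Sw in bw.
  have n3 : nbhs (t, i0) [set a : R * W | ball w d (replace_x a.2.1.2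
      (S (jet_path y0 a.2.2.1 z0 a.2.2.2 a.1 a.2.1.1)))].
    apply: cR; rewrite /= Sw -wx; clear -bw.
    by case: w bw => -[].
  suff : nbhs (t, i0) [set a : R * W | P a.2 a.1] by [].
  apply: filterS (filterI n1 (filterI n2 n3)) => -[s [[x x'] [y z]]] /= [Uc [b2 b3]].
  have [GS phiS] := phi_S SK Uc.
  have Sx : (S (jet_path y0 y z0 z s x)).1.1 = x by have := congr1 (fst \o fst) phiS.
  rewrite /P /=; move: Uc b2 b3 GS Sx.
  set c := jet_path _ _ _ _ _ _ => Uc; case: (S c) => -[x2 y2] z2.
  rewrite /replace_x -!ball_normE /= => b2 b3 GS x2x; rewrite x2x in b2 GS *.
  have [_ G2 dpos] := near_d x x' y2 z2 ltac:(by rewrite distrC) ltac:(by rewrite distrC).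
  by split.
have cov2 : \forall i \near i0, G (i.1.1, y0, z0) /\ G (i.1.1, i.2.1, i.2.2).
  have cid : {for i0, continuous (id : W -> W)} by exact: cvg_id.
  have cx := continuous_at_fst (continuous_at_fst cid).
  have cy := continuous_at_fst (continuous_at_snd cid).
  have cz := continuous_at_snd (continuous_at_snd cid).
  have ccst (A : topologicalType) (a : A) :
    {for i0, continuous ((fun=> a) : W -> A)} by exact: cvg_cst.
  have ca0 := continuous_at_pair (continuous_at_pair cx (ccst _ y0)) (ccst _ z0).
  have ca1 := continuous_at_pair (continuous_at_pair cx cy) cz.
  apply: filterI.
    by apply: ca0; apply: open_nbhs_nbhs; split => //; exact: gf_open H.
  by apply: ca1; apply: open_nbhs_nbhs; split => //; exact: gf_open H.
have /nbhs_ballP[d /= d0 dP] : nbhs i0 [set i | `[0, 1]%classic `<=` P i /\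
    (G (i.1.1, y0, z0) /\ G (i.1.1, i.2.1, i.2.2))] by exact: filterI.
exists d => // y z yd zd x x' xd xd'.
have [|cP [c0 c1]] := dP ((x, x'), (y, z)).
  by split; split; rewrite -ball_normE /= distrC.
by split => // t tI; exact: cP.
Qed.

End Admissible.

(** * The maximum principle *)

Section SquaredDistance.
Context {R : realType} {n : nat}.
Implicit Types (u v x : 'rV[R]_n).

Lemma dot_linear u : linear (dot u).
Proof. by move=> t v v'; rewrite dotDr dotZr. Qed.
HB.instance Definition _ u := GRing.isLinear.Build R 'rV[R]_n R _ (dot u) (dot_linear u).

Lemma dot_continuous u : continuous (dot u).
Proof.
apply: bounded_linear_continuous; apply/linear_boundedP.
apply: filterS (nbhs_pinfty_ge (num_real (n%:R * `|u|))) => r Cr v.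
by rewrite (le_trans (normr_dot _ _))// mulrA ler_wpM2r.
Qed.

Definition sqdist u x : R := dot (x - u) (x - u).

Lemma is_diff_sqdist u x : is_diff x (sqdist u) (dot (2 *: (x - u))).
Proof.
apply: near_is_diff; first exact: dot_continuous.
move=> e e0.
have n0 : 0 < n%:R + 1 :> R by rewrite ltr_wpDl.
apply/nbhs_ballP; exists (e / (n%:R + 1)) => /=; first by rewrite divr_gt0.
move=> b; rewrite -ball_normE /= distrC ltr_pdivlMr// => be.
have -> : sqdist u b - sqdist u x - dot (2 *: (x - u)) (b - x) = dot (b - x) (b - x).
  have -> : sqdist u b = dot (b - x + (x - u)) (b - x + (x - u)).
    by rewrite /sqdist subrKA.
  rewrite /sqdist; move: (b - x) (x - u) => p q.
  by rewrite !dotDl !dotDr dotZl (dotC p q); ring.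
rewrite (le_trans (normr_dot _ _))// mulrA ler_wpM2r//.
by rewrite (le_trans _ (ltW be))// mulrDr mulr1 mulrC lerDl.
Qed.

Lemma sqdist_continuous u : continuous (sqdist u).
Proof. by move=> x; apply: differentiable_continuous; case: (is_diff_sqdist u x). Qed.

End SquaredDistance.

Section MaximumPrinciple.
Context {R : realType} {n : nat}.
Notation T := ('rV[R]_n * 'rV[R]_n * R)%type.
Variables (G : set T) (g : T -> R) (gx gy : T -> 'rV[R]_n) (gz : T -> R)
  (gxx gxy : T -> 'M[R]_n) (gxz : T -> 'rV[R]_n).
Hypothesis H : genfun G g gx gy gz gxx gxy gxz.
Notation E := (matE gy gz gxy gxz).
Notation Q := (vecQ gy gz).
Notation V := (vecV gy gz gxy gxz).
Notation phi := (phi g gx).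
Notation jet_path := (jet_path g gx).
Variable S : T -> T.
Hypothesis SK : forall w, G w -> S (phi w) = w.

(** A3w read on two sections that meet at [x], the situation at every point of {g_1 = g_0}. *)
Definition convexA := forall (xi : 'rV[R]_n) y0 y1 z0 z1 x,
  G (x, y0, z0) -> G (x, y1, z1) -> g (x, y0, z0) = g (x, y1, z1) ->
  (forall t, t \in `[0, 1] -> (phi @` G) (jet_path y0 y1 z0 z1 t x)) ->
  dot (gx (x, y1, z1) - gx (x, y0, z0)) xi = 0 ->
  forall t, t \in `[0, 1] ->
  quad (gxx (S (jet_path y0 y1 z0 z1 t x))) xi <=
  (1 - t) * quad (gxx (x, y0, z0)) xi + t * quad (gxx (x, y1, z1)) xi.

Section Fixed.
Variables (y0 y1 : 'rV[R]_n) (z0 z1 : R).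
Notation c := (jet_path y0 y1 z0 z1).
Notation k x' t x := (moved_value g S x' (c t x)).
Notation h x := (g (x, y1, z1) - g (x, y0, z0)).

Lemma jet_path0 x : c 0 x = phi (x, y0, z0).
Proof. by rewrite /jet_path /phi /segpt subr0 scale1r scale0r addr0. Qed.

Lemma jet_path1 x : g (x, y1, z1) = g (x, y0, z0) -> c 1 x = phi (x, y1, z1).
Proof. by move=> gE; rewrite /jet_path /phi /segpt subrr scale1r scale0r add0r gE. Qed.

Lemma moved_value0 x' x : G (x, y0, z0) -> k x' 0 x = g (x', y0, z0).
Proof. by move=> G0; rewrite /moved_value jet_path0 SK. Qed.

Lemma moved_value1 x' x : G (x, y1, z1) -> g (x, y1, z1) = g (x, y0, z0) ->
  k x' 1 x = g (x', y1, z1).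
Proof. by move=> G1 gE; rewrite /moved_value jet_path1// SK. Qed.

Lemma moved_value_self x t : (phi @` G) (c t x) -> k x t x = g (x, y0, z0).
Proof.
move=> [w Gw wc]; rewrite /moved_value -wc SK//.
have wx : w.1.1 = x by have := congr1 (fst \o fst) wc.
have gw : g w = g (x, y0, z0) by have := congr1 snd wc.
by rewrite -gw /replace_x -wx; case: w {Gw wc wx gw} => -[].
Qed.

Lemma jet_path_continuous t x : G (x, y0, z0) -> G (x, y1, z1) ->
  {for (x, t), continuous (fun a : 'rV[R]_n * R => c a.2 a.1)}.
Proof.
move=> G0 G1.
have cid : {for (x, t), continuous (id : 'rV[R]_n * R -> _)} by exact: cvg_id.
have cx := continuous_at_fst cid.
have ct := continuous_at_snd cid.
have ccst (A : topologicalType) (a : A) :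
  {for (x, t), continuous ((fun=> a) : 'rV[R]_n * R -> A)} by exact: cvg_cst.
have ca0 := continuous_at_pair (continuous_at_pair cx (ccst _ y0)) (ccst _ z0).
have ca1 := continuous_at_pair (continuous_at_pair cx (ccst _ y1)) (ccst _ z1).
have cg := continuous_at_comp ca0 (g_continuous H G0).
have cp0 := continuous_at_comp ca0 (gx_continuous H G0).
have cp1 := continuous_at_comp ca1 (gx_continuous H G1).
exact: (continuous_at_pair (continuous_at_pair cx (continuous_at_segpt cp0 cp1 ct)) cg).
Qed.

Lemma moved_value_continuous x' t x : G (x, y0, z0) -> G (x, y1, z1) ->
  (phi @` G) (c t x) -> G (replace_x x' (S (c t x))) ->
  {for (x, t), continuous (fun a : 'rV[R]_n * R => k x' a.2 a.1)}.
Proof.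
move=> G0 G1 Uc Gc; have [w Gw wc] := Uc.
have cm : {for c t x, continuous (moved_value g S x')}.
  rewrite -wc SK// in Gc *; apply: differentiable_continuous.
  by case: (is_diff_moved_value H SK Gw Gc).
exact: (continuous_at_comp (@jet_path_continuous t x G0 G1) cm).
Qed.

Lemma is_derive_moved_value_t x' t x : G (x, y0, z0) -> G (x, y1, z1) ->
  (phi @` G) (c t x) -> G (replace_x x' (S (c t x))) ->
  is_derive t (1 : R) (fun t => k x' t x)
   (gz (replace_x x' (S (c t x))) / gz (S (c t x)) *
    dot (V (S (c t x)) (replace_x x' (S (c t x))))
        (gx (x, y1, z1) - gx (x, y0, z0))).
Proof.
move=> G0 G1 [w Gw wc]; rewrite -wc SK// => Gw'.
have [dk kE] := is_diff_moved_value H SK Gw Gw'.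
rewrite wc in dk kE.
have := is_derive_comp_curve dk (is_derive_jet_path g gx y0 y1 z0 z1 t x).
rewrite kE (moved_diffE H)//= ?mul0mx ?subr0//.
by rewrite dot0l.
Qed.

Lemma is_diff_moved_value_x x' t x : G (x, y0, z0) -> G (x, y1, z1) ->
  (phi @` G) (c t x) -> G (replace_x x' (S (c t x))) ->
  is_diff x (fun x => k x' t x)
   (fun v => moved_diff gx gy gz gxx gxy gxz x' (S (c t x)) (v,
      (1 - t) *: (v *m (gxx (x, y0, z0))^T) + t *: (v *m (gxx (x, y1, z1))^T),
      dot v (gx (x, y0, z0)))).
Proof.
move=> G0 G1 [w Gw wc] Gw'.
have dp := is_diff_jet_path H t G0 G1.
have Gw2 : G (replace_x x' w) by rewrite -(SK Gw) wc.
have dk := is_diff_moved_value H SK Gw Gw2.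
rewrite -wc SK//.
rewrite wc in dk.
exact: (is_diff_comp dp dk).
Qed.

Lemma is_diff_section_sub x : G (x, y0, z0) -> G (x, y1, z1) ->
  is_diff x (fun x => h x)
    (fun v => dot v (gx (x, y1, z1) - gx (x, y0, z0))).
Proof.
move=> G0 G1.
have di (y : 'rV[R]_n) (z : R) : is_diff x (fun x => (x, y, z) : T) (fun v => (v, 0, 0) : T).
  exact: (is_diff_pair (is_diff_pair (is_diff_id x) (is_diff_cst y x)) (is_diff_cst z x)).
have d0 := is_diff_comp (di y0 z0) (is_diff_g H G0).
have d1 := is_diff_comp (di y1 z1) (is_diff_g H G1).
apply: is_diff_eq (is_diffB d1 d0) _.
apply/funext => v; rewrite -[LHS]/(_ - _) /= /grad_form /= !dot0l !mul0r !addr0.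
by rewrite dotBr.
Qed.

(** Orthogonality of [v] to the difference of gradients makes [v . p] the same for all gradients of
    the segment, so [moved_diffE] applies; it is also the hypothesis of [convexA]. What remains is
    the convexity defect times a quotient of two negative numbers. *)
Lemma moved_diff_tangent_ge0 x' t x : convexA -> t \in `[0, 1] ->
  G (x, y0, z0) -> G (x, y1, z1) -> g (x, y0, z0) = g (x, y1, z1) ->
  (forall t, t \in `[0, 1] -> (phi @` G) (c t x)) ->
  G (replace_x x' (S (c t x))) ->
  let v := V (S (c t x)) (replace_x x' (S (c t x))) in
  dot (gx (x, y1, z1) - gx (x, y0, z0)) v = 0 ->
  0 <= moved_diff gx gy gz gxx gxy gxz x' (S (c t x)) (v,
      (1 - t) *: (v *m (gxx (x, y0, z0))^T) + t *: (v *m (gxx (x, y1, z1))^T),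
      dot v (gx (x, y0, z0))).
Proof.
move=> cA tI G0 G1 gE U Gw' v etav.
have [GS phiS] := phi_S SK (U t tI).
have := cA v _ _ _ _ _ G0 G1 gE U etav t tI.
have gxS : gx (S (c t x)) = segpt (gx (x, y0, z0)) (gx (x, y1, z1)) t.
  by have := congr1 (snd \o fst) phiS.
rewrite (moved_diffE H)//=; last first.
  rewrite gxS /segpt dotDr !dotZr.
  move: etav; rewrite dotC dotBr => /eqP; rewrite subr_eq0 => /eqP ->; ring.
rewrite -/v /quad => cAv.
apply: mulr_ge0.
  by apply: mulr_le0; rewrite ?invr_le0; apply: ltW; exact: gf_z H _ _.
rewrite dotBr dotDr !dotZr !(dotC v); move: cAv; lra.
Qed.

End Fixed.

(** [x] may be any point of {g_1 = g_0} near [x0]; this freedom later gives supporting half-spaces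
    at all boundary points near [x0]. *)
Lemma maximum_principle (d : R) x0 y0 y1 z0 z1 x x' t :
  0 < d -> convexA -> admissible G g gx gy gz gxy gxz S d x0 y0 y1 z0 z1 ->
  `|x - x0| < d / (2 * n%:R + 4) -> `|x' - x0| < d / (2 * n%:R + 4) ->
  g (x, y1, z1) = g (x, y0, z0) -> g (x', y1, z1) <= g (x', y0, z0) ->
  t \in `[0, 1] ->
  moved_value g S x' (jet_path y0 y1 z0 z1 t x) <= g (x', y0, z0).
Proof.
move=> d0 cA adm xd xd' hx hx' tI.
have N4 : 0 < 2 * n%:R + 4 :> R by rewrite ltr_wpDl// mulr_ge0.
(* A point at Euclidean distance from [x'] at most that of [x] is within [(n + 1) * (2 * q)] of [x']
   in maximum norm, so within [(2 * n + 3) * q < d] of [x0]. *)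
pose q := d / (2 * n%:R + 4).
have q0 : 0 < q by rewrite divr_gt0.
have qd : (2 * n%:R + 4) * q = d by rewrite mulrC divfK// gt_eqF.
have nq0 : 0 <= n%:R * q by rewrite mulr_ge0// ltW.
have d4 : q < d by rewrite -qd; lra.
rewrite -/q in xd xd'; clearbody q.
pose rho := sqdist x' x.
(* The bound by [rho] keeps the set compact and admissible, and cannot obstruct a move that
   approaches [x']. *)
pose A := [set x1 | sqdist x' x1 <= rho /\ g (x1, y1, z1) = g (x1, y0, z0)].
have Ad x1 : sqdist x' x1 <= rho -> `|x1 - x0| < d.
  move=> x1rho.
  have h1 : `|x - x'| <= 2 * q.
    rewrite -(subrKA x0) (le_trans (ler_normD _ _))// [2 * q]mulr_natl.
    by rewrite [X in _ + X]distrC lerD// ltW.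
  have h2 : `|x1 - x'| ^+ 2 <= (n%:R + 1) ^+ 2 * (2 * q) ^+ 2.
    rewrite (le_trans (sqr_norm_le_dot _))// (le_trans x1rho)//.
    rewrite (le_trans (ler_norm _))// (le_trans (normr_dot _ _))//.
    rewrite ler_pM ?mulr_ge0//.
      rewrite (le_trans _ (_ : n%:R + 1 <= _)) ?lerDl// expr2 ler_peMr ?lerDr//.
    by rewrite expr2 ler_pM.
  have h3 : `|x1 - x'| <= (n%:R + 1) * (2 * q).
    by rewrite -(@ler_pXn2r _ 2)// ?nnegrE ?mulr_ge0 ?addr_ge0 ?(ltW q0)// exprMn.
  rewrite -(subrKA x') (le_lt_trans (ler_normD _ _))//.
  rewrite -qd; move: h3 xd' q0; lra.
have xd1 : `|x - x0| < d by exact: lt_trans xd d4.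
have xd1' : `|x' - x0| < d by exact: lt_trans xd' d4.
(* Equal sections make {g_1 = g_0} degenerate, without a normal direction; the path is then constant
   in [t]. *)
have [[-> ->]|yz] := pselect ((y1, z1) = (y0, z0)).
  have [G0 _ _] := adm _ _ xd1 xd1'.
  have -> : jet_path y0 y0 z0 z0 t x = jet_path y0 y0 z0 z0 0 x.
    by rewrite /jet_path /segpt -!scalerDl !subrK.
  by rewrite moved_value0.
have hC x1 : `|x1 - x0| < d ->
    {for x1, continuous (fun x => g (x, y1, z1) - g (x, y0, z0))}.
  move=> /adm/(_ xd1')[G0 G1 _]; apply: differentiable_continuous.
  by case: (is_diff_section_sub G0 G1).
have cptA : compact A.
  have BB : A `<=` [set x1 | `|x1 - x0| <= d] by move=> x1 [/Ad/ltW].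
  apply: (subclosed_compact _ (@compact_closed_ball_rV _ _ x0 d) BB).
  move=> x1 clA.
  have x1rho : sqdist x' x1 <= rho.
    have clB : closed (sqdist x' @^-1` [set r | r <= rho]).
      apply: closed_comp; last exact: closed_le.
      by move=> ? _; exact: sqdist_continuous.
    by apply: clB; apply: closureS clA => ? [].
  split=> //; apply/eqP; rewrite -subr_eq0; apply/negP => /negP hn0.
  have nn0 := hC _ (Ad _ x1rho) [set r | r != 0]
    ltac:(by apply: open_nbhs_nbhs; split => //; exact: open_neq).
  have [x2 [[_ hx2] /=]] := clA _ nn0.
  by rewrite hx2 subrr eqxx.
pose I01 : set R := `[0, 1]%classic.
have cptA1 : compact (A `*` I01).
  by apply: compact_setX => //; exact: segment_compact.
apply/ler_addgt0Pr => e e0.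
(* At the given point (x, t) the penalty is [eps * rho <= e]; the 1 covers [rho = 0]. *)
pose eps := e / (rho + 1).
have rho0 : 0 <= rho by exact: dot_ge0.
have eps0 : 0 < eps by rewrite divr_gt0// ltr_wpDl.
pose F (a : 'rV[R]_n * R) :=
  moved_value g S x' (jet_path y0 y1 z0 z1 a.2 a.1) - eps * sqdist x' a.1.
have cF : {within A `*` I01, continuous F}.
  apply: continuous_in_subspaceT => -[x1 t1] /set_mem /= [[x1rho hx1] t1I].
  have x1d := Ad _ x1rho.
  have [G0 G1 /(_ t1 t1I) [U1 Gr _]] := adm _ _ x1d xd1'.
  have ck := moved_value_continuous G0 G1 U1 Gr.
  have cs : {for (x1, t1), continuous (fun a : 'rV[R]_n * R => sqdist x' a.1)}.
    apply: (@continuous_at_comp _ _ _ fst); last exact: sqdist_continuous.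
    exact: cvg_fst.
  by apply: cvgB => //; apply: cvgM => //; exact: cvg_cst.
have [|[x1 t1] /set_mem /= [[x1rho hx1] t1I] Fmax] :=
  compact_EVT_max _ cptA1 cF.
  by exists (x, t); split.
have x1d := Ad _ x1rho.
have [G0 G1 adm1] := adm _ _ x1d xd1'.
suff : F (x1, t1) <= g (x', y0, z0).
  have : F (x, t) <= F (x1, t1) by apply: Fmax; rewrite inE.
  rewrite /F /=.
  have : eps * rho <= e.
    by rewrite /eps mulrAC ler_pdivrMr ?ltr_wpDl// mulrDr mulr1 lerDl ltW.
  rewrite -/rho; lra.
have sq0 : 0 <= eps * sqdist x' x1 by rewrite mulr_ge0 ?(ltW eps0)// dot_ge0.
(* For [t1 = 0], [t1 = 1] and [x1 = x'] the moved value is g_0(x'), g_1(x') and g_0(x')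
   respectively, and the penalty only helps. *)
have [t10|t1n0] := eqVneq t1 0.
  rewrite /F /= t10 moved_value0//.
  by rewrite lerBlDr lerDl.
have [t11|t1n1] := eqVneq t1 1.
  rewrite /F /= t11 moved_value1//.
  by rewrite lerBlDr (le_trans hx')// lerDl.
have [xx1|x1n] := eqVneq x1 x'.
  have [U1 _ _] := adm1 t1 t1I.
  by rewrite /F /= -xx1 in sq0 *; rewrite moved_value_self// lerBlDr lerDl.
exfalso.
have t1I' : t1 \in `]0, 1[.
  by move: t1I; rewrite /I01 /= !in_itv /= !le_eqVlt eq_sym (negbTE t1n0) (negbTE t1n1).
have [U1 Gr Vpos] := adm1 t1 t1I.
have {Vpos} := Vpos x1n.
set w := S _ in Gr *; set w' := replace_x x' w in Gr *.
set v := V w w'; set eta := gx (x1, y1, z1) - gx (x1, y0, z0).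
move=> Vpos.
have U s : s \in `[0, 1] -> (phi @` G) (jet_path y0 y1 z0 z1 s x1).
  by move=> sI; case: (adm1 s sI).
have [Gw _] := phi_S SK U1; rewrite -/w in Gw.
have veta : dot v eta = 0.
  have dk s : s \in `[0, 1] -> G (replace_x x' (S (jet_path y0 y1 z0 z1 s x1))).
    by move=> sI; case: (adm1 s sI).
  have der s (sI : s \in `[0, 1]) :=
    is_derive_moved_value_t G0 G1 (U s sI) (dk s sI).
  have [] := @derive1_at_max _
    (fun s => moved_value g S x' (jet_path y0 y1 z0 z1 s x1)) 0 1 t1 ler01 _ t1I' _.
  - by move=> s sI; case: (der s (subset_itv_oo_cc sI)).
  - move=> s sI; have : F (x1, s) <= F (x1, t1).
      by apply: Fmax; rewrite inE; split => //=; exact: subset_itv_oo_cc sI.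
    by rewrite /F /= lerD2r.
  move=> _; have [_ ->] := der t1 t1I.
  rewrite -/w -/w' -/v -/eta => /eqP; rewrite mulf_eq0 => /orP[|/eqP//].
  by rewrite mulf_eq0 invr_eq0 !(negbTE (gz_neq0 H _)).
(* By A1 distinct sections with the same value at [x1] have distinct gradients, so {g_1 = g_0} is a
   hypersurface there with normal [eta]. *)
have eta0 : 0 < dot eta eta.
  apply: dot_gt0; apply/eqP => e0'; apply: yz.
  have /(gf_inj H G1 G0) [-> ->] // : phi (x1, y1, z1) = phi (x1, y0, z0).
  by rewrite /phi hx1; move/eqP: e0'; rewrite subr_eq0 => /eqP ->.
have Fx := is_diffB (is_diff_moved_value_x G0 G1 U1 Gr)
  (is_diffZ eps (is_diff_sqdist x' x1)).
have Ps := is_diffN (is_diff_sqdist x' x1).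
have Psv : dot (2 *: (x1 - x')) v < 0.
  by rewrite dotZl -opprB dotNl mulrN oppr_lt0 mulr_gt0.
have [dF dFE] := Fx; have [dP dPE] := Ps.
have tan := moved_diff_tangent_ge0 cA t1I G0 G1 (esym hx1) U Gr.
rewrite /= -/w -/w' -/v -/eta dotC in tan.
pose F1 := (fun x => moved_value g S x' (jet_path y0 y1 z0 z1 t1 x)) - eps *: sqdist x'.
(* A3w makes the derivative of the moved value nonnegative; the penalty adds a positive amount
   because [v] points towards [x']. *)
have dFv : 0 < 'd F1 x1 v.
  rewrite dFE.
  change (0 < moved_diff gx gy gz gxx gxy gxz x' w (v, (1 - t1) *: (v *m (gxx (x1, y0, z0))^T) +
       t1 *: (v *m (gxx (x1, y1, z1))^T), dot v (gx (x1, y0, z0))) - eps * dot (2 *: (x1 - x')) v).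
  rewrite subr_gt0; apply: lt_le_trans (tan veta).
  by rewrite pmulr_rlt0.
have dPv : 0 < 'd (- sqdist x') x1 v.
  by rewrite dPE; change (0 < - dot (2 *: (x1 - x')) v); rewrite oppr_gt0.
have [e1 e10 n1] := diff_direction_gt0 dF dFv.
have [e2 e20 n2] := diff_direction_gt0 dP dPv.
have nrm0 : 0 < `|eta| + 1 by rewrite ltr_wpDl.
(* Returning to {g_1 = g_0} costs a correction [r *: eta]; this bound on [r] keeps the direction
   within both tolerances [e1] and [e2]. *)
have e3 : 0 < Num.min e1 e2 / (`|eta| + 1) by rewrite divr_gt0// lt_min e10.
have [dh dhE] := is_diff_section_sub G0 G1.
have hn : {near x1, continuous (fun x => g (x, y1, z1) - g (x, y0, z0))}.
  apply/nbhs_ballP; exists (d - `|x1 - x0|) => /=; first by rewrite subr_gt0.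
  move=> x2; rewrite -ball_normE /= => x12; apply: hC.
  by rewrite -(subrKA x1) (le_lt_trans (ler_normD _ _))// distrC -ltrBrDr.
have h10 : g (x1, y1, z1) - g (x1, y0, z0) = 0 by rewrite hx1 subrr.
have hv : 'd (fun x => g (x, y1, z1) - g (x, y0, z0)) x1 v = 0 by rewrite dhE.
have heta : 0 < 'd (fun x => g (x, y1, z1) - g (x, y0, z0)) x1 eta by rewrite dhE.
have n3 := constrained_direction hn dh h10 hv heta e3.
have [s [F1s [Ps' [r re hr]]]] := filter_ex (filterI n1 (filterI n2 n3)).
have rv : `|v + r *: eta - v| <= Num.min e1 e2.
  rewrite addrC addKr normrZ (le_trans (ler_wpM2r _ re))//.
  rewrite mulrAC ler_pdivrMr// ler_wpM2l ?lerDl//.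
  by rewrite le_min !ltW.
move: rv; rewrite le_min => /andP[/F1s {}F1s /Ps' {}Ps'].
(* The new point lies on {g_1 = g_0} and is closer to [x'], so it competes for the maximum, yet [F]
   is larger there. *)
have : F (x1 + s *: (v + r *: eta), t1) <= F (x1, t1).
  apply: Fmax; rewrite inE; split => //=; split; last by apply/eqP; rewrite -subr_eq0 hr.
  apply: le_trans x1rho; rewrite ltW// -ltrN2; exact: Ps'.
by rewrite leNgt => /negP; apply; exact: F1s.
Qed.

End MaximumPrinciple.

Lemma near_at_right {R : realType} (a : R) (P : set R) :
  nbhs a P -> \forall r \near a^'+, P r.
Proof. by move=> nP; rewrite /at_right near_withinE; apply: filterS nP. Qed.

Lemma segpt_dist {R : realType} {n : nat} (p q a : 'rV[R]_n) (r t : R) :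
  `|p - a| < r -> `|q - a| < r -> t \in `[0, 1] -> `|segpt p q t - a| < r.
Proof.
rewrite in_itv /= => pr qr /andP[t0 t1].
have -> : segpt p q t - a = (1 - t) *: (p - a) + t *: (q - a).
  by apply/rowP => i; rewrite !mxE; ring.
rewrite (le_lt_trans (ler_normD _ _))// !normrZ (ger0_norm t0) ger0_norm ?subr_ge0//.
have [->|t0'] := eqVneq t 0; first by rewrite subr0 mul1r mul0r addr0.
rewrite (_ : r = (1 - t) * r + t * r); last by ring.
apply: ler_ltD; first by rewrite ler_wpM2l ?subr_ge0// ltW.
by rewrite ltr_pM2l// lt_neqAle eq_sym t0'.
Qed.

(** * Convexity of sublevel sets *)

Section Sublevel.
Context {R : realType} {n : nat}.
Notation T := ('rV[R]_n * 'rV[R]_n * R)%type.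
Variables (G : set T) (g : T -> R) (gx gy : T -> 'rV[R]_n) (gz : T -> R)
  (gxx gxy : T -> 'M[R]_n) (gxz : T -> 'rV[R]_n).
Hypothesis H : genfun G g gx gy gz gxx gxy gxz.
Notation E := (matE gy gz gxy gxz).
Notation Q := (vecQ gy gz).
Notation V := (vecV gy gz gxy gxz).
Notation phi := (phi g gx).
Notation jet_path := (jet_path g gx).
Variable S : T -> T.
Hypothesis SK : forall w, G w -> S (phi w) = w.
Notation admissible := (admissible G g gx gy gz gxy gxz S).

(** Up to the positive factor - g_z, the gradient of g_1 - g_0 in the coordinates Q. *)
Definition conormal (y0 y1 : 'rV[R]_n) (z0 z1 : R) x : 'rV[R]_n :=
  (gx (x, y1, z1) - gx (x, y0, z0)) *m (invmx (E (x, y0, z0)))^T.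

(* First-order consequence of the maximum principle as [t] tends to [0]. *)
Lemma supporting_halfspace (d : R) x0 y0 y1 z0 z1 x x' :
  0 < d -> convexA G g gx gxx S -> admissible d x0 y0 y1 z0 z1 ->
  `|x - x0| < d / (2 * n%:R + 4) -> `|x' - x0| < d / (2 * n%:R + 4) ->
  g (x, y1, z1) = g (x, y0, z0) -> g (x', y1, z1) <= g (x', y0, z0) ->
  dot (Q (x', y0, z0) - Q (x, y0, z0)) (conormal y0 y1 z0 z1 x) <= 0.
Proof.
move=> d0 cA adm xd xd' hx hx'.
have d4 : d / (2 * n%:R + 4) <= d.
  rewrite ler_pdivrMr ?ltr_wpDl ?mulr_ge0//.
  by rewrite ler_peMr ?(ltW d0)// ler_wpDl ?mulr_ge0// ler1n.
have [G0 G1 adm1] := adm x x' (lt_le_trans xd d4) (lt_le_trans xd' d4).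
have z0I : 0 \in `[(0 : R), 1] by rewrite in_itv /= lexx ler01.
have [U0 Gr _] := adm1 0 z0I.
have der := is_derive_moved_value_t H SK G0 G1 U0 Gr.
rewrite jet_path0 SK// /replace_x /= in Gr der.
have Gx' : G (x', y0, z0) by [].
have [/derivable1_diffP df dE] := der.
(* At [t = 0] the maximum principle is an equality, so a positive derivative there would violate it
   for small [t]. *)
have : ~~ (0 < 'D_1 (fun t => moved_value g S x' (jet_path y0 y1 z0 z1 t x)) (0 : R)).
  apply/negP; rewrite deriveE// => /(diff_direction_gt0 df)[e e0 ne].
  have [s [ns [s0 s1]]] := filter_ex (filterI ne (filterI (nbhs_right_gt 0) (nbhs_right_lt ltr01))).
  have := ns 1; rewrite subrr normr0 => /(_ (ltW e0)).
  rewrite add0r [s *: _]mulr1 (@moved_value0 _ _ _ _ _ _ SK y0 y1 z0 z1 x' x G0).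
  rewrite ltNge => /negP; apply.
  apply: (maximum_principle H SK d0 cA adm) => //.
  by rewrite in_itv /= ltW// ltW.
rewrite dE -leNgt.
have gz0 := gf_z H G0.
have gz1 := gf_z H Gx'.
rewrite pmulr_rle0; last by rewrite nmulr_lgt0// invr_lt0.
rewrite /vecV dotZl pmulr_rle0 ?oppr_gt0//.
by rewrite dot_mulmx.
Qed.

Lemma section_chart (r : R) x0 y0 z0 : 0 < r -> G (x0, y0, z0) ->
  exists2 rho : R, 0 < rho & forall q, `|q - Q (x0, y0, z0)| < rho ->
    exists x, [/\ G (x, y0, z0), Q (x, y0, z0) = q & `|x - x0| < r].
Proof.
move=> r0 G0.
have nN : nbhs x0 ([set x | G (x, y0, z0)] `&` [set x | `|x - x0| < r]).
  apply: filterI; first exact: near_section H _ _ _ G0.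
  by apply/nbhs_ballP; exists r => // x; rewrite -ball_normE /= distrC.
have /nbhs_ballP[rho /= rho0 rhoP] := Qx_open H G0 nN.
exists rho => // q qQ; have [|x [Gx xr] xq] := rhoP q.
  by rewrite -ball_normE /= distrC.
by exists x.
Qed.

(** A segment leaving {g_1 < g_0} meets {g_1 = g_0} at an interior point; the supporting half-space
    there contains both ends of the segment, and a perturbation of one end escapes from it. *)
Lemma sublevel_convex (d rho : R) x0 y0 y1 z0 z1 (q0 : 'rV[R]_n)
    (X : 'rV[R]_n -> 'rV[R]_n) :
  (forall x, G (x, y0, z0) -> X (Q (x, y0, z0)) = x) ->
  (forall q, `|q - q0| < rho ->
    exists x, [/\ G (x, y0, z0), Q (x, y0, z0) = q & `|x - x0| < d / (2 * n%:R + 4)]) ->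
  0 < d -> convexA G g gx gxx S -> admissible d x0 y0 y1 z0 z1 ->
  let h x := g (x, y1, z1) - g (x, y0, z0) in
  forall q q' t, `|q - q0| < rho -> `|q' - q0| < rho ->
  h (X q) < 0 -> h (X q') < 0 -> t \in `[0, 1] -> h (X (segpt q q' t)) < 0.
Proof.
move=> XK ch d0 cA adm h q q' t qr qr' hq hq' tI.
have d4 : d / (2 * n%:R + 4) <= d.
  rewrite ler_pdivrMr ?ltr_wpDl ?mulr_ge0//.
  by rewrite ler_peMr ?(ltW d0)// ler_wpDl ?mulr_ge0// ler1n.
have chX p : `|p - q0| < rho ->
    [/\ G (X p, y0, z0), Q (X p, y0, z0) = p & `|X p - x0| < d / (2 * n%:R + 4)].
  by move=> /ch[x [Gx <- xd]]; rewrite XK.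
have GX p : `|p - q0| < rho -> G (X p, y0, z0) /\ G (X p, y1, z1).
  by move=> /chX[_ _ /lt_le_trans/(_ d4) Xd]; case: (adm _ _ Xd Xd).
have hXC p : `|p - q0| < rho -> {for p, continuous (h \o X)}.
  move=> pr; have [G0 G1] := GX p pr; have [_ Qp _] := chX p pr.
  apply: differentiable_continuous; apply: differentiable_comp.
    by rewrite -Qp; case: (is_diff_X H XK G0).
  by case: (is_diff_section_sub H G0 G1).
have segr s : s \in `[0, 1] -> `|segpt q q' s - q0| < rho.
  exact: segpt_dist.
rewrite ltNge; apply/negP => ht.
have hC s : s \in `[0, 1] -> {for s, continuous (h \o X \o segpt q q')}.
  move=> sI; apply: continuous_comp; last by apply: hXC; exact: segr.
  apply: continuous_at_segpt; [exact: cvg_cst|exact: cvg_cst|exact: cvg_id].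
have t0 : 0 <= t by move: tI; rewrite in_itv => /andP[].
have t1 : t <= 1 by move: tI; rewrite in_itv => /andP[].
have [s sI hs] : exists2 s, s \in `[0, t] & (h \o X \o segpt q q') s = 0.
  apply: IVT => //.
    apply: continuous_in_subspaceT => s /set_mem /= sI; apply: hC.
    by apply: subset_itvl sI.
  rewrite /= {1 3}/segpt subr0 scale1r scale0r addr0.
  by rewrite ge_min le_max (ltW hq) ht orbT.
have {sI} [s0 s1 sI] : [/\ 0 < s, s < 1 & s \in `[0, 1]].
  move: sI; rewrite !in_itv /= => /andP[s0 st]; have s1 := le_trans st t1.
  split; last by rewrite s0.
    rewrite lt_neqAle s0 andbT; apply/eqP => s00; move: hs; rewrite -s00 /=.
    by rewrite /segpt subr0 scale1r scale0r addr0 => h0; rewrite h0 ltxx in hq.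
  rewrite lt_neqAle s1 andbT; apply/eqP => s11; move: hs; rewrite s11 /=.
  by rewrite /segpt subrr scale1r scale0r add0r => h1; rewrite h1 ltxx in hq'.
set p := segpt q q' s.
have pr : `|p - q0| < rho by exact: segr.
have [G0 G1] := GX p pr.
have hp : g (X p, y1, z1) = g (X p, y0, z0) by apply/eqP; rewrite -subr_eq0; apply/eqP.
set om := conormal y0 y1 z0 z1 (X p).
have om0 : om != 0.
  apply/eqP => om00; move: hq; rewrite /h.
  have : om *m (E (X p, y0, z0))^T = 0 by rewrite om00 mul0mx.
  rewrite /om /conormal -mulmxA -trmx_mul mulmxV ?(gf_unit H)// trmx1 mulmx1.
  move=> /eqP; rewrite subr_eq0 => /eqP gxE.
  have /(gf_inj H G1 G0) [-> ->] : phi (X p, y1, z1) = phi (X p, y0, z0).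
    by rewrite /phi gxE hp.
  by rewrite subrr ltxx.
have supp a : `|a - q0| < rho -> h (X a) < 0 -> dot (a - p) om <= 0.
  move=> ar ha; have [_ Qa aX] := chX a ar; have [_ Qp pX] := chX p pr.
  rewrite -{1}Qa -{1}Qp; apply: (supporting_halfspace d0 cA adm) => //.
  by rewrite -subr_le0; exact: ltW.
(* [q - p] and [q' - p] are opposite multiples of [q' - q], and both pair nonpositively with [om]:
   the segment lies in the supporting hyperplane. *)
have sq : dot (q' - q) om = 0.
  have := supp _ qr hq; have := supp _ qr' hq'.
  have -> : q - p = - s *: (q' - q).
    by rewrite /p /segpt; apply/rowP => i; rewrite !mxE; ring.
  have -> : q' - p = (1 - s) *: (q' - q).
    by rewrite /p /segpt; apply/rowP => i; rewrite !mxE; ring.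
  rewrite !dotZl mulNr oppr_le0 pmulr_rle0 ?subr_gt0// pmulr_rge0// => a0 a1.
  by apply/le_anti; rewrite a0 a1.
(* The strict sublevel set is open, so [q] can be pushed along [om], across the hyperplane, without
   leaving it. *)
have : \forall r \near (0 : R)^'+, `|q + r *: om - q0| < rho /\ h (X (q + r *: om)) < 0.
  apply: near_at_right.
  have nq : nbhs (q + 0 *: om) [set a | `|a - q0| < rho /\ h (X a) < 0]; last first.
    exact: continuous_line nq.
  rewrite scale0r addr0; apply: filterI.
    apply/nbhs_ballP; exists (rho - `|q - q0|) => /=.
      by rewrite subr_gt0.
    move=> a; rewrite -ball_normE /= => qa.
    by rewrite -(subrKA q) (le_lt_trans (ler_normD _ _))// distrC -ltrBrDr.
  by apply: (hXC q qr [set b | b < 0]); apply: open_nbhs_nbhs; split => //; exact: open_lt.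
move=> /(filterI (nbhs_right_gt 0)) /filter_ex[r [r0 [rr hr]]].
have := supp _ rr hr.
have -> : q + r *: om - p = r *: om - s *: (q' - q).
  by rewrite /p /segpt; apply/rowP => i; rewrite !mxE; ring.
rewrite dotBl !dotZl sq mulr0 subr0 leNgt => /negP; apply.
by rewrite mulr_gt0// dot_gt0.
Qed.

End Sublevel.

(** * Midpoint convexity *)

Section Midpoint.
Context {R : realType} {n : nat}.
Notation T := ('rV[R]_n * 'rV[R]_n * R)%type.
Variables (G : set T) (g : T -> R) (gx gy : T -> 'rV[R]_n) (gz : T -> R)
  (gxx gxy : T -> 'M[R]_n) (gxz : T -> 'rV[R]_n).
Hypothesis H : genfun G g gx gy gz gxx gxy gxz.
Notation phi := (phi g gx).

Lemma is_derive_dot_const (u : 'rV[R]_n) (p : R -> 'rV[R]_n) s dp :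
  is_derive s (1 : R) p dp -> is_derive s (1 : R) (fun s => dot u (p s)) (dot u dp).
Proof.
move=> hp; have du : is_diff (p s) (dot u) (dot u).
  apply: strict_diff_is_diff; first exact: dot_continuous.
  exact: strict_diff_linear.
have [d dE] := du.
by have := is_derive_comp_curve d hp; rewrite dE.
Qed.

Section Curve.
Variables (x0 xi et : 'rV[R]_n) (b : R).

Definition parabola (s : R) : 'rV[R]_n := x0 + s *: xi + (s ^+ 2 * b) *: et.

Lemma is_derive_parabola s :
  is_derive s (1 : R) parabola (xi + (2 * s * b) *: et).
Proof.
have d1 := is_derive_line x0 xi s.
have d2 : is_derive s (1 : R) (fun t : R => (t ^+ 2 * b) *: et) ((2 * s * b) *: et).
  have dk : is_derive s (1 : R) (fun t : R => t ^+ 2 * b) (2 * s * b).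
    have -> : (fun t : R => t ^+ 2 * b) = (id * id) * cst b.
      by apply/funext => t; rewrite expr2.
    have d2 := is_deriveM (is_derive_id s (1 : R)) (is_derive_id s (1 : R)).
    apply: is_derive_eq (is_deriveM d2 (is_derive_cst b s (1 : R))) _.
    rewrite scaler0 add0r -[LHS]/(b * (s * 1 + s * 1)); ring.
  have [/derivable1_diffP dd dE] := dk.
  have dz := @differentiableZl _ _ _ _ et _ dd.
  apply: DeriveDef; first exact/derivable1_diffP.
  by rewrite deriveE// (diffZl _ dd) -deriveE// dE.
exact: is_deriveD d1 d2.
Qed.

Lemma parabola0 : parabola 0 = x0.
Proof. by rewrite /parabola expr0n /= mul0r !scale0r !addr0. Qed.

Lemma is_derive_curve_g y z s : G (parabola s, y, z) ->
  is_derive s (1 : R) (fun s => g (parabola s, y, z))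
    (dot (xi + (2 * s * b) *: et) (gx (parabola s, y, z))).
Proof.
move=> Gs.
have di : is_diff (parabola s) (fun x => (x, y, z) : T) (fun v => (v, 0, 0) : T).
  exact: (is_diff_pair (is_diff_pair (is_diff_id _) (is_diff_cst y _)) (is_diff_cst z _)).
have [dg dgE] := is_diff_comp di (is_diff_g H Gs).
have := is_derive_comp_curve dg (is_derive_parabola s); rewrite dgE /=.
by rewrite /grad_form /= dot0l mul0r !addr0.
Qed.

Lemma is_derive_curve_gx y z s : G (parabola s, y, z) ->
  is_derive s (1 : R) (fun s => gx (parabola s, y, z))
    ((xi + (2 * s * b) *: et) *m (gxx (parabola s, y, z))^T).
Proof.
move=> Gs.
have di : is_diff (parabola s) (fun x => (x, y, z) : T) (fun v => (v, 0, 0) : T).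
  exact: (is_diff_pair (is_diff_pair (is_diff_id _) (is_diff_cst y _)) (is_diff_cst z _)).
have [dg dgE] := is_diff_comp di (is_diff_gx H Gs).
have := is_derive_comp_curve dg (is_derive_parabola s); rewrite dgE /=.
by rewrite /jet_p /= mul0mx scale0r !addr0.
Qed.

(* Along the parabola the difference of the two sections vanishes to first
   order, and the last hypothesis is on its second derivative. *)
Lemma curve_lt y0 z0 y1 z1 : G (x0, y0, z0) -> G (x0, y1, z1) ->
  g (x0, y1, z1) = g (x0, y0, z0) ->
  dot xi (gx (x0, y1, z1) - gx (x0, y0, z0)) = 0 ->
  quad (gxx (x0, y1, z1)) xi - quad (gxx (x0, y0, z0)) xi +
    2 * b * dot et (gx (x0, y1, z1) - gx (x0, y0, z0)) < 0 ->
  \forall s \near (0 : R)^'+, g (parabola s, y1, z1) < g (parabola s, y0, z0).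
Proof.
move=> G0 G1 gE g1 g2.
pose f s := g (parabola s, y1, z1) - g (parabola s, y0, z0).
pose p s := gx (parabola s, y1, z1) - gx (parabola s, y0, z0).
pose df s := dot (xi + (2 * s * b) *: et) (p s).
have nG : \forall s \near (0 : R), G (parabola s, y1, z1) /\ G (parabola s, y0, z0).
  have cp : {for 0, continuous parabola}.
    apply: differentiable_continuous; apply/derivable1_diffP.
    by case: (is_derive_parabola 0).
  have nx : nbhs (parabola 0) [set x | G (x, y1, z1) /\ G (x, y0, z0)].
    rewrite parabola0; apply: filterI; first exact: near_section H _ _ _ G1.
    exact: near_section H _ _ _ G0.
  exact: cp nx.
have nf : \forall s \near (0 : R), is_derive s (1 : R) f (df s).
  apply: filterS nG => s [Gs1 Gs0].
  rewrite /df /p dotBr.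
  exact: is_deriveB (is_derive_curve_g Gs1) (is_derive_curve_g Gs0).
have df0 : df 0 = 0.
  by rewrite /df /p parabola0 mulr0 mul0r scale0r addr0.
have ddf : is_derive (0 : R) (1 : R) df
   (dot xi (xi *m (gxx (x0, y1, z1))^T - xi *m (gxx (x0, y0, z0))^T) +
    2 * b * dot et (p 0)).
  have [Gp1 Gp0] := nbhs_singleton nG.
  have dp := is_deriveB (is_derive_curve_gx Gp1) (is_derive_curve_gx Gp0).
  have -> : df = (fun s => dot xi (p s)) + (2 * b *: id) * (fun s => dot et (p s)).
    apply/funext => s; rewrite /df dotDl dotZl -[RHS]/(dot xi (p s) + (2 * b * s) * dot et (p s)).
    by ring.
  have de := is_deriveM (is_deriveZ (2 * b) (is_derive_id (0 : R) (1 : R)))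
    (is_derive_dot_const et dp).
  apply: is_derive_eq (is_deriveD (is_derive_dot_const xi dp) de) _.
  rewrite mulr0 mul0r scale0r addr0 parabola0; congr (_ + _).
  rewrite -[LHS]/(2 * b * 0 * _ + dot et (p 0) * (2 * b * 1)); ring.
have := second_derivative_lt0 nf df0 ddf.
have -> : dot xi (xi *m (gxx (x0, y1, z1))^T - xi *m (gxx (x0, y0, z0))^T) +
    2 * b * dot et (p 0) = quad (gxx (x0, y1, z1)) xi - quad (gxx (x0, y0, z0)) xi +
    2 * b * dot et (gx (x0, y1, z1) - gx (x0, y0, z0)).
  by rewrite /p parabola0 dotC dotBl.
move=> /(_ g2); apply: filterS => s.
by rewrite /f parabola0 gE subrr subr_lt0.
Qed.

End Curve.

Lemma midpoint_quad (x0 xi et ym yp yl : 'rV[R]_n) (zm zp zl : R) :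
  G (x0, ym, zm) -> G (x0, yp, zp) -> G (x0, yl, zl) ->
  g (x0, yp, zp) = g (x0, ym, zm) -> g (x0, yl, zl) = g (x0, ym, zm) ->
  gx (x0, yp, zp) = gx (x0, ym, zm) + et -> gx (x0, yl, zl) = gx (x0, ym, zm) - et ->
  dot et xi = 0 ->
  (\forall x \near x0, ~ (g (x, yp, zp) < g (x, ym, zm) /\ g (x, yl, zl) < g (x, ym, zm))) ->
  quad (gxx (x0, ym, zm)) xi <=
  (quad (gxx (x0, yl, zl)) xi + quad (gxx (x0, yp, zp)) xi) / 2.
Proof.
move=> Gm Gp Gl gp gl xp xl etxi nr.
set q := quad (gxx (x0, ym, zm)) xi; set qp := quad (gxx (x0, yp, zp)) xi.
set ql := quad (gxx (x0, yl, zl)) xi.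
have [et0|et0] := eqVneq et 0.
  have := gf_inj H Gp Gm; rewrite /= gp xp et0 addr0 => /(_ erefl) [yE zE].
  have := gf_inj H Gl Gm; rewrite /= gl xl et0 subr0 => /(_ erefl) [yE' zE'].
  by rewrite /qp /ql yE zE yE' zE' -/q; lra.
rewrite leNgt; apply/negP => qlt.
have ee := dot_gt0 et0.
(* With this [b] both second derivatives equal [(ql + qp) / 2 - q]. *)
pose b := (ql - qp) / (4 * dot et et).
have dp : gx (x0, yp, zp) - gx (x0, ym, zm) = et by rewrite xp addrC addKr.
have dl : gx (x0, yl, zl) - gx (x0, ym, zm) = - et by rewrite xl addrC addKr.
have b2 : 2 * b * dot et et = (ql - qp) / 2 by rewrite /b; field; rewrite gt_eqF.
have np := @curve_lt x0 xi et b _ _ _ _ Gm Gp gp.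
have nl := @curve_lt x0 xi et b _ _ _ _ Gm Gl gl.
rewrite dp dotC b2 in np; rewrite dl dotNr dotNr dotC mulrN b2 in nl.
have {}np := np etxi ltac:(rewrite -/qp -/q; move: qlt; lra).
have {}nl := nl ltac:(by rewrite etxi oppr0) ltac:(rewrite -/ql -/q; move: qlt; lra).
have cp : {for 0, continuous (parabola x0 xi et b)}.
  apply: differentiable_continuous; apply/derivable1_diffP.
  by case: (is_derive_parabola x0 xi et b 0).
have nr' : \forall s \near (0 : R),
  ~ (g (parabola x0 xi et b s, yp, zp) < g (parabola x0 xi et b s, ym, zm) /\
   g (parabola x0 xi et b s, yl, zl) < g (parabola x0 xi et b s, ym, zm)).
  have nr0 : nbhs (parabola x0 xi et b 0) [set x |
    ~ (g (x, yp, zp) < g (x, ym, zm) /\ g (x, yl, zl) < g (x, ym, zm))].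
    by rewrite parabola0.
  exact: cp nr0.
have n3 := near_at_right nr'.
have n4 : \forall s \near (0 : R)^'+, False.
  by apply: filterS2 (filterI np nl) n3 => s; exact: (fun a b => b a).
by have [] := filter_ex n4.
Qed.

Variable S : T -> T.
Hypothesis SK : forall w, G w -> S (phi w) = w.

(** Comparison with the end points only; this is full convexity, since subsegments satisfy the same
    hypotheses. *)
Definition convexU := forall (xi : 'rV[R]_n) x u p0 p1,
  (forall t, t \in `[0, 1] -> (phi @` G) (x, segpt p0 p1 t, u)) ->
  dot (p1 - p0) xi = 0 ->
  forall t, t \in `[0, 1] ->
  quad (gxx (S (x, segpt p0 p1 t, u))) xi <=
  (1 - t) * quad (gxx (S (x, p0, u))) xi + t * quad (gxx (S (x, p1, u))) xi.

(** The range of [d] may depend on [w], [xi] and [et]: a local property, which [midpoint_convex]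
    makes global along a segment. *)
Definition midpointU := forall (xi : 'rV[R]_n) w et, G w -> dot et xi = 0 ->
  \forall d \near (0 : R)^'+,
  quad (gxx w) xi <=
  (quad (gxx (S (w.1.1, gx w - d *: et, g w))) xi +
   quad (gxx (S (w.1.1, gx w + d *: et, g w))) xi) / 2.

Lemma convexU_convexA : convexU -> convexA G g gx gxx S.
Proof.
move=> cU xi y0 y1 z0 z1 x G0 G1 gE U et t tI.
have := cU xi x (g (x, y0, z0)) (gx (x, y0, z0)) (gx (x, y1, z1)) U et t tI.
by rewrite -[(x, gx (x, y0, z0), _)]/(phi (x, y0, z0)) SK// {2}gE
  -[(x, gx (x, y1, z1), _)]/(phi (x, y1, z1)) SK.
Qed.

Lemma quad_gxx_continuous xi w : G w ->
  {for w, continuous (fun w => quad (gxx w) xi)}.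
Proof.
move=> Gw; apply/cvgrPdist_lt => e e0.
pose K : R := n%:R * (n%:R * (`|xi| * `|xi|)) + 1.
have K0 : 0 < K by rewrite ltr_wpDl// !mulr_ge0.
have eK : 0 < e / K by rewrite divr_gt0.
have /cvgrPdist_lt/(_ _ eK) := gf_cxx H Gw; apply: filterS => w'.
rewrite ltr_pdivlMr// => wK; apply: le_lt_trans wK.
have -> : quad (gxx w) xi - quad (gxx w') xi = dot xi (xi *m (gxx w - gxx w')).
  by rewrite /quad !dot_mulmx !trmxK mulmxBr dotBr.
rewrite (le_trans (normr_dot _ _))//.
rewrite (le_trans (ler_wpM2l _ (ler_wpM2l _ (normr_mulmx _ _))))//.
rewrite (_ : _ * (_ * (_ * _ * _)) = `|gxx w - gxx w'| * (K - 1)).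
  by rewrite ler_wpM2l// gerBl.
by rewrite /K; ring.
Qed.

Lemma midpointU_convexU : midpointU -> convexU.
Proof.
move=> mU xi x u p0 p1 U et t tI.
pose f s := quad (gxx (S (x, segpt p0 p1 s, u))) xi.
have f0 : f 0 = quad (gxx (S (x, p0, u))) xi by rewrite /f /segpt subr0 scale1r scale0r addr0.
have f1 : f 1 = quad (gxx (S (x, p1, u))) xi by rewrite /f /segpt subrr scale1r scale0r add0r.
rewrite -f0 -f1; apply: (@midpoint_convex _ f) => // [|s sI].
  apply: continuous_in_subspaceT => s /set_mem /= sI.
  have [GS phiS] := phi_S SK (U s sI).
  have cs : {for s, continuous (fun s : R => (x, segpt p0 p1 s, u) : T)}.
    apply: continuous_at_pair; last exact: cvg_cst.
    apply: continuous_at_pair; first exact: cvg_cst.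
    by apply: continuous_at_segpt; [exact: cvg_cst|exact: cvg_cst|exact: cvg_id].
  have cS : {for (x, segpt p0 p1 s, u), continuous S}.
    by rewrite -phiS; exact: (S_continuous H SK GS).
  have cSs := continuous_at_comp cs cS.
  have cq := continuous_at_comp cSs (@quad_gxx_continuous xi _ GS).
  exact: cq.
have [GS phiS] := phi_S SK (U s (subset_itv_oo_cc sI)).
have := mU xi _ _ GS et; apply: filterS => d.
have -> : gx (S (x, segpt p0 p1 s, u)) = segpt p0 p1 s by have := congr1 (snd \o fst) phiS.
have -> : g (S (x, segpt p0 p1 s, u)) = u by have := congr1 snd phiS.
have -> : (S (x, segpt p0 p1 s, u)).1.1 = x by have := congr1 (fst \o fst) phiS.
have -> : segpt p0 p1 s - d *: (p1 - p0) = segpt p0 p1 (s - d).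
  by rewrite /segpt; apply/rowP => i; rewrite !mxE; ring.
have -> // : segpt p0 p1 s + d *: (p1 - p0) = segpt p0 p1 (s + d).
by rewrite /segpt; apply/rowP => i; rewrite !mxE; ring.
Qed.

End Midpoint.

(** * The conditions as statements on sections *)

Section Conditions.
Context {R : realType} {n : nat}.
Notation T := ('rV[R]_n * 'rV[R]_n * R)%type.
Variables (G : set T) (g : T -> R) (gx gy : T -> 'rV[R]_n) (gz : T -> R)
  (gxx gxy : T -> 'M[R]_n) (gxz : T -> 'rV[R]_n).
Hypothesis H : genfun G g gx gy gz gxx gxy gxz.
Notation E := (matE gy gz gxy gxz).
Notation Q := (vecQ gy gz).
Notation phi := (phi g gx).
Variable S : T -> T.
Hypothesis SK : forall w, G w -> S (phi w) = w.

Lemma phi_ball w : G w -> exists2 r : R, 0 < r &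
  forall p, `|p - gx w| < r -> (phi @` G) (w.1.1, p, g w).
Proof.
move=> Gw; have : nbhs (phi w) (phi @` G).
  by apply: open_nbhs_nbhs; split; [exact: open_phi H|exact: imageP].
move=> /nbhs_ballP[r /= r0 rP]; exists r => // p pr; apply: rP.
rewrite -ball_normE /= (_ : _ - _ = (0, gx w - p, 0)); last first.
  by congr (_, _, _); rewrite /= subrr.
by rewrite normr_triple !normr0 [X in Num.max X _]max_r// max_l// distrC.
Qed.

Lemma near_scale_lt (v : 'rV[R]_n) (r : R) : 0 < r ->
  \forall d \near (0 : R)^'+, `|d *: v| < r.
Proof.
move=> r0; apply: near_at_right.
have nr : nbhs (0 + 0 *: v) [set u : 'rV[R]_n | `|u| < r].
  rewrite scale0r addr0; apply/nbhs_ballP; exists r => // u.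
  by rewrite -ball_normE /= sub0r normrN.
have cl := @continuous_line _ _ 0 v 0 _ nr.
have {}cl : \forall t \near (0 : R), `|0 + t *: v| < r by exact: cl.
by apply: filterS cl => d; rewrite add0r.
Qed.

(** So [Omega0] is a neighbourhood of [x0], by openness of the set of jets and compactness of the
    segment. *)
Lemma near_phi_segment x0 u p0 p1 :
  (forall t, t \in `[0, 1] -> (phi @` G) (x0, segpt p0 p1 t, u)) ->
  \forall x \near x0, forall t, t \in `[0, 1] -> (phi @` G) (x, segpt p0 p1 t, u).
Proof.
move=> U0.
pose P (x : 'rV[R]_n) (t : R) := (phi @` G) (x, segpt p0 p1 t, u).
have cov : \forall x \near x0, `[0, 1]%classic `<=` P x.
  have /compact_near_coveringP nc : compact `[(0 : R), 1]%classic.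
    exact: segment_compact.
  apply: (nc _ (nbhs x0) P) => t tI.
  have cid : {for (t, x0), continuous (id : R * 'rV[R]_n -> R * 'rV[R]_n)} by exact: cvg_id.
  have ccst (A : topologicalType) (a : A) :
    {for (t, x0), continuous ((fun=> a) : R * 'rV[R]_n -> A)} by exact: cvg_cst.
  have cc := continuous_at_pair (continuous_at_pair (continuous_at_snd cid)
    (continuous_at_segpt (ccst _ p0) (ccst _ p1) (continuous_at_fst cid))) (ccst _ u).
  have nU : nbhs (x0, segpt p0 p1 t, u) (phi @` G).
    by apply: open_nbhs_nbhs; split; [exact: open_phi H|exact: U0].
  exact: cc nU.
by apply: filterS cov => x xP t tI; exact: xP.
Qed.

Definition Xsec (y : 'rV[R]_n) (z : R) (q : 'rV[R]_n) : 'rV[R]_n :=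
  xget 0 [set x | G (x, y, z) /\ Q (x, y, z) = q].

Lemma XsecK y z x : G (x, y, z) -> Xsec y z (Q (x, y, z)) = x.
Proof.
move=> Gx; rewrite /Xsec; case: xgetP => [x' _ [Gx' Qx]|/(_ x)[]//].
exact: gf_injQ H _ _ _ _ Gx' Gx Qx.
Qed.

(* [A3w2] and [A3w1], for any [S] inverse to [phi]. *)
Definition sections_max := forall x0 u p0 p1,
  (forall t, t \in `[0, 1] -> (phi @` G) (x0, segpt p0 p1 t, u)) ->
  exists2 N, nbhs x0 N & forall x t, N x -> t \in `[0, 1] ->
    let w t := replace_x x (S (x0, segpt p0 p1 t, u)) in
    G (w t) /\ g (w t) <= Num.max (g (w 0)) (g (w 1)).

Definition sublevel_gconvex := forall x0 u p0 p1,
  (forall t, t \in `[0, 1] -> (phi @` G) (x0, segpt p0 p1 t, u)) ->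
  let w x t := replace_x x (S (x0, segpt p0 p1 t, u)) in
  exists2 N, nbhs x0 N &
  let C := [set x | [/\ forall t, t \in `[0, 1] -> (phi @` G) (x, segpt p0 p1 t, u),
    G (w x 1), G (w x 0) & g (w x 1) - g (w x 0) < 0]] `&` N in
  forall x x' t, C x -> C x' -> t \in `[0, 1] -> exists2 x'', C x'' &
    Q (w x'' 0) = segpt (Q (w x 0)) (Q (w x' 0)) t.

(** The weak property shared by all the conditions. The neighbourhood of x may shrink with [d],
    which is harmless because the expansion of [midpoint_quad] is made at fixed [d]. *)
Definition no_common_descent := forall w et, G w ->
  \forall d \near (0 : R)^'+, \forall x \near w.1.1,
    ~ (g (replace_x x (S (w.1.1, gx w + d *: et, g w))) < g (replace_x x w) /\
       g (replace_x x (S (w.1.1, gx w - d *: et, g w))) < g (replace_x x w)).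

Lemma segpt0 (p q : 'rV[R]_n) : segpt p q 0 = p.
Proof. by rewrite /segpt subr0 scale1r scale0r addr0. Qed.

Lemma segpt1 (p q : 'rV[R]_n) : segpt p q 1 = q.
Proof. by rewrite /segpt subrr scale1r scale0r add0r. Qed.

Lemma phi_segment w (et : 'rV[R]_n) : G w ->
  \forall d \near (0 : R)^'+, forall p q (t : R),
    `|p - gx w| <= `|d *: et| -> `|q - gx w| <= `|d *: et| -> t \in `[0, 1] ->
    (phi @` G) (w.1.1, segpt p q t, g w).
Proof.
move=> Gw; have [r r0 rP] := phi_ball Gw.
apply: filterS (near_scale_lt et r0) => d dr p q t pd qd tI; apply: rP.
by apply: segpt_dist tI; [exact: le_lt_trans pd dr|exact: le_lt_trans qd dr].
Qed.

Lemma no_common_descent_midpointU : no_common_descent -> midpointU G g gx gxx S.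
Proof.
move=> nc xi w et Gw exi.
have [r r0 rP] := phi_ball Gw.
apply: filterS2 (near_scale_lt et r0) (nc w et Gw) => d dr nd.
have [Gp pP] : G (S (w.1.1, gx w + d *: et, g w)) /\
    phi (S (w.1.1, gx w + d *: et, g w)) = (w.1.1, gx w + d *: et, g w).
  by apply: (phi_S SK); apply: rP; rewrite addrC addKr.
have [Gl lP] : G (S (w.1.1, gx w - d *: et, g w)) /\
    phi (S (w.1.1, gx w - d *: et, g w)) = (w.1.1, gx w - d *: et, g w).
  by apply: (phi_S SK); apply: rP; rewrite addrC addKr normrN.
move: Gw Gp pP Gl lP nd exi; rewrite /phi.
set wp := S _; set wl := S _.
case: wp => -[xp yp] zp; case: wl => -[xl yl] zl.
case: w {rP} => -[x ym] zm /= Gm Gp [xpE gxp gp] Gl [xlE gxl gl] nd exi.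
rewrite xpE in Gp gxp gp *; rewrite xlE in Gl gxl gl *.
apply: (@midpoint_quad _ _ _ _ _ _ _ _ _ _ H x xi (d *: et)) => //.
by rewrite dotZl exi mulr0.
Qed.

(** [gx w] is the midpoint of the two perturbed gradients, so [t = 1 / 2] in the bound by the
    maximum suffices. *)
Lemma sections_max_no_common_descent : sections_max -> no_common_descent.
Proof.
move=> sm w et Gw; apply: filterS (phi_segment et Gw) => d dU.
have U2 t : t \in `[0, 1] -> (phi @` G) (w.1.1, segpt (gx w - d *: et) (gx w + d *: et) t, g w).
  by apply: dU; rewrite addrC addKr// normrN.
have [N nN NP] := sm _ _ _ _ U2; apply: filterS nN => x Nx.
have h : (1 / 2 : R) \in `[0, 1] by rewrite in_itv /=; apply/andP; split; lra.
have [_] := NP x (1 / 2) Nx h; rewrite segpt0 segpt1.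
have -> : segpt (gx w - d *: et) (gx w + d *: et) (1 / 2) = gx w.
  by rewrite /segpt; apply/rowP => i; rewrite !mxE; field.
rewrite -[(w.1.1, gx w, g w)]/(phi w) SK// => le [lp ll].
by move: le; rewrite le_max leNgt ll leNgt lp.
Qed.

End Conditions.

Lemma near_line_right {R : realType} {n : nat} (a v : 'rV[R]_n) (P : set 'rV[R]_n) :
  nbhs a P -> \forall s \near (0 : R)^'+, P (a + s *: v).
Proof.
move=> nP; apply: near_at_right; have nP0 : nbhs (a + 0 *: v) P by rewrite scale0r addr0.
exact: continuous_line nP0.
Qed.

(** * From g-convexity of sublevel sets to A3w *)

Section Reverse.
Context {R : realType} {n : nat}.
Notation T := ('rV[R]_n * 'rV[R]_n * R)%type.
Variables (G : set T) (g : T -> R) (gx gy : T -> 'rV[R]_n) (gz : T -> R)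
  (gxx gxy : T -> 'M[R]_n) (gxz : T -> 'rV[R]_n).
Hypothesis H : genfun G g gx gy gz gxx gxy gxz.
Notation E := (matE gy gz gxy gxz).
Notation Q := (vecQ gy gz).
Notation phi := (phi g gx).
Notation conormal := (conormal gx gy gz gxy gxz).
Variable S : T -> T.
Hypothesis SK : forall w, G w -> S (phi w) = w.

Lemma is_diff_sub_Xsec y0 z0 y1 z1 x : G (x, y0, z0) -> G (x, y1, z1) ->
  is_diff (Q (x, y0, z0)) (fun q => g (Xsec G gy gz y0 z0 q, y1, z1) -
                                    g (Xsec G gy gz y0 z0 q, y0, z0))
    (fun v => - gz (x, y0, z0) * dot v (conormal y0 y1 z0 z1 x)).
Proof.
move=> G0 G1; pose h x := g (x, y1, z1) - g (x, y0, z0).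
have XK := XsecK H (y := y0) (z := z0).
have dX := is_diff_X H XK G0.
have dh : is_diff (Xsec G gy gz y0 z0 (Q (x, y0, z0))) h
    (fun v => dot v (gx (x, y1, z1) - gx (x, y0, z0))).
  by rewrite XK//; exact: (is_diff_section_sub H G0 G1).
apply: is_diff_eq (is_diff_comp dX dh) _; apply/funext => v /=.
by rewrite -scalemxAr dotZl dot_mulmx.
Qed.

Lemma near_section_lt x y0 z0 y1 z1 : G (x, y0, z0) -> G (x, y1, z1) ->
  g (x, y1, z1) < g (x, y0, z0) ->
  \forall x' \near x, g (x', y1, z1) < g (x', y0, z0).
Proof.
move=> G0 G1 hx; pose h x := g (x, y1, z1) - g (x, y0, z0).
have [dh _] : is_diff x h _ := is_diff_section_sub H G0 G1.
have nP : nbhs (h x) [set b | b < 0].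
  by apply: open_nbhs_nbhs; split; [exact: open_lt|rewrite /= subr_lt0].
have nh : \forall x' \near x, h x' < 0 by exact: (differentiable_continuous dh) nP.
by apply: filterS nh => x'; rewrite subr_lt0.
Qed.

(** If a point of [C] lay on the side of [x0] where g_1 - g_0 increases, a small step from [x0] in
    the opposite direction would give another point of [C], and convexity would put [x0] itself in
    [C], where g_1 < g_0. *)
Lemma descent_halfspace (C N : set 'rV[R]_n) x0 y0 z0 y1 z1 :
  G (x0, y0, z0) -> G (x0, y1, z1) -> g (x0, y1, z1) = g (x0, y0, z0) ->
  nbhs x0 N ->
  (forall x, N x -> g (x, y1, z1) < g (x, y0, z0) -> C x) ->
  (forall x, C x -> G (x, y0, z0) /\ g (x, y1, z1) < g (x, y0, z0)) ->
  (forall x x' t, C x -> C x' -> t \in `[0, 1] -> exists2 x'', C x'' &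
    Q (x'', y0, z0) = segpt (Q (x, y0, z0)) (Q (x', y0, z0)) t) ->
  \forall x \near x0, g (x, y1, z1) < g (x, y0, z0) ->
    dot (Q (x, y0, z0) - Q (x0, y0, z0)) (conormal y0 y1 z0 z1 x0) <= 0.
Proof.
move=> G0 G1 gE nN NC CG cC; apply: filterS (nN) => x Nx hx.
rewrite leNgt; apply/negP; set de := _ - _ => dde.
pose f q := g (Xsec G gy gz y0 z0 q, y0, z0) - g (Xsec G gy gz y0 z0 q, y1, z1).
have XK := XsecK H (y := y0) (z := z0).
have [dif difE] : is_diff (Q (x0, y0, z0)) f
    (fun v => gz (x0, y0, z0) * dot v (conormal y0 y1 z0 z1 x0)).
  have -> : f = - (fun q => g (Xsec G gy gz y0 z0 q, y1, z1) -
                            g (Xsec G gy gz y0 z0 q, y0, z0)).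
    by apply/funext => q; rewrite -[RHS]/(- (_ - _)) opprB.
  apply: is_diff_eq (is_diffN (is_diff_sub_Xsec G0 G1)) _.
  by apply/funext => v; rewrite -[LHS]/(- (_ * _)) mulNr opprK.
have : 0 < 'd f (Q (x0, y0, z0)) (- de).
  by rewrite difE dotNl mulrN -mulNr mulr_gt0// oppr_gt0 (gf_z H).
move=> /(diff_direction_gt0 dif)[e e0 ne].
have nU : nbhs x0 (N `&` [set x | G (x, y0, z0)]).
  by apply: filterI nN _; exact: near_section H _ _ _ G0.
have ns := near_line_right (- de) (Qx_open H G0 nU).
have [s [[nes [x' [Nx' Gx'] Qx']] s0]] := filter_ex (filterI (filterI ne ns) (nbhs_right_gt 0)).
have := nes (- de); rewrite subrr normr0 => /(_ (ltW e0)).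
rewrite -Qx' /f !XK// gE subrr subr_gt0 => hx'.
(* The weight for which [x0] is the combination of the points at [- s *: de] and [de] from it in the
   chart: [(1 - t) * s = t]. *)
pose t := s / (1 + s).
have s1 : 0 < 1 + s by rewrite addr_gt0.
have tI : t \in `[0, 1].
  by rewrite in_itv /= divr_ge0 ?(ltW s0) ?(ltW s1)//= ler_pdivrMr// mul1r lerDr.
have [x'' Cx'' Qx''] := cC x' x t (NC _ Nx' hx') (NC _ Nx hx) tI.
have [Gx'' hx''] := CG _ Cx''.
have Q0 : Q (x'', y0, z0) = Q (x0, y0, z0).
  rewrite Qx'' Qx' /segpt /de; move: (Q _) (Q _) => a b.
  by apply/rowP => i; rewrite !mxE /t; field; rewrite gt_eqF.
have x0E := gf_injQ H Gx'' G0 Q0.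
by rewrite x0E gE ltxx in hx''.
Qed.

Lemma sublevel_halfspace x0 y0 z0 y1 z1 : sublevel_gconvex G g gx gy gz S ->
  G (x0, y0, z0) -> G (x0, y1, z1) -> g (x0, y1, z1) = g (x0, y0, z0) ->
  (forall t, t \in `[0, 1] -> (phi @` G)
    (x0, segpt (gx (x0, y0, z0)) (gx (x0, y1, z1)) t, g (x0, y0, z0))) ->
  \forall x \near x0, g (x, y1, z1) < g (x, y0, z0) ->
    dot (Q (x, y0, z0) - Q (x0, y0, z0)) (conormal y0 y1 z0 z1 x0) <= 0.
Proof.
move=> sg G0 G1 gE U01; have [N nN] := sg _ _ _ _ U01.
have S0 : S (x0, gx (x0, y0, z0), g (x0, y0, z0)) = (x0, y0, z0) := SK G0.
have S1 : S (x0, gx (x0, y1, z1), g (x0, y0, z0)) = (x0, y1, z1).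
  by rewrite -gE; exact: SK G1.
rewrite segpt0 segpt1 S0 S1; cbv beta iota delta [replace_x fst snd].
set C := (_ `&` N) => cC.
have nn : nbhs x0 (N `&` [set x | (forall t, t \in `[0, 1] -> (phi @` G)
      (x, segpt (gx (x0, y0, z0)) (gx (x0, y1, z1)) t, g (x0, y0, z0))) /\
    (G (x, y0, z0) /\ G (x, y1, z1))]).
  apply: filterI nN _; apply: filterI (near_phi_segment H U01) _.
  by apply: filterI; [exact: near_section H _ _ _ G0|exact: near_section H _ _ _ G1].
apply: (@descent_halfspace C _ x0 y0 z0 y1 z1 G0 G1 gE nn _ _ cC).
  move=> x [Nx [Ux [G0x G1x]]] hx; split => //.
  by split => //; rewrite subr_lt0.
by move=> x [[_ _ G0x hx] _]; rewrite subr_lt0 in hx.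
Qed.

(** The sections with gradients p + et and p - et have opposite conormals, so near the base point
    their common descent set lies in a hyperplane of the chart; being open, it is empty. *)
Lemma sublevel_gconvex_no_common_descent :
  sublevel_gconvex G g gx gy gz S -> no_common_descent G g gx S.
Proof.
move=> sg w et Gw; apply: filterS (phi_segment H et Gw) => d dU.
have [et0|et0] := eqVneq (d *: et) 0.
  apply: (filterS _ (@filterT _ (nbhs w.1.1) _)) => x _.
  rewrite et0 addr0 -[(w.1.1, gx w, g w)]/(phi w) SK// ltxx.
  by case.
have Up t : t \in `[0, 1] -> (phi @` G) (w.1.1, segpt (gx w) (gx w + d *: et) t, g w).
  by apply: dU; rewrite ?subrr ?normr0// addrC addKr.
have Ul t : t \in `[0, 1] -> (phi @` G) (w.1.1, segpt (gx w) (gx w - d *: et) t, g w).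
  by apply: dU; rewrite ?subrr ?normr0// addrC addKr ?normrN.
have I1 : (1 : R) \in `[0, 1] by rewrite in_itv /= lexx ler01.
have := Up 1 I1; rewrite segpt1 => /(phi_S SK).
have := Ul 1 I1; rewrite segpt1 => /(phi_S SK).
set wl := S _; set wp := S (_, gx w + _, _).
case: wl => -[xl yl] zl; case: wp => -[xp yp] zp.
move: et0 Up Ul; clear dU; set eta := d *: et => et0; rewrite /phi.
case: w Gw => -[x0 y0] z0 /= G0 Up Ul [Gl [xlE gxl gl]] [Gp [xpE gxp gp]].
rewrite /replace_x /=; rewrite xpE in Gp gxp gp *; rewrite xlE in Gl gxl gl *.
rewrite -gxp in Up; rewrite -gxl in Ul.
have halfp := sublevel_halfspace sg G0 Gp gp Up.
have halfl := sublevel_halfspace sg G0 Gl gl Ul.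
have cnl : conormal y0 yl z0 zl x0 = - conormal y0 yp z0 zp x0.
  by rewrite /conormal gxl gxp -mulNmx; congr (_ *m _); rewrite addrC addKr addrC addKr.
have cn0 : conormal y0 yp z0 zp x0 != 0.
  apply: contra_neq et0 => cn0.
  have : conormal y0 yp z0 zp x0 *m (E (x0, y0, z0))^T = 0 by rewrite cn0 mul0mx.
  rewrite /conormal -mulmxA -trmx_mul mulmxV ?(gf_unit H)// trmx1 mulmx1.
  by rewrite gxp addrC addKr.
rewrite cnl in halfl.
move: cn0 halfp halfl; set om := conormal _ _ _ _ _ => om0 halfp halfl.
have nall : nbhs x0 [set x | [/\ g (x, yp, zp) < g (x, y0, z0) ->
    dot (Q (x, y0, z0) - Q (x0, y0, z0)) om <= 0, g (x, yl, zl) < g (x, y0, z0) ->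
    dot (Q (x, y0, z0) - Q (x0, y0, z0)) (- om) <= 0, G (x, y0, z0), G (x, yp, zp) &
    G (x, yl, zl)]].
  apply: filterS2 (filterI halfp halfl) (filterI (near_section H G0)
    (filterI (near_section H Gp) (near_section H Gl))).
  by move=> x [a b] [c [e f]]; split.
(* The half-space inequalities are needed on a neighbourhood of [x], since [x] is going to be moved
   along [om]. *)
apply: filterS (nbhs_interior nall) => x nx [hp hl].
have [px lx G0x Gpx Glx] := nbhs_singleton nx.
have nh : nbhs x [set x | g (x, yp, zp) < g (x, y0, z0) /\
    g (x, yl, zl) < g (x, y0, z0)].
  by apply: filterI; [exact: near_section_lt G0x Gpx hp|exact: near_section_lt G0x Glx hl].
have nq := Qx_open H G0x (@filterI _ (nbhs x) (nbhs_filter x) _ _ nx nh).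
have ns := near_line_right om nq.
have [s [[x' [[px' lx' _ _ _] [hp' hl']] Qx'] s0]] := filter_ex (filterI ns (nbhs_right_gt 0)).
have {}px' := px' hp'; have {}lx' := lx' hl'.
have {}px := px hp; have {}lx := lx hl.
have : dot (Q (x', y0, z0) - Q (x, y0, z0)) om <= 0.
  clear -px' lx' px lx; move: px' lx' px lx; move: (Q _) (Q _) (Q _) => a b c.
  by rewrite !dotNr !dotBl; lra.
by rewrite Qx' addrC addKr dotZl leNgt mulr_gt0// dot_gt0.

Qed.

End Reverse.

(** * From A3w to the conditions on sections *)

Section Direct.
Context {R : realType} {n : nat}.
Notation T := ('rV[R]_n * 'rV[R]_n * R)%type.
Variables (G : set T) (g : T -> R) (gx gy : T -> 'rV[R]_n) (gz : T -> R)
  (gxx gxy : T -> 'M[R]_n) (gxz : T -> 'rV[R]_n).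
Hypothesis H : genfun G g gx gy gz gxx gxy gxz.
Notation Q := (vecQ gy gz).
Notation phi := (phi g gx).
Notation jet_path := (jet_path g gx).
Variable S : T -> T.
Hypothesis SK : forall w, G w -> S (phi w) = w.

Lemma near_ball_lt (x0 : 'rV[R]_n) (r : R) : 0 < r -> nbhs x0 [set x | `|x - x0| < r].
Proof. by move=> r0; apply/nbhs_ballP; exists r => // x; rewrite -ball_normE /= distrC. Qed.

Lemma radius_gt0 (d : R) : 0 < d -> 0 < d / (2 * n%:R + 4).
Proof. by move=> d0; rewrite divr_gt0// ltr_wpDl// mulr_ge0. Qed.

Lemma radius_le (d : R) : 0 < d -> d / (2 * n%:R + 4) <= d.
Proof.
move=> d0; rewrite ler_pdivrMr ?ltr_wpDl ?mulr_ge0//.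
by rewrite ler_peMr ?(ltW d0)// ler_wpDl ?mulr_ge0// ler1n.
Qed.

Lemma segment_ends x0 u p0 p1 :
  (forall t, t \in `[0, 1] -> (phi @` G) (x0, segpt p0 p1 t, u)) ->
  exists y0 z0 y1 z1, [/\ S (x0, p0, u) = (x0, y0, z0) /\ S (x0, p1, u) = (x0, y1, z1),
    G (x0, y0, z0) /\ G (x0, y1, z1), g (x0, y1, z1) = g (x0, y0, z0) &
    forall t, (x0, segpt p0 p1 t, u) = jet_path y0 y1 z0 z1 t x0].
Proof.
move=> U01.
have I0 : (0 : R) \in `[0, 1] by rewrite in_itv /= lexx ler01.
have I1 : (1 : R) \in `[0, 1] by rewrite in_itv /= lexx ler01.
have := U01 0 I0; rewrite segpt0 => /(phi_S SK).
have := U01 1 I1; rewrite segpt1 => /(phi_S SK).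
case: (S (x0, p0, u)) => -[a y0] z0; case: (S (x0, p1, u)) => -[b y1] z1.
rewrite /phi /= => -[G1 [bx <- gu]] [G0 [ax <- gu0]].
rewrite ax in G0 gu0 *; rewrite bx in G1 gu *.
exists y0, z0, y1, z1; split => //; first by rewrite gu.
by move=> t; rewrite -gu0.
Qed.

(** The maximum principle bounds by the section that is larger at x', so it is applied to the pair
    in both orders; reversal replaces [t] by [1 - t]. *)
Lemma convexA_sections_max : convexA G g gx gxx S -> sections_max G g gx S.
Proof.
move=> cA x0 u p0 p1 U01.
have [y0 [z0 [y1 [z1 [[S0 S1] [G0 G1] gE cE]]]]] := segment_ends U01.
have U01' t : t \in `[0, 1] -> (phi @` G) (jet_path y0 y1 z0 z1 t x0).
  by move=> tI; rewrite -cE; exact: U01.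
have rE t : jet_path y1 y0 z1 z0 t x0 = jet_path y0 y1 z0 z1 (1 - t) x0.
  rewrite /jet_path gE; congr (_, _, _).
  by rewrite /segpt; apply/rowP => i; rewrite !mxE; ring.
have I1t (t : R) : t \in `[0, 1] -> 1 - t \in `[0, 1].
  by rewrite !in_itv /= => /andP[t0 t1]; rewrite subr_ge0 t1 gerBl.
have U10 t : t \in `[0, 1] -> (phi @` G) (jet_path y1 y0 z1 z0 t x0).
  by move=> tI; rewrite rE; exact: U01' (I1t _ tI).
have [d d0 dP] := admissible_near H SK G0 G1 U01'.
have [d' d'0 dP'] := admissible_near H SK G1 G0 U10.
have adm : admissible G g gx gy gz gxy gxz S d x0 y0 y1 z0 z1.
  by apply: dP; rewrite subrr normr0.
have adm' : admissible G g gx gy gz gxy gxz S d' x0 y1 y0 z1 z0.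
  by apply: dP'; rewrite subrr normr0.
exists [set x | `|x - x0| < d / (2 * n%:R + 4) /\ `|x - x0| < d' / (2 * n%:R + 4)].
  by apply: filterI; apply: near_ball_lt; exact: radius_gt0.
move=> x t [xd xd'] tI w; rewrite /w segpt0 segpt1 S0 S1 cE.
cbv beta iota zeta delta [replace_x fst snd].
have x0d (e : R) : 0 < e -> `|x0 - x0| < e / (2 * n%:R + 4).
  by move=> e0; rewrite subrr normr0 radius_gt0.
split.
  have [_ _ /(_ t tI)[_ Gt _]] := adm x0 x (lt_le_trans (x0d _ d0) (radius_le d0))
    (lt_le_trans xd (radius_le d0)).
  exact: Gt.
rewrite le_max; case: (leP (g (x, y1, z1)) (g (x, y0, z0))) => hx.
  by rewrite (maximum_principle H SK d0 cA adm (x0d _ d0) xd gE hx tI).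
have := maximum_principle H SK d'0 cA adm' (x0d _ d'0) xd' (esym gE) (ltW hx) (I1t _ tI).
by rewrite rE opprB addrCA subrr addr0 => ->; rewrite orbT.
Qed.

Lemma convexA_sublevel_gconvex : convexA G g gx gxx S -> sublevel_gconvex G g gx gy gz S.
Proof.
move=> cA x0 u p0 p1 U01.
have [y0 [z0 [y1 [z1 [[S0 S1] [G0 G1] gE cE]]]]] := segment_ends U01.
have U01' t : t \in `[0, 1] -> (phi @` G) (jet_path y0 y1 z0 z1 t x0).
  by move=> tI; rewrite -cE; exact: U01.
have [d d0 dP] := admissible_near H SK G0 G1 U01'.
have adm : admissible G g gx gy gz gxy gxz S d x0 y0 y1 z0 z1.
  by apply: dP; rewrite subrr normr0.
have nn : nbhs x0 [set x | (forall t, t \in `[0, 1] -> (phi @` G) (x, segpt p0 p1 t, u)) /\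
    (G (x, y0, z0) /\ G (x, y1, z1))].
  apply: filterI (near_phi_segment H U01) _.
  by apply: filterI; [exact: near_section H _ _ _ G0|exact: near_section H _ _ _ G1].
have /nbhs_ballP[e /= e0 eP] := nn.
pose r := Num.min e (d / (2 * n%:R + 4)).
have r0 : 0 < r by rewrite lt_min e0 radius_gt0.
have [rho rho0 ch] := section_chart H r0 G0.
(* A ball in the chart, so that its image is convex; [section_chart] provides points over it that
   satisfy [|x - x0| < r]. *)
exists [set x | [/\ G (x, y0, z0), `|x - x0| < r & `|Q (x, y0, z0) - Q (x0, y0, z0)| < rho]].
  have cQ : {for x0, continuous (fun x => Q (x, y0, z0))}.
    apply: differentiable_continuous.
    by have [] := strict_diff_is_diff (@mulmx_continuous _ _ _) (strict_diff_Qx H G0).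
  have nQ : nbhs x0 [set x | `|Q (x, y0, z0) - Q (x0, y0, z0)| < rho].
    exact: cQ (near_ball_lt (Q (x0, y0, z0)) rho0).
  by apply: filterS2 (filterI (near_section H G0) (near_ball_lt x0 r0)) nQ => x [].
rewrite segpt0 segpt1 S0 S1; cbv beta iota zeta delta [replace_x fst snd].
move=> x x' t [[_ G1x G0x hx] [_ xr Qx]] [[_ G1x' G0x' hx'] [_ xr' Qx']] tI.
have XK := XsecK H (y := y0) (z := z0).
have Qt := segpt_dist Qx Qx' tI.
have [x'' [G0x'' Qx'' xr'']] := ch _ Qt.
exists x'' => //; split; last by split => //; rewrite Qx''.
have [|Ux'' [_ G1x'']] := eP x''.
  by rewrite -ball_normE /= distrC; move: xr''; rewrite lt_min => /andP[].
split => //.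
have ch' q : `|q - Q (x0, y0, z0)| < rho -> exists x,
    [/\ G (x, y0, z0), Q (x, y0, z0) = q & `|x - x0| < d / (2 * n%:R + 4)].
  move=> /ch[a [Ga Qa ar]]; exists a; split => //.
  by move: ar; rewrite lt_min => /andP[].
have := sublevel_convex H SK XK ch' d0 cA adm Qx Qx'.
by move=> /(_ t); rewrite !XK// -Qx'' XK//; exact.
Qed.

End Direct.

(** * Duality *)

Section Dual.
Context {R : realType} {n : nat}.
Notation T := ('rV[R]_n * 'rV[R]_n * R)%type.

(** y comes first, so that the dual is a generating function of the same shape with y as base
    variable. *)
Definition dualpt (g : T -> R) (w : T) : T := (w.1.2, w.1.1, g w).

Variables (G : set T) (g : T -> R) (gx gy : T -> 'rV[R]_n) (gz : T -> R)
  (gxx gxy : T -> 'M[R]_n) (gxz : T -> 'rV[R]_n).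
Hypothesis H : genfun G g gx gy gz gxx gxy gxz.
Notation Q := (vecQ gy gz).
Variable S : T -> T.
Hypothesis SK : forall w, G w -> S (phi g gx w) = w.

Variables (gs : T -> R) (gxs gys : T -> 'rV[R]_n) (gzs : T -> R)
  (gxxs gxys : T -> 'M[R]_n) (gxzs : T -> 'rV[R]_n).
Notation Gs := (dualpt g @` G).
Hypothesis Hs : genfun Gs gs gxs gys gzs gxxs gxys gxzs.
Variable Ss : T -> T.
Hypothesis SsK : forall v, Gs v -> Ss (phi gs gxs v) = v.

Hypothesis gsK : forall w, G w -> gs (dualpt g w) = w.2.
Hypothesis gxsE : forall w, G w -> gxs (dualpt g w) = Q w.
Hypothesis gdec : forall x y z z', G (x, y, z) -> G (x, y, z') -> z < z' ->
  g (x, y, z') < g (x, y, z).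

Lemma dual_section (y0 : 'rV[R]_n) (z0 : R) q : (phi gs gxs @` Gs) (y0, q, z0) ->
  exists x, [/\ G (x, y0, z0), Q (x, y0, z0) = q &
    Ss (y0, q, z0) = (y0, x, g (x, y0, z0))].
Proof.
move=> [_ [[[x y] z] Gw <-]]; rewrite /phi gsK// gxsE// => -[/= <- <- <-].
exists x; split => //.
by have := SsK (imageP (dualpt g) Gw); rewrite /phi gsK// gxsE.
Qed.

(** The dual section at y is the z for which g(., y, z) still passes through the height g(x, y_0,
    z_0) over x. *)
Lemma dual_near (x y0 : 'rV[R]_n) (z0 d : R) : 0 < d -> G (x, y0, z0) ->
  \forall y \near y0, exists z, [/\ G (x, y, z), g (x, y, z) = g (x, y0, z0),
    gs (y, x, g (x, y0, z0)) = z & `|z - z0| < d].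
Proof.
move=> d0 Gw.
have Gsw : Gs (y0, x, g (x, y0, z0)) by exists (x, y0, z0).
have nGs := near_section Hs Gsw.
have cgs : {for y0, continuous (fun y => gs (y, x, g (x, y0, z0)))}.
  have di : is_diff y0 (fun y => (y, x, g (x, y0, z0)) : T) (fun v => (v, 0, 0) : T).
    exact: (is_diff_pair (is_diff_pair (is_diff_id _) (is_diff_cst x _)) (is_diff_cst _ _)).
  have [dg _] := is_diff_comp di (is_diff_g Hs Gsw).
  exact: differentiable_continuous dg.
have gs0 : gs (y0, x, g (x, y0, z0)) = z0 := gsK Gw.
have nb : nbhs (gs (y0, x, g (x, y0, z0))) [set z : R | `|z - z0| < d].
  by rewrite gs0; apply/nbhs_ballP; exists d => // z; rewrite -ball_normE /= distrC.
have nz : \forall y \near y0, `|gs (y, x, g (x, y0, z0)) - z0| < d by exact: cgs nb.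
apply: filterS2 nGs nz => y [[[x' y'] z] Gw' [/= yE xE gE]] zd.
rewrite yE xE in Gw' gE; exists z.
by have := gsK Gw'; rewrite /dualpt /= gE => gz'; rewrite -gz'; split => //; rewrite gz'.
Qed.

(** Let the dual sections of [xp] and [xl] both lie below that of [x0] at y, and take z strictly
    between. Since g decreases in z, [xp] and [xl] belong to {g(., y, z) < g(., y_0, z_0)} and [x0]
    does not, although it is their midpoint in the chart. *)
Lemma convexA_dual_no_common_descent :
  convexA G g gx gxx S -> no_common_descent Gs gs gxs Ss.
Proof.
move=> cA _ et [[[x0 y0] z0] G0 <-].
rewrite /dualpt [(_, _, _).1.1]/= [(x0, y0, z0).1.2]/= [(x0, y0, z0).1.1]/=.
rewrite (gsK G0) (gxsE G0) [(x0, y0, z0).2]/=.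
(* The pair consists of (y_0, z_0) twice, a constant path of jets; the uniformity in
   [admissible_near] then reaches every (y, z) near (y_0, z_0). *)
have U0 t : t \in `[0, 1] -> (phi g gx @` G) (jet_path g gx y0 y0 z0 z0 t x0).
  move=> _; exists (x0, y0, z0) => //; rewrite /phi /jet_path /=; congr (_, _, _).
  by rewrite /segpt -scalerDl subrK scale1r.
have [d d0 adm] := admissible_near H SK G0 G0 U0.
have [rho rho0 ch] := section_chart H (@radius_gt0 _ n _ d0) G0.
have [r r0 rP] := phi_ball Hs (imageP (dualpt g) G0).
rewrite gsK// gxsE// in rP.
have {}rP q : `|q - Q (x0, y0, z0)| < r -> (phi gs gxs @` Gs) (y0, q, z0) := rP q.
apply: filterS2 (near_scale_lt et r0) (near_scale_lt et rho0) => s sr srho.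
have [xp [Gp Qp ->]] : exists x, [/\ G (x, y0, z0), Q (x, y0, z0) = Q (x0, y0, z0) + s *: et &
    Ss (y0, Q (x0, y0, z0) + s *: et, z0) = (y0, x, g (x, y0, z0))].
  by apply: dual_section; apply: rP; rewrite addrC addKr.
have [xl [Gl Ql ->]] : exists x, [/\ G (x, y0, z0), Q (x, y0, z0) = Q (x0, y0, z0) - s *: et &
    Ss (y0, Q (x0, y0, z0) - s *: et, z0) = (y0, x, g (x, y0, z0))].
  by apply: dual_section; apply: rP; rewrite addrC addKr normrN.
have np := dual_near d0 Gp; have nl := dual_near d0 Gl; have nm := dual_near d0 G0.
have nd := near_ball_lt y0 d0.
apply: filterS2 (filterI np nl) (filterI nm nd) => y.
move=> [[zp [Gzp gzp gsp zpd]] [zl [Gzl gzl gsl zld]]].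
move=> [[zm [Gzm gzm gsm zmd]] yd]; rewrite /replace_x gsp gsl /= gsm => -[pm lm].
(* Strictly between, because [sublevel_convex] concerns the strict sublevel set. *)
pose z1 := (Num.max zp zl + zm) / 2.
have mm : Num.max zp zl < zm by rewrite gt_max pm.
have [z1m z1p z1l] : [/\ z1 < zm, zp < z1 & zl < z1].
  have : Num.max zp zl < z1 by rewrite /z1; lra.
  by rewrite gt_max => /andP[? ?]; split => //; rewrite /z1; lra.
have z1d : `|z1 - z0| < d.
  by move: zmd zpd; rewrite !ltr_norml => /andP[? ?] /andP[? ?]; apply/andP; split; lra.
have {}adm := adm y z1 yd z1d.
have XK := XsecK H (y := y0) (z := z0).
have qp : `|Q (xp, y0, z0) - Q (x0, y0, z0)| < rho by rewrite Qp addrC addKr.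
have ql : `|Q (xl, y0, z0) - Q (x0, y0, z0)| < rho by rewrite Ql addrC addKr normrN.
have h : (1 / 2 : R) \in `[0, 1] by rewrite in_itv /=; apply/andP; split; lra.
have [_ Gm _] := adm x0 x0 ltac:(by rewrite subrr normr0) ltac:(by rewrite subrr normr0).
have qd (x : 'rV[R]_n) : `|x - x0| < d / (2 * n%:R + 4) -> G (x, y, z1).
  by move=> /lt_le_trans/(_ (@radius_le _ n _ d0)) xd; have [_ Gx _] := adm x x xd xd.
have chd x : G (x, y0, z0) -> `|Q (x, y0, z0) - Q (x0, y0, z0)| < rho -> G (x, y, z1).
  move=> Gx /ch[x' [Gx' /(gf_injQ H Gx' Gx) -> xd]]; exact: qd.
have mid : segpt (Q (xp, y0, z0)) (Q (xl, y0, z0)) (1 / 2) = Q (x0, y0, z0).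
  by rewrite Qp Ql; move: (Q _) => a; apply/rowP => i; rewrite !mxE; field.
have := sublevel_convex H SK XK ch d0 cA adm qp ql.
move=> /(_ (1 / 2)); rewrite mid !XK// !subr_lt0 => hm.
have hp := gdec Gzp (chd _ Gp qp) z1p; rewrite gzp in hp.
have hl := gdec Gzl (chd _ Gl ql) z1l; rewrite gzl in hl.
have := gdec Gm Gzm z1m; rewrite gzm ltNge => /negP; apply.
by apply: ltW; apply: hm.
Qed.

End Dual.

Lemma continuous_mx {R : realType} {n m : nat} {A : topologicalType}
    (M : A -> 'M[R]_(m, n)) x :
  (forall i j, {for x, continuous (fun a => M a i j)}) -> {for x, continuous M}.
Proof.
move=> cM N [P nP PN]; have nn : \forall a \near x, forall i j, P i j (M a i j).
  apply: filter_forall => i; apply: filter_forall => j; exact: cM (nP i j).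
by apply: filterS nn => a Pa; exact: PN.
Qed.

Lemma derive_opp_ratio {R : realType} {V : normedModType R} (a b : V -> R) w v :
  a w != 0 -> differentiable a w -> differentiable b w ->
  'D_v (fun x => - (a x)^-1 * b x) w =
  - (a w)^-1 * ('D_v b w - (a w)^-1 * 'D_v a w * b w).
Proof.
move=> a0 da' db'; have da : derivable a w v by exact: diff_derivable.
have db : derivable b w v by exact: diff_derivable.
have dV := derivableV a0 da.
have -> : (fun x => - (a x)^-1 * b x) = (- (fun x => (a x)^-1)) * b by [].
rewrite (deriveM (derivableN dV) db) (deriveN dV) (deriveV a0 da).
rewrite -[LHS]/(- (a w)^-1 * 'D_v b w + b w * - (- (a w) ^- 2 * 'D_v a w)).
by rewrite -exprVn; move: (_^-1) => c; ring.
Qed.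

Lemma jet_p_coord {R : realType} {n : nat} (A B : 'M[R]_n) (k a b x y : 'rV[R]_n)
    (c z : R) i : (forall j, a 0 j = A i j) -> (forall j, b 0 j = B i j) ->
  c = k 0 i -> jet_p A B k (x, y, z) 0 i = dot x a + dot y b + z * c.
Proof.
move=> aE bE ->; rewrite /jet_p !dotE !mxE; congr (_ + _ + _).
  by apply: eq_bigr => j _; rewrite mxE aE.
by apply: eq_bigr => j _; rewrite mxE bE.
Qed.

(** * Differentiability data of a C^2 generating function *)

Section Regular.
Context {R : realType} {n : nat}.
Notation T := ('rV[R]_n * 'rV[R]_n * R)%type.

(* Monotonicity in [z] replaces the intervals in the definition of a generating
   domain: it is inherited by the dual. *)
Record regular (G : set T) (g : T -> R) : Prop := Regular {
  rg_open : open G;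
  rg_C2 : C2_on G g;
  rg_z : forall w, G w -> pz g w < 0;
  rg_A1 : A1 G g;
  rg_A2 : A2 G g;
  rg_A1star : A1star G g;
  rg_dec : forall x y z z', G (x, y, z) -> G (x, y, z') -> z < z' ->
    g (x, y, z') < g (x, y, z) }.

Variables (G : set T) (g : T -> R).
Hypothesis H : regular G g.

Lemma regular_pz_neq0 w : G w -> 'D_dirz g w != 0.
Proof. by move=> Gw; rewrite lt_eqF// (rg_z H). Qed.

Definition Qi (i : 'I_n) (w : T) : R := - ('D_dirz g w)^-1 * 'D_(diry i) g w.

Lemma Qi_C1 i : C1_on G (Qi i).
Proof.
have oG := rg_open H; have C2 := (rg_C2 H).2.
apply: C1_onM => //; apply: C1_onN => //; apply: C1_onV => //.
exact: regular_pz_neq0.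
Qed.

Lemma vecQ_row : vecQ (py g) (pz g) = (fun w => \row_i Qi i w).
Proof. by apply/funext => w; apply/rowP => i; rewrite !mxE. Qed.

Lemma derive_Qi i v w : G w ->
  'D_v (Qi i) w = - ('D_dirz g w)^-1 *
    ('D_v ('D_(diry i) g) w - ('D_dirz g w)^-1 * 'D_v ('D_dirz g) w * 'D_(diry i) g w).
Proof.
move=> Gw; have [dz _] := (rg_C2 H).2 dirz w Gw.
have [dy _] := (rg_C2 H).2 (diry i) w Gw.
exact: (@derive_opp_ratio _ _ ('D_dirz g) ('D_(diry i) g) w v (regular_pz_neq0 Gw) dz dy).
Qed.

(** Differentiating Q produces g_yx and g_zx, whereas E is written with g_xy and g_xz; [schwarz]
    exchanges them. *)
Lemma derive_Qi_x i j w : G w ->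
  'D_(dirx j) (Qi i) w = - ('D_dirz g w)^-1 * E g w j i.
Proof.
move=> Gw; rewrite derive_Qi// !mxE big_ord1 !mxE.
have e1 := @schwarz _ _ G g w (diry i) (dirx j) (rg_open H) (rg_C2 H) Gw.
have e2 := @schwarz _ _ G g w dirz (dirx j) (rg_open H) (rg_C2 H) Gw.
have aux (c p p' q q' b : R) : p = p' -> q = q' ->
  - c * (p - c * q * b) = - c * (p' - c * (q' * b)) by move=> -> ->; ring.
exact: aux _ _ _ _ _ _ e1 e2.
Qed.

Lemma strict_diff_Q w : G w ->
  strict_diff (vecQ (py g) (pz g)) w (fun v => \row_i 'd (Qi i) w v).
Proof.
move=> Gw; rewrite vecQ_row; apply: strict_diff_row => i.
have sd := C1_strict_diff (rg_open H) (@Qi_C1 i) Gw.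
exact: sd.
Qed.

Lemma regular_genfun :
  genfun G g (px g) (py g) (pz g) (pxx g) (pxy g) (pxz g).
Proof.
have oG := rg_open H; have [C1 C2] := rg_C2 H.
split.
- exact: oG.
- move=> w Gw; have -> : grad_form (px g w) (py g w) (pz g w) = 'd g w.
    by apply/funext => -[[x y] z]; rewrite diff_triple//; case: (C1 w Gw).
  have sd := C1_strict_diff oG C1 Gw.
  exact: sd.
- move=> w Gw; have -> : jet_p (pxx g w) (pxy g w) (pxz g w) =
      (fun v => \row_i 'd ('D_(dirx i) g) w v).
    apply/funext => -[[x y] z]; apply/rowP => i; rewrite [RHS]mxE.
    have dt := diff_triple x y z (C2 (dirx i) w Gw).1.
    apply: etrans (esym dt); apply: jet_p_coord => [j|j|]; by rewrite !mxE.
  apply: strict_diff_row => i; have sd := C1_strict_diff oG (C2 (dirx i)) Gw.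
  exact: sd.
- exact: rg_z H.
- by move=> w Gw; exact: (C1 w Gw).2.
- move=> w Gw; apply: continuous_mx => i j.
  have -> : (fun w => pxx g w i j) = 'D_(dirx j) ('D_(dirx i) g).
    by apply/funext => a; rewrite mxE.
  exact: (C2 _ w Gw).2.
- move=> w Gw; apply: continuous_mx => i j.
  have -> : (fun w => matE (py g) (pz g) (pxy g) (pxz g) w i j) =
    (fun w => 'D_(diry j) ('D_(dirx i) g) w -
       ('D_dirz g w)^-1 * ('D_dirz ('D_(dirx i) g) w * 'D_(diry j) g w)).
    by apply/funext => a; rewrite !mxE big_ord1 !mxE.
  apply: cvgB; first exact: (C2 _ w Gw).2.
  apply: cvgM; first by apply: cvgV; [exact: regular_pz_neq0|exact: (C1 w Gw).2].
  by apply: cvgM; [exact: (C2 _ w Gw).2|exact: (C1 w Gw).2].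
- move=> w Gw; exists (fun v => \row_i 'd (Qi i) w v); first exact: strict_diff_Q.
  move=> x; apply/rowP => i; rewrite [LHS]mxE (diff_triple _ _ _ (@Qi_C1 i w Gw).1).
  rewrite dotC dot0l mul0r !addr0 dotE !mxE mulr_sumr; apply: eq_bigr => j _.
  by rewrite mxE (derive_Qi_x i j Gw) -mulrA; congr (_ * _); exact: mulrC.
- by move=> w Gw; rewrite unitmxE unitfE; exact: rg_A2 H w Gw.
- move=> [[x y] z] [[x' y'] z'] Gw Gw' [/= xE pE gE]; rewrite -xE in Gw' pE gE *.
  have [|yz [_ yzP]] := rg_A1 H (x := x) (u := g (x, y, z)) (p := px g (x, y, z)).
    by exists (x, y, z).
  have e1 : yz = (y, z) by apply: yzP.
  have e2 : yz = (y', z') by apply: yzP; split; [exact: Gw'|exact: esym gE|exact: esym pE].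
  by move: e2; rewrite e1 => -[-> ->].
- by move=> x x' y z Gx Gx'; exact: rg_A1star H _ _ _ _ Gx Gx'.
Qed.

End Regular.

Lemma E_entry {R : realType} {n : nat} (f : 'rV[R]_n * 'rV[R]_n * R -> R) w i j :
  E f w i j = 'D_(diry j) ('D_(dirx i) f) w -
    (pz f w)^-1 * ('D_dirz ('D_(dirx i) f) w * py f w 0 j).
Proof. by rewrite !mxE big_ord1 !mxE. Qed.

(** * Regularity of the dual generating function *)

Section DualGenerating.
Context {R : realType} {n : nat}.
Notation T := ('rV[R]_n * 'rV[R]_n * R)%type.
Variables (G : set T) (g : T -> R).
Hypothesis H : regular G g.
Notation Gs := (dualpt g @` G).

Definition gdual (v : T) : R := gstar G g (v.1.2, v.1.1, v.2).
Definition undual (v : T) : T := (v.1.2, v.1.1, gdual v).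

(** Strict monotonicity in z makes the solution chosen by [xget] unique. *)
Lemma gdualK w : G w -> gdual (dualpt g w) = w.2.
Proof.
case: w => -[x y] z Gw; rewrite /gdual /gstar /dualpt /=.
case: xgetP => [z' _ [/= Gz' gz']|/(_ z)[]//].
by case: (ltgtP z z') => // zz'; [have := rg_dec H Gw Gz' zz'|have := rg_dec H Gz' Gw zz'];
  rewrite gz' ltxx.
Qed.

Lemma undualK w : G w -> undual (dualpt g w) = w.
Proof. by move=> Gw; rewrite /undual gdualK//; case: w Gw => -[]. Qed.

Lemma undual_dual v : Gs v -> G (undual v) /\ dualpt g (undual v) = v.
Proof. by move=> [w Gw <-]; rewrite undualK. Qed.

Let c0 w : G w -> pz g w != 0.
Proof. by move=> Gw; rewrite lt_eqF// (rg_z H). Qed.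

Lemma strict_diff_dualpt w : G w ->
  strict_diff (dualpt g) w (jet_swap (px g w) (py g w) (pz g w)).
Proof.
move=> Gw; apply: strict_diff_triple.
- by move=> e e0; exists 1 => // b c _ _; rewrite /= subrr normr0 mulr_ge0// ltW.
- by move=> e e0; exists 1 => // b c _ _; rewrite /= subrr normr0 mulr_ge0// ltW.
- exact: gf_diff (regular_genfun H) _ Gw.
Qed.

Lemma dualpt_open w (N : set T) : G w -> nbhs w N -> nbhs (dualpt g w) (dualpt g @` N).
Proof.
move=> Gw Nw.
have h1 := jet_swapK (px g w) (py g w) (c0 Gw).
have h2 := jet_swap_invK (px g w) (py g w) (c0 Gw).
have h3 := @strict_diff_open _ _ _ _ _ _ _ (strict_diff_dualpt Gw)
  (@linear_triple_continuous _ _ _ _) h1 h2.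
apply: h3 Nw.
exact: compact_closed_ball_triple.
Qed.

Lemma open_dual : open Gs.
Proof.
rewrite openE => _ [w Gw <-]; apply: dualpt_open => //.
by apply: open_nbhs_nbhs; split=> //; exact: rg_open H.
Qed.

Lemma undual_continuous v : Gs v -> {for v, continuous undual}.
Proof.
move=> [w Gw <-] N; rewrite undualK// => Nw.
have NG : nbhs w (N `&` G).
  by apply: filterI => //; apply: open_nbhs_nbhs; split=> //; exact: rg_open H.
apply: filterS (dualpt_open Gw NG) => _ [w' [Nw' Gw'] <-] /=.
by rewrite undualK.
Qed.

Lemma is_diff_undual w : G w ->
  is_diff (dualpt g w) undual (jet_swap_inv (px g w) (py g w) (pz g w)).
Proof.
move=> Gw.
have h1 := jet_swapK (px g w) (py g w) (c0 Gw).
have h2 := @strict_diff_inverse _ _ _ _ _ _ _ (strict_diff_dualpt Gw)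
  (@linear_triple_continuous _ _ _ _) h1 G undual.
apply: h2.
- by apply: dualpt_open => //; apply: open_nbhs_nbhs; split=> //; exact: rg_open H.
- by apply: undual_continuous; exists w.
- by move=> b; exact: undualK.
- exact: undualK.
Qed.

(** Implicit differentiation of g(x, y, g*(x, y, u)) = u, expressed at the primal point. It involves
    only first derivatives of g, so it is C^1 in [w], and hence the dual is C^2. *)
Definition dgdual (d : T) (w : T) : R :=
  (d.2 - 'D_((d.1.2, d.1.1, 0) : T) g w) * ('D_dirz g w)^-1.

Lemma C1_on_dgdual d : C1_on G (dgdual d).
Proof.
have oG := rg_open H; have C2 := (rg_C2 H).2.
apply: C1_onM => //; last by apply: C1_onV => //; exact: c0.
by apply: C1_onD => //; [exact: C1_on_cst|apply: C1_onN].
Qed.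

Lemma jet_swap_inv_dgdual w d : G w ->
  jet_swap_inv (px g w) (py g w) (pz g w) d = (d.1.2, d.1.1, dgdual d w).
Proof.
move=> Gw; congr (_, _, _ / _); rewrite deriveE; last by case: ((rg_C2 H).1 w Gw).
rewrite diff_triple; last by case: ((rg_C2 H).1 w Gw).
by rewrite mul0r addr0 opprD addrA.
Qed.

Lemma derive_comp_undual (F : T -> R) d v : C1_on G F -> Gs v ->
  differentiable (F \o undual) v /\ 'D_d (F \o undual) v =
  'D_((d.1.2, d.1.1, 0) : T) F (undual v) + dgdual d (undual v) * 'D_dirz F (undual v).
Proof.
move=> FC [w Gw <-]; rewrite undualK//.
have [dF _] := FC w Gw; have [dU dUE] := is_diff_undual Gw.
have dF' : differentiable F (undual (dualpt g w)) by rewrite undualK.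
have dc : differentiable (F \o undual) (dualpt g w) by exact: differentiable_comp.
split=> //; rewrite deriveE// diff_comp//= dUE undualK// jet_swap_inv_dgdual//.
rewrite (_ : (_, _, _) = (d.1.2, d.1.1, 0) + dgdual d w *: dirz :> T).
  by rewrite linearD linearZ /= -!deriveE.
by congr (_, _, _); rewrite /= ?scaler0 ?addr0// add0r [_ *: _]mulr1.
Qed.

Lemma C1_on_comp_undual (F : T -> R) : C1_on G F -> C1_on Gs (F \o undual).
Proof.
move=> FC.
apply: (@C1_on_derive _ _ _ _ (fun d v => 'D_((d.1.2, d.1.1, 0) : T) F (undual v) +
  dgdual d (undual v) * 'D_dirz F (undual v))).
- exact: open_dual.
- by move=> v Gv; case: (derive_comp_undual 0 FC Gv).
- by move=> v d Gv; case: (derive_comp_undual d FC Gv).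
- move=> v d Gv; have [Gw _] := undual_dual Gv; have cu := undual_continuous Gv.
  apply: cvgD; first exact: continuous_at_comp cu ((FC _ Gw).2 _).
  apply: cvgM; last exact: continuous_at_comp cu ((FC _ Gw).2 _).
  exact: continuous_at_comp cu (C1_on_continuous (@C1_on_dgdual d) Gw).
Qed.

Lemma derive_snd (v w : T) : differentiable (snd : T -> R) w /\ 'D_v (snd : T -> R) w = v.2.
Proof.
have c2 : continuous (snd : T -> R) by move=> a; exact: cvg_snd.
have d2 : differentiable (snd : T -> R) w by exact: linear_differentiable.
by split=> //; rewrite deriveE// diff_lin.
Qed.

Lemma C1_on_snd : C1_on G (snd : T -> R).
Proof.
apply: (@C1_on_derive _ _ _ _ (fun d _ => d.2)).
- exact: rg_open H.
- by move=> w _; case: (derive_snd 0 w).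
- by move=> w d _; case: (derive_snd d w).
- by move=> w d _; exact: cvg_cst.
Qed.

Lemma derive_gdual d v : Gs v -> 'D_d gdual v = dgdual d (undual v).
Proof.
move=> Gv; have [_] := derive_comp_undual d C1_on_snd Gv.
rewrite (derive_snd _ _).2 (derive_snd _ _).2 mulr1 add0r => <-.
by congr ('D_d _ v).
Qed.

Lemma C2_on_gdual : C2_on Gs gdual.
Proof.
split=> [|d]; first exact: (C1_on_comp_undual C1_on_snd).
apply: C1_on_eq (C1_on_comp_undual (@C1_on_dgdual d)); first exact: open_dual.
by move=> v /set_mem Gv; rewrite derive_gdual.
Qed.

Lemma pz_gdual w : G w -> pz gdual (dualpt g w) = (pz g w)^-1.
Proof.
move=> Gw; rewrite /pz derive_gdual ?undualK//.
rewrite /dgdual /= (_ : (0, 0, 0) = 0 :> T)// deriveE; last by case: ((rg_C2 H).1 w Gw).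
by rewrite linear0 subr0 mul1r.
Qed.

Lemma px_gdual w : G w -> px gdual (dualpt g w) = vecQ (py g) (pz g) w.
Proof.
move=> Gw; apply/rowP => i; rewrite !mxE derive_gdual ?undualK//.
by rewrite /dgdual /= sub0r mulNr mulNr mulrC.
Qed.

Lemma py_gdual w : G w -> py gdual (dualpt g w) = - (pz g w)^-1 *: px g w.
Proof.
move=> Gw; apply/rowP => i; rewrite !mxE derive_gdual ?undualK//.
by rewrite /dgdual /= sub0r mulNr mulNr mulrC.
Qed.

Lemma Q_gdual w : G w -> vecQ (py gdual) (pz gdual) (dualpt g w) = px g w.
Proof.
move=> Gw; rewrite /vecQ pz_gdual// py_gdual// scalerA invrK mulrNN mulfV ?scale1r//.
exact: c0.
Qed.

(** The x-gradient of the dual is Q, whose x-derivative is - E / g_z; the rank-one term of E removes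
    exactly the contribution of the z-derivative of Q. Thus A2 is self-dual. *)
Lemma E_gdual w : G w -> E gdual (dualpt g w) = - (pz g w)^-1 *: (E g w)^T.
Proof.
move=> Gw; have Gv : Gs (dualpt g w) by exists w.
apply/matrixP => i j; rewrite E_entry [RHS]mxE [X in _ = _ * X]mxE.
have dQ d : 'D_d ('D_(dirx i) gdual) (dualpt g w) =
    'D_((d.1.2, d.1.1, 0) : T) (Qi g i) w + dgdual d w * 'D_dirz (Qi g i) w.
  have [_] := derive_comp_undual d (@Qi_C1 _ _ _ _ H i) Gv; rewrite undualK// => <-.
  apply: near_eq_derive; have nG : \forall v \near dualpt g w, Gs v.
    by apply: open_nbhs_nbhs; split=> //; exact: open_dual.
  apply: filterS nG => v [w' Gw' <-]; have := px_gdual Gw' => /rowP/(_ i).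
  by rewrite !mxE /= undualK.
have dx := derive_Qi_x H i j Gw; have yj : py gdual (dualpt g w) 0 j = dgdual (diry j) w.
  by rewrite mxE derive_gdual ?undualK//.
have zz : dgdual dirz w = (pz g w)^-1.
  by have := derive_gdual dirz Gv; rewrite (undualK Gw) => <-; exact: pz_gdual.
have e1 : 'D_(diry j) ('D_(dirx i) gdual) (dualpt g w) =
  'D_(dirx j) (Qi g i) w + dgdual (diry j) w * 'D_dirz (Qi g i) w := dQ (diry j).
have e2 : 'D_dirz ('D_(dirx i) gdual) (dualpt g w) =
    'D_(0 : T) (Qi g i) w + dgdual dirz w * 'D_dirz (Qi g i) w := dQ dirz.
have e3 : 'D_(0 : T) (Qi g i) w = 0.
  by rewrite deriveE ?linear0//; case: (@Qi_C1 _ _ _ _ H i w Gw).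
rewrite e1 e2 e3 dx yj zz (pz_gdual Gw) invrK add0r.
have aux (a b c p : R) : p != 0 -> a + b * c - p * (p^-1 * c * b) = a.
  by move=> p0; field.
exact: aux (c0 Gw).
Qed.

(** Duality exchanges g_x with Q, and therefore A1 with [A1star]. *)
Lemma dual_regular : regular Gs gdual.
Proof.
split.
- exact: open_dual.
- exact: C2_on_gdual.
- by move=> _ [w Gw <-]; rewrite pz_gdual// invr_lt0; exact: rg_z H w Gw.
- move=> y z q [_ [w Gw <-] [yE zE qE]]; rewrite gdualK// in zE; rewrite px_gdual// in qE.
  exists (w.1.1, g w); split.
    split; rewrite /= -yE; first by exists w.
    + by rewrite -[(_, _, _)]/(dualpt g w) gdualK.
    + by rewrite -[(_, _, _)]/(dualpt g w) px_gdual.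
  move=> [x u] [[[[x' y'] z'] Gw' [/= yE' xE' uE']] /= gE pE].
  case: w yE zE qE Gw => -[x0 y0] z0 /= yE zE qE Gw.
  rewrite yE' xE' in Gw' uE' *; rewrite yE in Gw qE *.
  have z'z : z' = z by have := gdualK Gw'; rewrite /dualpt /= uE' gE.
  have Qx : vecQ (py g) (pz g) (x, y, z') = q by have := px_gdual Gw'; rewrite /dualpt /= uE' pE.
  rewrite z'z in Gw' Qx uE'; rewrite zE in Gw qE *.
  have x0x := rg_A1star H Gw Gw' (etrans qE (esym Qx)).
  by rewrite -uE' x0x.
- move=> _ [w Gw <-]; rewrite E_gdual// detZ det_tr mulf_neq0 ?(rg_A2 H)//.
  by rewrite expf_neq0// oppr_eq0 invr_eq0 c0.
- move=> x u y y' [w Gw wE] [w' Gw' wE']; rewrite -wE -wE' => QE.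
  have Q1 := Q_gdual Gw; have Q2 := Q_gdual Gw'.
  have pE : px g w = px g w' by rewrite -Q1 -Q2; exact: QE.
  case: w w' Gw Gw' wE wE' {QE Q1 Q2} pE => -[x1 y1] z1 [[x2 y2] z2] Gw Gw'.
  move=> [/= <- xE uE] [<- xE' uE'] pE.
  have e : (x1, y1, z1) = (x2, y2, z2).
    by apply: (gf_inj (regular_genfun H) Gw Gw'); rewrite /= uE uE' pE xE xE'.
  by case: e.
- move=> y x u u' [[[x1 y1] z1] Gw [/= <- <- <-]] [[[x2 y2] z2] Gw' [/= yE xE <-]].
  rewrite yE xE in Gw' *.
  rewrite -[(y1, x1, g (x1, y1, z1))]/(dualpt g (x1, y1, z1)).
  rewrite -[(y1, x1, g (x1, y1, z2))]/(dualpt g (x1, y1, z2)).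
  rewrite !gdualK// => /= gg; case: (ltgtP z2 z1) => // [zz|zz].
    by have := rg_dec H Gw Gw' zz; rewrite ltNge (ltW gg).
  by rewrite zz ltxx in gg.
Qed.

End DualGenerating.

(** * Translation of the given conditions *)

Section Glue.
Context {R : realType} {n : nat}.
Notation T := ('rV[R]_n * 'rV[R]_n * R)%type.

(** The fibres in z are intervals, so g_z < 0 gives monotonicity by the mean value theorem. *)
Lemma generating_regular (G : set T) (g : T -> R) : generating_domain G ->
  generating_function G g -> A1 G g -> A2 G g -> A1star G g -> regular G g.
Proof.
move=> [oG _ iG] [C2 zneg] hA1 hA2 hA1s; split => // x y z z' Gz Gz' zz'.
have sz : 0 < z' - z by rewrite subr_gt0.
have ptE t : (x, y, z) + t *: dirz = (x, y, z + t) :> T.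
  by congr (_, _, _); rewrite /= ?scaler0 ?addr0// [_ *: _]mulr1.
have Gt t : t \in `[0, z' - z] -> G (x, y, z + t).
  rewrite in_itv /= => /andP[t0 tz]; apply: (iG x y).2 Gz Gz' _ _ => /=.
  by rewrite lerDl t0 /=; move: tz; rewrite lerBrDl.
have [t|t tI] := @mvt_line _ _ g (x, y, z) dirz (z' - z) sz.
  by move=> tI; rewrite ptE; case: (C2.1 _ (Gt t tI)).
rewrite !ptE addrCA subrr addr0 => gE.
rewrite -subr_lt0 gE pmulr_rlt0//; apply: zneg; apply: Gt; exact: subset_itv_oo_cc tI.
Qed.

(** [conv] puts the weight [t] on its first argument and [segpt] on its second, hence the
    exchange. *)
Lemma conv_segpt (p q : convex_lmodType 'rV[R]_n) (t : {i01 R}) :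
  conv t p q = segpt q p t%:num.
Proof. exact: addrC. Qed.

Lemma seg_segpt (p0 p1 p q : 'rV[R]_n) s : seg p0 p1 p -> seg p0 p1 q ->
  s \in `[0, 1] -> seg p0 p1 (segpt p q s).
Proof.
move=> [a aI <-] [b bI <-]; rewrite in_itv /= => /andP[s0 s1].
have /andP[a0 a1] : 0 <= a <= 1 by move: aI; rewrite /= in_itv.
have /andP[b0 b1] : 0 <= b <= 1 by move: bI; rewrite /= in_itv.
have ss : 0 <= 1 - s by rewrite subr_ge0.
exists ((1 - s) * a + s * b); last first.
  by rewrite /segpt; apply/rowP => i; rewrite !mxE; ring.
rewrite /= in_itv /= addr_ge0 ?mulr_ge0//=.
by rewrite (le_trans (lerD (ler_piMr ss a1) (ler_piMr s0 b1)))// subrK.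
Qed.

Lemma convex_function_seg_eq (q0 q1 : 'rV[R]_n) (f f' : 'rV[R]_n -> R) :
  (forall p, seg q0 q1 p -> f p = f' p) ->
  @convex_function R 'rV[R]_n (seg q0 q1) f ->
  @convex_function R 'rV[R]_n (seg q0 q1) f'.
Proof.
move=> E h t p q pI qI; have := h t p q pI qI.
move: pI qI => /set_mem ps /set_mem qs.
have cs : seg q0 q1 (conv t p q).
  by rewrite conv_segpt; apply: seg_segpt => //; rewrite in_itv /= ge0 le1.
by rewrite (E _ ps) (E _ qs) (E _ cs).
Qed.

Section Conditions.
Variables (G : set T) (g : T -> R).
Hypothesis H : regular G g.

(** The concrete left inverse of [phi], built from [Y] and [Z]. *)
Definition jet_section (v : T) : T :=
  (v.1.1, Y G g v.1.1 v.2 v.1.2, Z G g v.1.1 v.2 v.1.2).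

Lemma jet_sectionK w : G w -> jet_section (phi g (px g) w) = w.
Proof.
case: w => -[x y] z Gw; rewrite /jet_section /Y /Z /phi /=.
have uE yz : YZset G g x (g (x, y, z)) (px g (x, y, z)) yz -> yz = (y, z).
  case: yz => y' z' [/= Gw' gE pE].
  have e : (x, y', z') = (x, y, z).
    by apply: (gf_inj (regular_genfun H) Gw' Gw); rewrite /= gE pE.
  by case: e => -> ->.
by case: xgetP => [yz _ /uE -> //|/(_ (y, z))[]].
Qed.

Lemma Ufiber_phi x u p : Ufiber G g x u p <-> (phi g (px g) @` G) (x, p, u).
Proof. by split=> -[w Gw [<- <- <-]]; exists w. Qed.

Lemma seg_Ufiber x u p0 p1 : seg p0 p1 `<=` Ufiber G g x u <->
  forall t, t \in `[0, 1] -> (phi g (px g) @` G) (x, segpt p0 p1 t, u).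
Proof.
split=> [sU t tI|tU _ [t tI <-]]; last by apply/Ufiber_phi; exact: tU.
by apply/Ufiber_phi; apply: sU; exists t.
Qed.

(** From right to left, convexity at two arbitrary points of the segment is [convexU] on the
    subsegment that they span, whose direction is still orthogonal to [xi]. *)
Lemma A3w_convexU : A3w G g <-> convexU G g (px g) (pxx g) jet_section.
Proof.
split=> [h xi x u p0 p1 /seg_Ufiber pU pxi t|h xi x u p0 p1 pU' pxi t p q].
  rewrite in_itv /= => /andP[t0 t1].
  have s0 : seg p0 p1 p0 by exists 0; rewrite ?segpt0//= in_itv /= lexx ler01.
  have s1 : seg p0 p1 p1 by exists 1; rewrite ?segpt1//= in_itv /= lexx ler01.
  have := h xi x u p0 p1 pU pxi (Itv01 t0 t1) p1 p0 (mem_set s1) (mem_set s0).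
  by rewrite conv_segpt convRE [X in _ <= X -> _]addrC.
move=> /set_mem ps /set_mem qs.
rewrite conv_segpt convRE [X in _ <= X]addrC.
have tI : t%:num \in `[(0 : R), 1] by rewrite in_itv /= ge0 le1.
apply: (h xi x u q p) => //.
  by move=> s sI; apply/Ufiber_phi; apply: pU'; exact: seg_segpt.
move: ps qs => [a _ <-] [b _ <-].
have -> : segpt p0 p1 a - segpt p0 p1 b = (a - b) *: (p1 - p0).
  by rewrite /segpt; apply/rowP => i; rewrite !mxE; ring.
by rewrite dotZl pxi mulr0.
Qed.

Lemma A3w2_sections_max : A3w2 G g <-> sections_max G g (px g) jet_section.
Proof.
split=> h x0 u0 p0 p1 /seg_Ufiber pU.
  exact: h x0 u0 p0 p1 pU.
exact: h x0 u0 p0 p1 pU.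
Qed.

Lemma A3w1_sublevel_gconvex :
  A3w1 G g <-> sublevel_gconvex G g (px g) (py g) (pz g) jet_section.
Proof.
split=> h x0 u0 p0 p1 pU; have pU' := pU.
  move/seg_Ufiber in pU'; have [N nN [CG cC]] := h x0 u0 p0 p1 pU'.
  exists N => // C x x' t Cx Cx'; rewrite in_itv /= => /andP[t0 t1].
  have CE a : C a -> (Sth G g x0 u0 p0 p1 1 `&` N) a.
    by move=> [[Ua G1 G0 ha] Na]; split => //; split => //; apply/seg_Ufiber.
  have := cC (Q g (replace_x x' (jet_section (x0, segpt p0 p1 0, u0))))
    (Q g (replace_x x (jet_section (x0, segpt p0 p1 0, u0)))) (Itv01 t0 t1).
  rewrite conv_segpt => /(_ _ _)/set_mem[].
  - by apply/mem_set; exists x' => //; exact: CE.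
  - by apply/mem_set; exists x => //; exact: CE.
  - move=> x'' [[Ua G1 G0 ha] Na] QE; exists x'' => //; split => //; split => //.
    exact/seg_Ufiber.
move/seg_Ufiber in pU'; have [N nN cC] := h x0 u0 p0 p1 pU'.
exists N => //; split => [x [[]] //|p q t].
move=> /set_mem[x [[Ux G1x G0x hx] Nx] <-] /set_mem[x' [[Ux' G1x' G0x' hx'] Nx'] <-].
apply/mem_set; rewrite conv_segpt.
have tI : t%:num \in `[(0 : R), 1] by rewrite in_itv /= ge0 le1.
have [||//|x'' [[Ux'' G1'' G0'' h''] N''] QE] := cC x' x t%:num.
- by split => //; split => //; exact/seg_Ufiber.
- by split => //; split => //; exact/seg_Ufiber.
exists x'' => //; split => //; split => //; exact/seg_Ufiber.
Qed.

End Conditions.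

Lemma pxx_swap_xy (f : T -> R) (w : T) : pxx (f \o swap_xy) w = pyy f (swap_xy w).
Proof.
apply/matrixP => i j; rewrite [LHS]mxE [RHS]mxE.
have -> : 'D_(dirx i) (f \o swap_xy) = 'D_(diry i) f \o swap_xy.
  by apply/funext => a; exact: derive_swap_xy.
exact: derive_swap_xy.
Qed.

(** [V] and [Astar] are [U] and [A] of the dual. The latter are compared only over [V], where both
    are given by solutions of their equations and not by default values. *)
Lemma A3wstar_A3w_dual (G : set T) (g : T -> R) : regular G g ->
  A3wstar G g <-> A3w (dualpt g @` G) (gdual G g).
Proof.
move=> H; have Hs := dual_regular H.
have UV y z q : V G g (y, z, q) <-> U (dualpt g @` G) (gdual G g) (y, z, q).
  split=> [[w Gw [<- <- <-]]|[_ [w Gw <-] [<- <- <-]]].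
    by exists (dualpt g w); [exists w|rewrite gdualK// px_gdual].
  by exists w => //; rewrite gdualK// px_gdual.
have AE y z q : V G g (y, z, q) ->
    Astar G g y z q = A (dualpt g @` G) (gdual G g) y z q.
  move=> [[[x y1] z1] Gw [/= <- <- <-]].
  have Yw : jet_section (dualpt g @` G) (gdual G g) (y1, Q g (x, y1, z1), z1) =
      (y1, x, g (x, y1, z1)).
    have := jet_sectionK Hs (imageP (dualpt g) Gw).
    by rewrite /phi gdualK// px_gdual.
  have Xw : X G g y1 z1 (Q g (x, y1, z1)) = x.
    rewrite /X; case: xgetP => [x' _ [Gx Qx]|/(_ x)[]//].
    exact: rg_A1star H _ _ _ _ Gx Gw Qx.
  rewrite /Astar Xw -[RHS]/(pxx _ (jet_section (dualpt g @` G) (gdual G g)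
    (y1, Q g (x, y1, z1), z1))) Yw.
  exact: esym (pxx_swap_xy (gstar G g) (y1, x, g (x, y1, z1))).
have sUV p0 p1 y z : seg p0 p1 `<=` Vfiber G g y z <->
    seg p0 p1 `<=` Ufiber (dualpt g @` G) (gdual G g) y z.
  by split=> sub p /sub /UV.
split=> h xi y z q0 q1 sub qxi.
  apply: (convex_function_seg_eq (f := fun q => quad (Astar G g y z q) xi)).
    by move=> p /((sUV _ _ _ _).2 sub) /AE ->.
  by apply: h => //; exact/sUV.
apply: (convex_function_seg_eq
  (f := fun q => quad (A (dualpt g @` G) (gdual G g) y z q) xi)).
  by move=> p /sub /AE ->.
by apply: h => //; exact/sUV.
Qed.

End Glue.

(** * The equivalences and invariance under duality *)

Section Equivalence.
Context {R : realType} {n : nat}.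
Notation T := ('rV[R]_n * 'rV[R]_n * R)%type.
Variables (G : set T) (g : T -> R).
Hypothesis H : regular G g.
Let Hg := regular_genfun H.
Let SK := jet_sectionK H.

Lemma A3w_convexA : A3w G g -> convexA G g (px g) (pxx g) (jet_section G g).
Proof. by move=> /A3w_convexU; exact: convexU_convexA. Qed.

Lemma no_common_descent_A3w :
  no_common_descent G g (px g) (jet_section G g) -> A3w G g.
Proof.
move=> nc; apply/A3w_convexU/(midpointU_convexU Hg SK).
exact: (no_common_descent_midpointU Hg SK nc).
Qed.

Lemma A3w_iff_A3w1 : A3w G g <-> A3w1 G g.
Proof.
split=> [/A3w_convexA cA|/A3w1_sublevel_gconvex sg].
  exact/A3w1_sublevel_gconvex/(convexA_sublevel_gconvex Hg SK).
exact: (no_common_descent_A3w (sublevel_gconvex_no_common_descent Hg SK sg)).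
Qed.

Lemma A3w_iff_A3w2 : A3w G g <-> A3w2 G g.
Proof.
split=> [/A3w_convexA cA|/A3w2_sections_max sm].
  exact/A3w2_sections_max/(convexA_sections_max Hg SK).
exact: (no_common_descent_A3w (sections_max_no_common_descent Hg SK sm)).
Qed.

End Equivalence.

Section Duality.
Context {R : realType} {n : nat}.
Notation T := ('rV[R]_n * 'rV[R]_n * R)%type.
Variables (G : set T) (g : T -> R).
Hypothesis H : regular G g.

Lemma A3w_dual : A3w G g -> A3w (dualpt g @` G) (gdual G g).
Proof.
have Hs := dual_regular H; move=> /(A3w_convexA H) cA.
apply: (no_common_descent_A3w Hs).
exact: (convexA_dual_no_common_descent (regular_genfun H) (jet_sectionK H)
  (regular_genfun Hs) (jet_sectionK Hs) (gdualK H) (px_gdual H) (rg_dec H) cA).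
Qed.

Lemma bidual_set : dualpt (gdual G g) @` (dualpt g @` G) = G.
Proof.
apply/seteqP; split=> [_ [_ [w Gw <-] <-]|w Gw].
  by rewrite /dualpt gdualK//; case: w Gw => -[].
by exists (dualpt g w) => //; rewrite /dualpt gdualK//; case: w Gw => -[].
Qed.

(** The bidual function agrees with [g] only on [G], so [g] itself, with its own derivatives, is
    supplied as the dual of [gdual G g]; only the domains need to be identified. *)
Lemma A3w_of_dual : A3w (dualpt g @` G) (gdual G g) -> A3w G g.
Proof.
have Hs := dual_regular H; move=> /(A3w_convexA Hs) cA.
apply: (no_common_descent_A3w H).
have := @convexA_dual_no_common_descent _ _ _ _ _ _ _ _ _ _ (regular_genfun Hs) _
  (jet_sectionK Hs) g (px g) (py g) (pz g) (pxx g) (pxy g) (pxz g) _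
  (jet_section G g).
rewrite bidual_set; apply.
- exact: regular_genfun.
- exact: jet_sectionK.
- by move=> _ [w Gw <-]; rewrite /dualpt gdualK//; case: w Gw => -[].
- move=> _ [w Gw <-]; rewrite (Q_gdual H Gw); congr px.
  by rewrite /dualpt gdualK//; case: w Gw => -[].
- exact: rg_dec Hs.
- exact: cA.
Qed.

End Duality.

Theorem theorem2p1 (R : realType) (n : nat)
    (G : set ('rV[R]_n * 'rV[R]_n * R)) (g : 'rV[R]_n * 'rV[R]_n * R -> R)
    (hG : generating_domain G) (hg : generating_function G g)
    (hA1 : A1 G g) (hA2 : A2 G g) (hA1star : A1star G g) :
  (A3w G g <-> A3wstar G g) /\ (A3w G g <-> A3w1 G g) /\ (A3w G g <-> A3w2 G g).
Proof.
have H := generating_regular hG hg hA1 hA2 hA1star.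
split; last by split; [exact: A3w_iff_A3w1|exact: A3w_iff_A3w2].
split=> [/(A3w_dual H)/(A3wstar_A3w_dual H)//|].
by move=> /(A3wstar_A3w_dual H)/(A3w_of_dual H).
Qed.
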